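(* Let $k\in\mathbb{N}$, $k\geq 4$ and $1/n\ll \nu, 1/k$. Let $G$ be a $C_{2k}$-divisible $\nu$-expander on $n$ vertices. If $k=4$, assume further that $\delta(G)\geq n/2$. Then $G$ has a $C_{2k}$-decomposition.
   Context: Graphs are finite and simple; $e(G)$ is the number of edges, $\delta(G)$ the minimum degree, $N_G(x)$ the neighbourhood of $x$, and $d_G(v,S):=|N_G(v)\cap S|$. $C_\ell$ denotes the cycle of length $\ell$. A graph $G$ is $C_\ell$-divisible if $e(G)$ is divisible by $\ell$ and every vertex of $G$ has even degree. A graph has a $C_\ell$-decomposition if its edge set can be partitioned into copies of $C_\ell$. Expanders: let $G$ be a graph on $n$ vertices. The robust neighbourhood of $S\subseteq V(G)$ is $R_{\nu,G}(S):=\{v\in V(G): d_G(v,S)\geq \nu n\}$. A set $S\subseteq V(G)$ is $\nu$-expanding in $G$ if $|R_{\nu,G}(S)|\geq n/2+\nu n$. $G$ is a $\nu$-expander if $N_G(x)$ is $\nu$-expanding in $G$ for every $x\in V(G)$. Hierarchy convention: $1/n\ll \nu,1/k$ means that for every $\nu>0$ and every $k$ as given there is an $n_0=n_0(\nu,k)$ such that the result holds for all $n\geq n_0$. *)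

(* Defs.v *)
From HB Require Import structures.
From mathcomp Require Import all_boot all_order all_algebra.
From mathcomp Require Import reals.

Set Implicit Arguments.
Unset Strict Implicit.
Unset Printing Implicit Defensive.

Import Order.TTheory GRing.Theory Num.Theory.
Local Open Scope ring_scope.

Record sgraph := SGraph {
  vertex :> finType;
  adj : rel vertex;
  adj_sym : symmetric adj;
  adj_irrefl : irreflexive adj
}.

Definition nbhd (G : sgraph) (x : G) : {set G} := [set y | adj x y].

Definition edges (G : sgraph) : {set {set G}} :=
  [set [set x; y] | x in [set: G], y in nbhd x].

Definition deg_in (G : sgraph) (v : G) (S : {set G}) : nat :=
  #|nbhd v :&: S|.

(* Degrees are smaller than #|G|, so the default value of the minimum only
   matters for the graph without vertices, which gets minimum degree 0. *)
Definition min_degree (G : sgraph) : nat :=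
  \big[minn/#|G|]_(x : G) #|nbhd x|.

Definition cycle_divisible (l : nat) (G : sgraph) : Prop :=
  (l %| #|edges G|)%N /\ forall x : G, ~~ odd #|nbhd x|.

(* B is the edge set of the copy of C_l in G that runs through the vertices
   of c in cyclic order; [ucycle] makes them distinct and consecutively
   adjacent, and l >= 3 excludes degenerate closed walks. *)
Definition is_cycle_copy (l : nat) (G : sgraph) (B : {set {set G}}) : Prop :=
  (2 < l)%N /\
  exists c : seq G,
    [/\ size c = l, ucycle (@adj G) c
      & B = [set [set x; next c x] | x in c]].

Definition has_cycle_decomposition (l : nat) (G : sgraph) : Prop :=
  exists P : {set {set {set G}}},
    partition P (edges G) /\ forall B, B \in P -> is_cycle_copy l B.

Definition robust_nbhd (R : realType) (nu : R) (G : sgraph) (S : {set G}) :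
    {set G} :=
  [set v | nu * #|G|%:R <= (deg_in v S)%:R].

Definition expanding (R : realType) (nu : R) (G : sgraph) (S : {set G}) :
    Prop :=
  #|G|%:R / 2 + nu * #|G|%:R <= #|robust_nbhd nu S|%:R :> R.

Definition expander (R : realType) (nu : R) (G : sgraph) : Prop :=
  forall x : G, expanding nu (nbhd x).

(* Main.v *)
Require Import Defs.
From mathcomp Require Import all_boot all_order all_algebra.
From mathcomp Require Import reals.
From mathcomp Require Import zify lra.

Set Implicit Arguments.
Unset Strict Implicit.
Unset Printing Implicit Defensive.

(* In an expander any two vertices are joined by paths of every length from 4
   on (also of length 3 if k = 4, by the minimum degree condition), even after
   deleting a graph of small maximum degree and few vertices; so paths with
   prescribed ends and lengths can be embedded greedily and edge-disjointly.

   First reserve a sparse subgraph E0 of G that is itself robustly connected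
   (from a random vertex colouring), then an absorber A, disjoint from E0, such
   that A together with any even subgraph of E0 with number of edges divisible
   by 2k decomposes.  Greedily remove 2k-cycles from the rest.  What remains is
   C_{2k}-free, so all but boundedly many of its vertices have small degree, and
   its edges can be covered by 2k-cycles whose other edges lie in E0.  The
   unused part of E0 inherits evenness and divisibility, and A absorbs it.

   The absorber is a bounded number of layers of paths.  Each edge xy of E0 that
   remains is traded for paths of length k: x to a hub p(x), y to a hub p(y), and
   p(x) and p(y) to a common hub q.  An even number of internally disjoint
   k-paths with the same ends pairs up into 2k-cycles.  At x the number of
   traded paths is even; between hubs p_i and q_j it need not be, but all row
   and column sums are even, so 2 x 2 squares of k-paths, chosen by
   two-dimensional prefix parities, correct it.  The number of edges modulo 2k
   is carried along a cyclic chain of loops of length 2k + 1.  All pieces are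
   closed walks of length divisible by 2k, and such a walk is absorbed by
   shifting it onto a bouquet of 2k-cycles. *)

(** * Edge multisets and decompositions *)

(** The remainder of E0 can be any of exponentially many graphs, far too many for one absorber each.
    So every edge of E0 carries its own bit (present or not), and all that edges exchange is a
    residue modulo 2k and the parities at the hubs. This leaves only O(n^2) closed walks, each with
    an absorber that decomposes both with and without its walk. The degree condition for k = 4 stems
    from the walk absorber alone. Shifting a walk closes each edge by two paths of total length 2k -
    1, in the most balanced case k and k - 1. Expansion makes the robust neighbourhoods of two ends
    meet in the middle of paths of length 4, but length 3 is out of its reach. E0 only has to supply
    lengths from 4 on. Densities are reciprocals of natural numbers, fixed in this order:
    connectivity of G, sparsity of E0 tolerated by the absorber, the much weaker connectivity of E0,
    and last the sparsity that the leftover must have to be covered inside E0. For this last step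
    low density would not do; in a C_{2k}-free graph the vertices above any degree threshold linear
    in n are boundedly many. *)

Ltac blia :=
  repeat match goal with
  | |- context [@bigop.body ?A ?B ?x ?y ?z] => generalize (@bigop.body A B x y z); intro
  | |- context [nat_of_bool ?b] => generalize (nat_of_bool b); intro
  end; lia.

(* Edge sets are multisets [{set V} -> nat]: decompositions then add up without
   any disjointness hypothesis, which is only checked for the final sum. *)
Section EdgeMultisets.
Variable V : finType.
Implicit Types (x y z u v : V) (s p c : seq V) (e : {set V}).
Implicit Types (M N F : {set V} -> nat) (adj : rel V).

Definition edge_mult x y e : nat := e == [set x; y].

Definition occ v s := count (pred1 v) s.

Fixpoint walk_mult x s e : nat :=
  if s is y :: s' then edge_mult x y e + walk_mult y s' e else 0.

Definition cycle_mult c e : nat :=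
  if c is x :: s then walk_mult x (rcons s x) e else 0.

(** The term [u = v] reads the singleton [[set v]], so this is the usual degree only for loopless
    [M]. *)
Definition degree M v := \sum_(u : V) M [set v; u].

Definition graph_mult adj e : nat :=
  [exists x, exists y, adj x y && (e == [set x; y])].

(** The cycles are mere vertex sequences. That they lie in a graph and are edge-disjoint is
    recovered at the very end, from the equality with a multiset whose values are 0 and 1. *)
Definition decomposable l M := exists2 cs : seq (seq V),
  all (fun c => uniq c && (size c == l)) cs
  & forall e, M e = \sum_(c <- cs) cycle_mult c e.

Lemma edge_multC x y e : edge_mult x y e = edge_mult y x e.
Proof. by rewrite /edge_mult setUC. Qed.

Lemma walk_mult_cat x s1 s2 e :
  walk_mult x (s1 ++ s2) e = walk_mult x s1 e + walk_mult (last x s1) s2 e.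
Proof. by elim: s1 x => //= y s1 IH x; rewrite IH addnA. Qed.

Lemma walk_mult_rcons x s y e :
  walk_mult x (rcons s y) e = walk_mult x s e + edge_mult (last x s) y e.
Proof. by rewrite -cats1 walk_mult_cat /= addn0. Qed.

Lemma walk_mult_rev x s y e :
  walk_mult y (rcons (rev s) x) e = walk_mult x (rcons s y) e.
Proof.
elim: s x => [|z s IH] x /=; first by rewrite edge_multC.
rewrite rev_cons walk_mult_rcons last_rcons IH edge_multC; lia.
Qed.

Lemma walk_mult_nth x0 x s e :
  walk_mult x s e
  = \sum_(i < size s) edge_mult (nth x0 (x :: s) i) (nth x0 (x :: s) i.+1) e.
Proof.
elim: s x => [|y s IH] x /=; first by rewrite big_ord0.
by rewrite big_ord_recl /= IH.
Qed.

Lemma decomposable_ext l M N : M =1 N -> decomposable l M -> decomposable l N.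
Proof. by move=> MN [cs cs_cyc Mcs]; exists cs => // e; rewrite -MN. Qed.

Lemma decomposable0 l : decomposable l (fun=> 0).
Proof. by exists [::] => // e; rewrite big_nil. Qed.

Lemma decomposableD l M N :
  decomposable l M -> decomposable l N ->
  decomposable l (fun e => M e + N e).
Proof.
move=> [cs1 C1 E1] [cs2 C2 E2]; exists (cs1 ++ cs2).
  by rewrite all_cat C1.
by move=> e; rewrite big_cat /= E1 E2.
Qed.

Lemma decomposable_cycle l c :
  uniq c -> size c = l -> decomposable l (cycle_mult c).
Proof.
move=> uc sc; exists [:: c]; first by rewrite /= uc sc eqxx.
by move=> e; rewrite big_seq1.
Qed.

Lemma decomposable_sum l (I : Type) (r : seq I) (P : pred I) (M : I -> {set V} -> nat) :
  (forall i, P i -> decomposable l (M i)) ->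
  decomposable l (fun e => \sum_(i <- r | P i) M i e).
Proof.
move=> dM; elim: r => [|i r IH].
  by apply: decomposable_ext (decomposable0 l) => e; rewrite big_nil.
case Pi: (P i); last first.
  by apply: decomposable_ext IH => e; rewrite big_cons Pi.
apply: decomposable_ext (decomposableD (dM i Pi) IH) => e.
by rewrite big_cons Pi.
Qed.

Lemma degreeD M N v : degree (fun e => M e + N e) v = degree M v + degree N v.
Proof. by rewrite /degree big_split. Qed.

Lemma degree_sum (I : Type) (r : seq I) (P : pred I) (M : I -> {set V} -> nat) v :
  degree (fun e => \sum_(i <- r | P i) M i e) v
  = \sum_(i <- r | P i) degree (M i) v.
Proof. by rewrite /degree exchange_big. Qed.

Lemma eq_degree M N v : M =1 N -> degree M v = degree N v.
Proof. by move=> MN; apply: eq_bigr => u _; rewrite MN. Qed.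

Lemma leq_degree M N v : (forall e, M e <= N e) -> degree M v <= degree N v.
Proof. by move=> MN; apply: leq_sum => u _. Qed.

Lemma pair_set_eq x y z t : ([set x; y] == [set z; t])
  = (x == z) && (y == t) || (x == t) && (y == z).
Proof.
apply/eqP/orP => [E|[/andP[/eqP-> /eqP->]|/andP[/eqP-> /eqP->]]] //; last first.
  by rewrite setUC.
have := set21 x y; rewrite E !inE => Hx.
have := set22 x y; rewrite E !inE => Hy.
have := set21 z t; rewrite -E !inE => Hz.
have := set22 z t; rewrite -E !inE => Ht.
by case/orP: Hx => /eqP ?; subst x; case/orP: Hy => /eqP ?; subst y;
  rewrite ?eqxx ?orbT /=; auto;
  move: Hz Ht; rewrite ?orbb => /eqP ? /eqP ?; subst; rewrite ?eqxx; auto.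
Qed.

Lemma degree_edge x y v : x != y ->
  degree (edge_mult x y) v = (v == x) + (v == y).
Proof.
move=> xy; rewrite /degree /edge_mult.
transitivity (\sum_(u : V) ((v == x) && (u == y) + (v == y) && (u == x))).
  apply: eq_bigr => u _; rewrite pair_set_eq.
  case: (eqVneq v x) => [->|_] //=; first by rewrite (negbTE xy) orbF addn0.
have S (a : V) : \sum_(u : V) (u == a) = 1.
  by rewrite (bigD1 a) //= eqxx big1 // => u /negbTE ->.
by rewrite big_split /=; congr (_ + _); case: eqVneq => _ /=; rewrite ?S // big1.
Qed.

(** A visit to an inner vertex uses two edges, an end only one. As only consecutive vertices must
    differ, this also covers walks with repetitions and closed ones, where [x = y] counts twice. *)
Lemma path_neq_walk_degree x s y v :
  path (fun a b => a != b) x (rcons s y) ->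
  degree (walk_mult x (rcons s y)) v
  = (v == x) + (v == y) + 2 * occ v s.
Proof.
elim: s x => [|z s IH] x /=.
  rewrite andbT => xy; rewrite -(degree_edge v xy) muln0 addn0.
  by apply: eq_degree => e /=; rewrite addn0.
case/andP=> xz pz.
rewrite degreeD degree_edge // IH // (eq_sym z v) /occ mulnDr -!/(occ _ _); blia.
Qed.

Lemma ms_sub M N : (forall e, N e <= M e) -> exists M', forall e, M e = N e + M' e.
Proof. by move=> NM; exists (fun e => M e - N e) => e; rewrite subnKC. Qed.

Lemma walk_mult_notin x s z e : z \in e -> z \notin x :: s -> walk_mult x s e = 0.
Proof.
move=> ze; elim: s x => //= y s IH x.
rewrite !inE !negb_or => /and3P[zx zy zs].
rewrite IH ?inE ?negb_or ?zy // addn0 /edge_mult.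
by case: eqP => // E; move: ze; rewrite E !inE (negbTE zx) (negbTE zy).
Qed.

Lemma walk_mult_le1 x s e : uniq (x :: s) -> walk_mult x s e <= 1.
Proof.
elim: s x => //= y s IH x /andP[xys us].
have := IH y us; rewrite /edge_mult; case: eqP => //= E _.
by rewrite (walk_mult_notin (z := x)) // E set21.
Qed.

(** [x = y] is allowed, so the path may close up to a cycle; [1 < size p] then excludes going along
    one edge and back. *)
Lemma walk_mult_rcons_le1 x p y e : uniq p -> x \notin p -> y \notin p ->
  1 < size p -> walk_mult x (rcons p y) e <= 1.
Proof.
move=> up xp yp sp; rewrite walk_mult_rcons.
have := @walk_mult_le1 x p e; rewrite /= xp up => /(_ isT).
rewrite /edge_mult; case: eqP => [->|_]; last by rewrite addn0.
move=> _; case: p up xp yp sp => [//|a [//|b p]] up xp yp _.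
rewrite [last x _]/= [walk_mult x _ _]/= -[edge_mult a b _ + _]/(walk_mult a (b :: p) _).
rewrite (walk_mult_notin (z := y) (x := a)) ?set22 // addn0.
rewrite /edge_mult pair_set_eq.
have l_in : last b p \in b :: p by exact: mem_last.
have -> : (last b p == a) = false.
  by apply/negbTE; apply: contraTneq up => <-; rewrite /= l_in.
have -> : (last b p == x) = false.
  by apply/negbTE; apply: contraNneq xp => <-; rewrite inE l_in orbT.
by [].
Qed.

Lemma decomposable_even_degree l M v : 2 < l -> decomposable l M -> ~~ odd (degree M v).
Proof.
move=> l2 [cs Hcs EM]; rewrite (eq_degree v EM) degree_sum.
elim: cs Hcs {EM} => [|c cs IH] /=; first by rewrite big_nil.
case/andP=> /andP[uc /eqP sc] /IH; rewrite big_cons oddD => /negbTE ->.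
rewrite addbF; case: c uc sc => [|x s] /=; first by move=> _ E; move: l2; rewrite -E.
move=> us sl.
rewrite path_neq_walk_degree; first by rewrite addnn oddD odd_double oddM.
have s1 : 1 < size s by lia.
case: s us s1 {sl} => [//|a s] /= /andP[xas uas] _.
have hx : x != a by apply: contraNneq xas => ->; rewrite inE eqxx.
rewrite hx /=.
elim: s a uas xas hx => [|b s IHs] a /= .
  by move=> _ _; rewrite eq_sym andbT.
move=> /andP[abs ub] xabs hx.
have -> : a != b by apply: contraNneq abs => ->; rewrite inE eqxx.
apply: IHs => //.
  by apply: contra xabs; rewrite !inE => ->; rewrite orbT.
by apply: contraNneq xabs => ->; rewrite !inE eqxx orbT.
Qed.

Definition msize M := \sum_(e : {set V}) M e.

Lemma msize_walk x s : msize (walk_mult x s) = size s.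
Proof.
rewrite /msize; elim: s x => [|y s IH] x /=; first by rewrite big1.
rewrite big_split /= IH /edge_mult (bigD1 [set x; y]) //= eqxx big1 //.
by move=> e /negbTE ->.
Qed.

Lemma msize_decomposable l M : decomposable l M -> l %| msize M.
Proof.
case=> cs Hcs EM; rewrite /msize (eq_bigr _ (fun e _ => EM e)) exchange_big /=.
rewrite big_seq; apply: dvdn_sum => c /(allP Hcs) /andP[uc /eqP sc].
case: c uc sc => [|x s] uc sc; first by rewrite big1.
by have := msize_walk x (rcons s x); rewrite /msize /= => ->; rewrite size_rcons -sc.
Qed.

Lemma graph_multP adj x y : symmetric adj ->
  graph_mult adj [set x; y] = adj x y.
Proof.
move=> sadj; rewrite /graph_mult; congr nat_of_bool.
apply/existsP/idP => [[a /existsP[b /andP[ab]]]|xy].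
  rewrite pair_set_eq => /orP[/andP[/eqP-> /eqP->] //|/andP[/eqP-> /eqP->]].
  by rewrite sadj.
by exists x; apply/existsP; exists y; rewrite xy eqxx.
Qed.

Lemma walk_mult_le_graph adj x s : symmetric adj ->
  (forall e, walk_mult x s e <= graph_mult adj e) -> path adj x s.
Proof.
move=> sadj; elim: s x => //= y s IH x H; apply/andP; split.
  have := H [set x; y]; rewrite graph_multP // /edge_mult eqxx.
  by case: (adj x y).
by apply: IH => e; apply: leq_trans (H e); rewrite leq_addl.
Qed.

Lemma graph_mult_le1 adj e : graph_mult adj e <= 1.
Proof. exact: leq_b1. Qed.

End EdgeMultisets.
Arguments cycle_mult : simpl never.

(** * Robust connection and greedy embedding *)

Section RobustConnection.
Variables (V : finType) (adj : rel V).
Hypothesis adj_irr : irreflexive adj.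

(* The constraints [#|O| * q <= #|V|] and [degree F v * q <= #|V|] say that O and
   F are at most a 1/q-fraction of all vertices, respectively of a full degree.
   For x = y the path is a closed walk through x. *)
Definition robustly_connected (q L : nat) :=
  forall (x y : V) (O : {set V}) (F : {set V} -> nat),
    #|O| * q <= #|V| -> (forall v, degree F v * q <= #|V|) ->
  exists p : seq V,
    [/\ size p = L.-1, uniq p, {in p, forall v, v \notin O}
      & path (fun a b => adj a b && (F [set a; b] == 0)) x (rcons p y)].

Lemma robustly_connectedW q q' L :
  q <= q' -> robustly_connected q L -> robustly_connected q' L.
Proof.
move=> qq' H x y O F hO hF; apply: H => [|v].
  by apply: leq_trans hO; rewrite leq_mul2l qq' orbT.
by apply: leq_trans (hF v); rewrite leq_mul2l qq' orbT.
Qed.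

Lemma walk_mult_gt0 (r : rel V) x s e :
  path r x s -> 0 < walk_mult x s e -> exists a b, r a b /\ e = [set a; b].
Proof.
elim: s x => //= y s IH x /andP[rxy ps]; rewrite /edge_mult.
by case: eqP => [-> _|_ /(IH _ ps)//]; exists x, y.
Qed.

(** On the edges of the walk [M] vanishes and the graph has an edge, elsewhere nothing is added.
    This is how greedily added paths stay edge-disjoint. *)
Lemma walk_avoiding_le_graph (M : {set V} -> nat) x s e :
  path (fun a b => adj a b && (M [set a; b] == 0)) x s ->
  walk_mult x s e <= 1 -> M e <= graph_mult adj e ->
  M e + walk_mult x s e <= graph_mult adj e.
Proof.
move=> ps le1 Me; case: (posnP (walk_mult x s e)) => [->|gt0]; first by rewrite addn0.
have [a [b [/andP[ab /eqP M0] E]]] := walk_mult_gt0 ps gt0.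
rewrite {1}E M0 add0n; apply: leq_trans le1 _.
rewrite /graph_mult; case: existsP => // -[]; exists a; apply/existsP; exists b.
by rewrite ab E eqxx.
Qed.

Lemma path_adj_neq x s : path adj x s -> path (fun a b => a != b) x s.
Proof.
by apply: sub_path => a b; apply: contraTneq => ->; rewrite adj_irr.
Qed.

(** * Greedy edge-disjoint embedding of paths with prescribed ends *)

Section Embedding.
(** Budgets: [f] bounds the degrees of the forbidden edges [F], [a] the path ends at a vertex, [thr]
    the number of times a vertex may be an inner vertex, [ov] the number of vertices that have
    reached [thr], and [s] the private forbidden sets [S d]. *)
Variables (q Lmin Lmax s thr a f ov : nat).
Hypothesis Lmin3 : 3 <= Lmin.
Hypothesis conn : forall L, Lmin <= L <= Lmax -> robustly_connected q L.
Variables (D : finType) (A : {set D}) (x y : D -> V) (L : D -> nat).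
Variables (S : D -> {set V}) (F : {set V} -> nat).
Hypothesis L_range : forall d, d \in A -> Lmin <= L d <= Lmax.
Hypothesis S_small : forall d, d \in A -> #|S d| <= s.
Hypothesis F_small : forall v, degree F v <= f.
Hypothesis load : forall v, \sum_(d in A) ((v == x d) + (v == y d)) <= a.
Hypothesis thr_gt0 : 0 < thr.
Hypothesis deg_ok : (f + 2 * thr + a) * q <= #|V|.
Hypothesis ov_ok : #|V| * a * Lmax <= 2 * thr * ov.
Hypothesis O_ok : (ov + s + 2 + 2 * a * Lmax) * q <= #|V|.

(** Two paths that are later glued into one cycle always have a common end, so only such pairs need
    disjoint interiors; for all others edge-disjointness is enough. *)
Definition share_end d d' :=
  [|| x d == x d', x d == y d', y d == x d' | y d == y d'].

Definition token_mult (g : D -> seq V) d := walk_mult (x d) (rcons (g d) (y d)).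

Definition token_ok (g : D -> seq V) d :=
  [/\ size (g d) = (L d).-1, uniq (g d),
      {in g d, forall v, [/\ v \notin S d, v != x d & v != y d]}
    & path adj (x d) (rcons (g d) (y d))].

Lemma sum_sub_uniq (h : D -> nat) (ds : seq D) : uniq ds -> {subset ds <= A} ->
  \sum_(d <- ds) h d <= \sum_(d in A) h d.
Proof.
move=> uds dsA; rewrite big_uniq //= big_mkcond [X in _ <= X]big_mkcond /=.
by apply: leq_sum => d _; case: ifP => // /dsA ->.
Qed.

Lemma sum_card_count (g : seq V) : \sum_(v : V) occ v g = size g.
Proof.
elim: g => [|z g IH] /=; first by rewrite big1.
by rewrite /occ /= big_split /= -/(occ _ _) IH (bigD1 z) //= eqxx big1 // => u; rewrite eq_sym => /negbTE ->.
Qed.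

Lemma token_degree (g : D -> seq V) d v : token_ok g d ->
  degree (token_mult g d) v = (v == x d) + (v == y d) + 2 * occ v (g d).
Proof.
by case=> _ _ _ pd; rewrite /token_mult path_neq_walk_degree //; apply: path_adj_neq.
Qed.

Lemma token_ok_ext (g g' : D -> seq V) d : g d = g' d -> token_ok g d -> token_ok g' d.
Proof. by rewrite /token_ok => ->. Qed.

Lemma demand_count : 2 * #|A| <= #|V| * a.
Proof.
rewrite -[_ * a]sum_nat_const.
apply: leq_trans (_ : \sum_(v : V) \sum_(d in A) ((v == x d) + (v == y d)) <= _); last first.
  by apply: leq_sum => v _.
rewrite exchange_big /= mulnC -sum_nat_const; apply: leq_sum => d _.
rewrite big_split /=.
have S1 (z : V) : \sum_(v : V) (v == z) = 1.
  by rewrite (bigD1 z) //= eqxx big1 // => u /negbTE ->.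
by rewrite !S1.
Qed.

(* Vertices used [thr] times become forbidden; there are at most [ov] of them
   because the total length of all paths is bounded. *)
Lemma embed_list (ds : seq D) : uniq ds -> {subset ds <= A} ->
  exists g : D -> seq V,
  [/\ {in ds, forall d, token_ok g d},
      {in ds &, forall d d', d != d' -> share_end d d' ->
         forall u, u \in g d -> u \notin g d'},
      forall e, F e <= graph_mult adj e ->
        F e + \sum_(d <- ds) token_mult g d e <= graph_mult adj e
    & forall v, \sum_(d <- ds) occ v (g d) <= thr].
Proof.
elim: ds => [|d ds IH] /=.
  by exists (fun=> [::]); split=> // [e He|v]; rewrite big_nil ?addn0.
case/andP=> dds uds dsA.
have dsA' : {subset ds <= A} by move=> d' d'ds; apply: dsA; rewrite inE d'ds orbT.
have dA : d \in A by apply: dsA; rewrite inE eqxx.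
have [g [g_ok g_disj g_le g_use]] := IH uds dsA'.
pose M e := F e + \sum_(d' <- ds) token_mult g d' e.
have M_deg v : degree M v <= f + 2 * thr + a.
  rewrite /M degreeD degree_sum.
  rewrite (eq_big_seq (fun d' => ((v == x d') + (v == y d')) + 2 * occ v (g d'))); last first.
    by move=> d' d'ds; rewrite token_degree //; apply: g_ok.
  rewrite big_split /= -big_distrr /=.
  have := sum_sub_uniq (fun d' => (v == x d') + (v == y d')) uds dsA'.
  have := load v; have := g_use v; have := F_small v.
  blia.
pose over := [set v | thr <= \sum_(d' <- ds) occ v (g d')].
pose near := flatten [seq g d' | d' <- ds & share_end d d'].
(* [conn] does not keep inner vertices away from the ends, hence [x d] and [y d] are forbidden
   explicitly. *)
pose O := S d :|: [set x d; y d] :|: over :|: [set v in near].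
have near_size : size near <= 2 * a * Lmax.
  rewrite /near size_flatten sumnE big_map big_map big_filter.
  apply: leq_trans (_ : \sum_(d' <- ds | share_end d d') Lmax <= _).
    rewrite big_seq_cond [X in _ <= X]big_seq_cond; apply: leq_sum => d' /andP[d'ds _].
    have [-> _ _ _] := g_ok _ d'ds; have := L_range (dsA' _ d'ds); lia.
  rewrite (eq_bigr (fun=> 1 * Lmax)) => [|d' _]; last by rewrite mul1n.
  rewrite -big_distrl /= leq_mul2r; apply/orP; right.
  have H1 := sum_sub_uniq (fun d' => (x d == x d') + (x d == y d')) uds dsA'.
  have H2 := sum_sub_uniq (fun d' => (y d == x d') + (y d == y d')) uds dsA'.
  have := load (x d); have := load (y d).
  (* A demand sharing an end with [d] makes one of four indicators equal to 1, and the loads at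
     [x d] and at [y d] are at most [a] each. *)
  suff : \sum_(d' <- ds | share_end d d') 1 <=
     \sum_(d' <- ds) ((x d == x d') + (x d == y d')) +
     \sum_(d' <- ds) ((y d == x d') + (y d == y d')) by lia.
  rewrite -big_split /= big_mkcond /=; apply: leq_sum => d' _.
  by rewrite /share_end; do 4 case: eqP => _ //=.
have over_size : #|over| <= ov.
  rewrite -(leq_pmul2l (m := 2 * thr)); last by lia.
  apply: leq_trans ov_ok; rewrite -mulnA (mulnC thr).
  apply: leq_trans (_ : 2 * (#|A| * Lmax) <= _); last by have := demand_count; nia.
  rewrite leq_mul2l /=.
  apply: leq_trans (_ : \sum_(v : V) \sum_(d' <- ds) occ v (g d') <= _).
    rewrite -sum_nat_const big_mkcond /=; apply: leq_sum => v _.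
    by case: ifP => //; rewrite inE.
  rewrite exchange_big /=.
  apply: leq_trans (_ : \sum_(d' <- ds) Lmax <= _).
    rewrite big_seq [X in _ <= X]big_seq; apply: leq_sum => d' d'ds.
    rewrite sum_card_count; have [-> _ _ _] := g_ok _ d'ds.
    have := L_range (dsA' _ d'ds); lia.
  by apply: leq_trans (sum_sub_uniq _ uds dsA') _; rewrite sum_nat_const.
have O_size : #|O| <= ov + s + 2 + 2 * a * Lmax.
  rewrite /O; apply: leq_trans (leq_card_setU _ _) _.
  have c1 : #|[set v in near]| <= 2 * a * Lmax.
    by apply: leq_trans near_size; rewrite cardsE card_size.
  have c2 : #|S d :|: [set x d; y d] :|: over| <= #|S d| + 2 + #|over|.
    apply: leq_trans (leq_card_setU _ _) _; rewrite leq_add2r.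
    apply: leq_trans (leq_card_setU _ _) _; rewrite leq_add2l.
    by rewrite cards2; case: eqP.
  have := S_small dA; lia.
have [p [sp up pO pp]] : exists p : seq V,
    [/\ size p = (L d).-1, uniq p, {in p, forall v, v \notin O}
      & path (fun a b => adj a b && (M [set a; b] == 0)) (x d) (rcons p (y d))].
  apply: conn; first exact: L_range.
    by apply: leq_trans O_ok; rewrite leq_mul2r O_size orbT.
  by move=> v; apply: leq_trans deg_ok; rewrite leq_mul2r M_deg orbT.
have pO' v : v \in p -> [/\ v \notin S d, v != x d, v != y d, v \notin over & v \notin near].
  by move=> /pO; rewrite !inE !negb_or => /andP[/andP[/andP[-> /andP[-> ->]] ->] ->].
have g'E d' : d' \in ds -> (if d' == d then p else g d') = g d'.
  by move=> d'ds; case: eqP => // E; rewrite -E d'ds in dds.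
exists (fun d' => if d' == d then p else g d'); split.
- move=> d'; rewrite inE => /predU1P[->|d'ds].
    split; rewrite ?eqxx //; first by move=> v /pO' [].
    by apply: sub_path pp => b c /andP[].
  by apply: token_ok_ext (g_ok _ d'ds); rewrite g'E.
- move=> d1 d2; rewrite !inE => /predU1P[->|d1ds] /predU1P[->|d2ds].
  + by rewrite eqxx.
  + move=> _ sh u; rewrite eqxx (g'E _ d2ds) => /pO' [_ _ _ _].
    apply: contra => ug; apply/flattenP; exists (g d2) => //.
    by apply: map_f; rewrite mem_filter sh.
  + move=> _ sh u; rewrite eqxx (g'E _ d1ds) => ug; apply/negP => /pO' [_ _ _ _].
    case/negP; apply/flattenP; exists (g d1) => //.
    apply: map_f; rewrite mem_filter d1ds andbT.
    by move: sh; rewrite /share_end => /or4P[] /eqP ->; rewrite eqxx ?orbT.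
  + by move=> ne sh u; rewrite (g'E _ d1ds) (g'E _ d2ds); apply: g_disj.
- move=> e Fe; rewrite big_cons /token_mult eqxx.
  have /(_ e Fe) Mle := g_le; rewrite addnCA addnC.
  have -> : F e + \sum_(d' <- ds) walk_mult (x d')
      (rcons (if d' == d then p else g d') (y d')) e = M e.
    by congr (_ + _); apply: eq_big_seq => d' d'ds; rewrite g'E.
  apply: walk_avoiding_le_graph => //.
  apply: walk_mult_rcons_le1 => //.
  + by apply/negP => /pO' [_ /eqP].
  + by apply/negP => /pO' [_ _ /eqP].
  + by have := L_range dA; lia.
- move=> v; rewrite big_cons eqxx.
  rewrite (eq_big_seq (fun d' => occ v (g d'))); last by move=> d' /g'E ->.
  have := g_use v; rewrite [occ v p]count_uniq_mem //.
  case vp: (v \in p) => //=; have [_ _ _ vo _] := pO' v vp => _.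
  by move: vo; rewrite inE -ltnNge.
Qed.

Lemma embed_all : (forall e, F e <= graph_mult adj e) ->
  exists g : D -> seq V,
  [/\ {in A, forall d, token_ok g d},
      {in A &, forall d d', d != d' -> share_end d d' ->
         forall u, u \in g d -> u \notin g d'},
      forall e, F e + \sum_(d in A) token_mult g d e <= graph_mult adj e
    & forall v, degree (fun e => \sum_(d in A) token_mult g d e) v <= a + 2 * thr].
Proof.
move=> Fle; have [||g [g1 g2 g3 g4]] := embed_list (ds := enum A).
- exact: enum_uniq.
- by move=> d; rewrite mem_enum.
exists g; split.
- by move=> d dA; apply: g1; rewrite mem_enum.
- by move=> d d' dA d'A; apply: g2; rewrite mem_enum.
- by move=> e; have := g3 e (Fle e); rewrite big_enum.
- move=> v; rewrite degree_sum.
  rewrite (eq_bigr (fun d' => ((v == x d') + (v == y d')) + 2 * occ v (g d'))); last first.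
    by move=> d' d'ds; rewrite token_degree //; apply: g1; rewrite mem_enum.
  rewrite big_split /= -big_distrr /=.
  have := load v; have := g4 v; rewrite big_enum /=; lia.
Qed.
End Embedding.
End RobustConnection.

(** The quotient enters only through these three bounds, so the choice of constants below works
    without division. *)
Lemma div_bounds n d : 0 < d -> exists t, [/\ t * d <= n, n < t.+1 * d
  & forall m, m * d <= n -> m <= t].
Proof.
move=> d0; exists (n %/ d); split; first exact: leq_trunc_div.
  by rewrite mulnC; have := ltn_ceil n d0; rewrite mulnC.
by move=> m; rewrite leq_divRL.
Qed.

Lemma embedding_parameters q q' Lmax s : 0 < q -> exists q1 n1, forall n, n1 <= n ->
  exists thr a f ov,
  [/\ 0 < thr, (f + 2 * thr + a) * q <= n, n * a * Lmax <= 2 * thr * ov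
    & (ov + s + 2 + 2 * a * Lmax) * q <= n] /\
  [/\ (forall m, m * (2 * q) <= n -> m <= f), (forall m, m * q1 <= n -> m <= a)
    & (a + 2 * thr) * q' <= n].
Proof.
move=> q0.
have [X [X0 Xq Xq']] : exists X, [/\ 0 < X, 16 * q <= X & 16 * q' <= X].
  by exists (16 * q + 16 * q'); split; lia.
(* With [thr] at least n/(2X), [ov] at least n/(16q) and [a] at most n/q1, the condition
   [n * a * Lmax <= 2 * thr * ov] asks for q1 at least 16 q X Lmax. *)
have [q1 Eq1] : exists q1, q1 = 16 * q * X * Lmax.+1 by eexists.
exists q1, (X + 8 * q * s.+2) => n nn.
have q1X : X <= q1 by rewrite Eq1 (_ : 16 * q * X * Lmax.+1 = X * (16 * q * Lmax.+1)); [rewrite leq_pmulr //; lia | lia].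
have q10 : 0 < q1 by apply: leq_trans q1X.
have q1L : 16 * q * Lmax <= q1.
  rewrite Eq1 (_ : 16 * q * X * Lmax.+1 = 16 * q * Lmax.+1 * X); last by lia.
  apply: leq_trans (_ : 16 * q * Lmax.+1 <= _); last by rewrite leq_pmulr.
  by rewrite leq_mul2l leqnSn orbT.
have [thr [ht1 ht2 _]] := div_bounds n X0.
have [a [ha _ ha2]] := div_bounds n q10.
have q20 : 0 < 2 * q by lia.
have [f [hf _ hf2]] := div_bounds n q20.
have q80 : 0 < 8 * q by lia.
have [ov [ho1 ho2 _]] := div_bounds n q80.
have thr0 : 0 < thr by case: thr ht2 {ht1} => //; rewrite mul1n; lia.
have ov0 : 0 < ov by case: ov ho2 {ho1} => //; rewrite mul1n; lia.
have aq : a * (16 * q) <= n by apply: leq_trans ha; rewrite leq_mul2l; lia.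
have aq' : a * (16 * q') <= n by apply: leq_trans ha; rewrite leq_mul2l; lia.
have aL : a * (16 * q * Lmax) <= n by apply: leq_trans ha; rewrite leq_mul2l; lia.
have tq : thr * (16 * q) <= n by apply: leq_trans ht1; rewrite leq_mul2l; lia.
have tq' : thr * (16 * q') <= n by apply: leq_trans ht1; rewrite leq_mul2l; lia.
have sq : 8 * q * s.+2 <= n by lia.
have h1 : (f + 2 * thr + a) * q <= n by lia.
have h3 : (ov + s + 2 + 2 * a * Lmax) * q <= n by lia.
have n1 : n <= 2 * thr * X by have : X <= thr * X; [exact: leq_pmull | lia].
have n2 : n <= 16 * ov * q by have : q <= ov * q; [exact: leq_pmull | lia].
have h2 : n * a * Lmax <= 2 * thr * ov.
  rewrite -(leq_pmul2r q10).
  apply: leq_trans (_ : n * n * Lmax <= _).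
    rewrite (_ : _ * q1 = n * (a * q1) * Lmax); last by lia.
    by rewrite leq_mul2r leq_mul2l ha !orbT.
  apply: leq_trans (_ : (2 * thr * X) * (16 * ov * q) * Lmax <= _).
    by rewrite leq_mul2r leq_mul ?orbT.
  by rewrite Eq1; clear; lia.
exists thr, a, f, ov; split; split=> //; clear -aq' tq'; lia.
Qed.

(** [q1] is the sparsity required of the path ends, [q'] the sparsity wished for the union of the
    paths. Since [q'] is prescribed in advance, embeddings can be stacked: each output is sparse
    enough to be avoided by the next one. *)
Lemma robust_embedding (q Lmin Lmax s q' : nat) : 0 < q -> 3 <= Lmin ->
  exists q1 n1 : nat, forall (V : finType) (adj : rel V),
  irreflexive adj ->
  (forall L, Lmin <= L <= Lmax -> robustly_connected adj q L) ->
  n1 <= #|V| ->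
  forall (D : finType) (A : {set D}) (x y : D -> V) (L : D -> nat)
         (S : D -> {set V}) (F : {set V} -> nat),
  (forall d, d \in A -> Lmin <= L d <= Lmax) ->
  (forall d, d \in A -> #|S d| <= s) ->
  (forall v, degree F v * (2 * q) <= #|V|) ->
  (forall v, (\sum_(d in A) ((v == x d) + (v == y d))) * q1 <= #|V|) ->
  (forall e, F e <= graph_mult adj e) ->
  exists g : D -> seq V,
  [/\ {in A, forall d, token_ok adj x y L S g d},
      {in A &, forall d d', d != d' -> share_end x y d d' ->
         forall u, u \in g d -> u \notin g d'},
      forall e, F e + \sum_(d in A) token_mult x y g d e <= graph_mult adj e
    & forall v, degree (fun e => \sum_(d in A) token_mult x y g d e) v * q' <= #|V|].
Proof.
move=> q0 L3; have [q1 [n1 par]] := embedding_parameters q' Lmax s q0.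
exists q1, n1 => V adj irr conn nV D A x y L S F Lr Ss Fs load Fle.
have [thr [a [f [ov [[h0 h1 h2 h3] [hf ha hq]]]]]] := par _ nV.
have [g [g1 g2 g3 g4]] := @embed_all V adj irr q Lmin Lmax s thr a f ov L3 conn
   D A x y L S F Lr Ss (fun v => hf _ (Fs v)) (fun v => ha _ (load v)) h0 h1 h2 h3 Fle.
exists g; split=> // v; apply: leq_trans hq.
by rewrite leq_mul2r g4 orbT.
Qed.

(** * Absorbing closed walks *)

Section WalkAbsorber.
Variable V : finType.
Implicit Types (x y w : V) (s p : seq V) (e : {set V}).

Lemma sum_next_mod N (h : nat -> nat) :
  \sum_(i < N) h (i.+1 %% N) = \sum_(i < N) h i.
Proof. by rewrite [RHS](reindex_inj (@ordS_inj N)). Qed.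

Lemma walk_mult_rcons_cat x s1 y s2 e :
  walk_mult x (rcons s1 y ++ s2) e
  = walk_mult x (rcons s1 y) e + walk_mult y s2 e.
Proof. by rewrite walk_mult_cat last_rcons. Qed.

(* The cycle x y s1 z s2^-1 x, where s1 joins y to z and s2 joins x to z. *)
Definition cell x y s1 z s2 := x :: y :: s1 ++ z :: rev s2.

Lemma cycle_mult_cell x y s1 z s2 e :
  cycle_mult (cell x y s1 z s2) e
  = edge_mult x y e + walk_mult y (rcons s1 z) e + walk_mult x (rcons s2 z) e.
Proof.
rewrite /cell /cycle_mult [LHS]/= -addnA; congr (_ + _).
by rewrite rcons_cat rcons_cons -cat_rcons walk_mult_rcons_cat walk_mult_rev.
Qed.

(* The paths R i from v (i+1) to v' i and S i from v i to v' i close up with the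
   edge v i v (i+1), but equally (R i with S (i+1)) with v' i v' (i+1): the same
   paths decompose together with either closed walk. *)
Lemma decomposable_shifted_walks l N (v v' : nat -> V) (R S : nat -> seq V) :
  v N = v 0 -> v' N = v' 0 ->
  (forall i, i < N -> let c := cell (v i) (v i.+1) (R i) (v' i) (S i) in
     uniq c /\ size c = l) ->
  (forall i, i < N ->
     let c := cell (v' i) (v' i.+1) (rev (S (i.+1 %% N))) (v i.+1) (rev (R i)) in
     uniq c /\ size c = l) ->
  let T e := \sum_(i < N) (walk_mult (v i.+1) (rcons (R i) (v' i)) e
                           + walk_mult (v i) (rcons (S i) (v' i)) e) in
  decomposable l (fun e => \sum_(i < N) edge_mult (v i) (v i.+1) e + T e) /\
  decomposable l (fun e => \sum_(i < N) edge_mult (v' i) (v' i.+1) e + T e).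
Proof.
move=> vN v'N C1 C2 T; split.
  apply: decomposable_ext (decomposable_sum (index_enum 'I_N) (P := xpredT)
    (M := fun i : 'I_N => cycle_mult (cell (v i) (v i.+1) (R i) (v' i) (S i))) _).
    move=> e; rewrite /T -big_split /=; apply: eq_bigr => i _.
    by rewrite cycle_mult_cell addnA.
  by move=> i _; have [] := C1 i (ltn_ord i); apply: decomposable_cycle.
apply: decomposable_ext (decomposable_sum (index_enum 'I_N) (P := xpredT)
  (M := fun i : 'I_N => cycle_mult
    (cell (v' i) (v' i.+1) (rev (S (i.+1 %% N))) (v i.+1) (rev (R i)))) _).
  move=> e; transitivity (\sum_(i < N) (edge_mult (v' i) (v' i.+1) e
      + walk_mult (v i.+1) (rcons (R i) (v' i)) e
      + walk_mult (v (i.+1 %% N)) (rcons (S (i.+1 %% N)) (v' (i.+1 %% N))) e)).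
    apply: eq_bigr => i _.
    have [Ev Ev'] : v (i.+1 %% N) = v i.+1 /\ v' (i.+1 %% N) = v' i.+1.
      have := ltn_ord i; rewrite leq_eqVlt => /predU1P[->|lt]; last by rewrite modn_small.
      by rewrite modnn.
    by rewrite cycle_mult_cell Ev Ev' !walk_mult_rev addnAC.
  rewrite /T !big_split (sum_next_mod N
    (fun i => walk_mult (v i) (rcons (S i) (v' i)) e)) addnA.
  by [].
by move=> i _; have [] := C2 i (ltn_ord i); apply: decomposable_cycle.
Qed.

Lemma last_flatten_loops w (ps : seq (seq V)) :
  last w (flatten [seq rcons p w | p <- ps]) = w.
Proof.
elim: ps => //= p ps IH.
by rewrite last_cat last_rcons.
Qed.

Lemma walk_flatten_loops w (ps : seq (seq V)) e :
  walk_mult w (flatten [seq rcons p w | p <- ps]) e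
  = \sum_(p <- ps) walk_mult w (rcons p w) e.
Proof.
elim: ps => [|p ps IH]; first by rewrite big_nil.
by rewrite big_cons /= walk_mult_rcons_cat IH.
Qed.

Lemma size_flatten_loops w (ps : seq (seq V)) l :
  all (fun p => size p == l.-1) ps -> 0 < l ->
  size (flatten [seq rcons p w | p <- ps]) = l * size ps.
Proof.
move=> + l0; elim: ps => [|p ps IH] /=; first by rewrite muln0.
by case/andP=> /eqP sp /IH; rewrite size_cat size_rcons sp => ->; lia.
Qed.

(** Greedy choice: a vertex taken [cap] times is full, so at most |T|/cap vertices are full, and
    together with [s] excluded ones they do not exhaust [V]. *)
Lemma balanced_choice (T : finType) (S : T -> {set V}) (cap s : nat) :
  (forall t, #|S t| <= s) -> 0 < cap -> #|T| + s * cap < cap * #|V| ->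
  exists w : T -> V, (forall t, w t \notin S t) /\
    forall v : V, \sum_(t : T) (v == w t) <= cap.
Proof.
move=> Ss cap0 Tc.
suff [w [w1 w2]] : exists w : T -> V, {in enum T, forall t, w t \notin S t} /\
    forall v : V, \sum_(t <- enum T) (v == w t) <= cap.
  exists w; split; first by move=> t; apply: w1; rewrite mem_enum.
  by move=> v; have := w2 v; rewrite big_enum.
have V0 : 0 < #|V| by case: #|V| Tc => //; rewrite muln0.
have /card_gt0P[v0 _] := V0.
have : size (enum T) <= #|T| by rewrite cardE.
have := enum_uniq T.
elim: (enum T) => [|t ts IH] /=.
  by exists (fun=> v0); split=> // v; rewrite big_nil.
case/andP=> tts uts sts; have [w [w1 w2]] := IH uts (ltnW sts).
pose full := [set v | cap <= \sum_(t <- ts) (v == w t)].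
have full_size : #|full| * cap <= size ts.
  apply: leq_trans (_ : \sum_(v : V) \sum_(t <- ts) (v == w t) <= _).
    rewrite -sum_nat_const big_mkcond /=; apply: leq_sum => v _.
    by case: ifP => //; rewrite inE.
  rewrite exchange_big /= -sum1_size; apply: leq_sum => t' _.
  by rewrite (bigD1 (w t')) //= eqxx big1 // => u /negbTE ->.
have : 0 < #|~: (S t :|: full)|.
  rewrite cardsCs setCK subn_gt0; apply: leq_ltn_trans (leq_card_setU _ _) _.
  rewrite -(ltn_pmul2l cap0) mulnDr; apply: leq_ltn_trans Tc.
  rewrite addnC leq_add //; last by rewrite mulnC leq_mul2r Ss orbT.
  by rewrite mulnC; apply: leq_trans full_size (ltnW sts).
case/card_gt0P => z; rewrite !inE negb_or => /andP[zS zf].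
have wE t' : t' \in ts -> (if t' == t then z else w t') = w t'.
  by move=> t'ts; case: eqP => // E; rewrite -E t'ts in tts.
exists (fun t' => if t' == t then z else w t'); split.
  move=> t'; rewrite inE => /predU1P[->|t'ts]; first by rewrite eqxx.
  by rewrite wE // w1.
move=> v; rewrite big_cons eqxx.
rewrite (eq_big_seq (fun t' => nat_of_bool (v == w t'))); last by move=> t' /wE ->.
have := w2 v; case: eqP => [->|] //=; move: zf; rewrite -ltnNge; lia.
Qed.

End WalkAbsorber.

Lemma sum_pair_dep (T J : finType) (Q : T -> J -> bool) (f : T * J -> nat) :
  \sum_(d | Q d.1 d.2) f d = \sum_t \sum_(j | Q t j) f (t, j).
Proof. by rewrite pair_big_dep; apply: eq_bigr => -[]. Qed.

Lemma sum_ord_inord m N (h : 'I_m.+1 -> nat) : N <= m.+1 ->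
  \sum_(i < m.+1 | i < N) h i = \sum_(i < N) h (inord i).
Proof.
move=> Nm; rewrite (big_ord_narrow Nm); apply: eq_bigr => i _; congr h.
by apply: val_inj; rewrite /= inordK //; apply: leq_trans (ltn_ord i) Nm.
Qed.

Lemma walk_degree_nth (V : finType) (x : V) s v :
  path (fun a b => a != b) x s ->
  degree (walk_mult x s) v
  = \sum_(i < size s) ((v == nth x (x :: s) i) + (v == nth x (x :: s) i.+1)).
Proof.
move=> ps; rewrite (eq_degree _ (walk_mult_nth x x s)) degree_sum.
apply: eq_bigr => i _; rewrite degree_edge //.
by have /(pathP x)/(_ i (ltn_ord i)) := ps.
Qed.

Lemma path_flatten_loops (V : finType) (r : rel V) w (ps : seq (seq V)) :
  all (fun p => path r w (rcons p w)) ps ->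
  path r w (flatten [seq rcons p w | p <- ps]).
Proof.
elim: ps => //= p ps IH /andP[pp /IH pps].
by rewrite cat_path last_rcons pp.
Qed.

Lemma uniq_cell (V : finType) (a b z : V) r s :
  a != b -> z != a -> z != b -> uniq r -> uniq s ->
  {in r, forall u, [/\ u != a, u != b, u != z & u \notin s]} ->
  {in s, forall u, [/\ u != a, u != b & u != z]} ->
  uniq (cell a b r z s).
Proof.
move=> ab za zb ur us Hr Hs; rewrite /cell /= !inE !mem_cat !inE !mem_rev.
rewrite cat_uniq /= mem_rev rev_uniq ur us !negb_or ab (eq_sym a z) za (eq_sym b z) zb.
have ar u : (u == a) || (u == b) || (u == z) -> u \notin r.
  move=> uabz; apply/negP => /Hr[/negbTE ua /negbTE ub /negbTE uz _].
  by move: uabz; rewrite ua ub uz.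
have as_ u : (u == a) || (u == b) || (u == z) -> u \notin s.
  move=> uabz; apply/negP => /Hs[/negbTE ua /negbTE ub /negbTE uz].
  by move: uabz; rewrite ua ub uz.
rewrite !ar ?eqxx ?orbT // !as_ ?eqxx ?orbT // andbT /=.
by rewrite andbT; apply/hasPn => u; rewrite mem_rev => us'; apply/negP => /Hr[_ _ _ /negP].
Qed.

(* The walk v' is a bouquet of 2k-cycles at a vertex w outside the given walk. *)
Lemma closed_walk_absorbers k q Nm : 0 < q -> 4 <= k ->
  exists q1 n1 : nat, forall (V : finType) (adj : rel V),
  irreflexive adj ->
  (forall L, k.-1 <= L <= 2 * k -> robustly_connected adj q L) ->
  n1 <= #|V| ->
  forall (T : finType) (tx : T -> V) (ts : T -> seq V) (F : {set V} -> nat),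
  (forall t, last (tx t) (ts t) = tx t) ->
  (forall t, path (fun a b => a != b) (tx t) (ts t)) ->
  (forall t, 2 * k %| size (ts t)) -> (forall t, size (ts t) <= Nm) ->
  (forall v, degree F v * (4 * q) <= #|V|) ->
  (forall e, F e <= graph_mult adj e) ->
  (forall v, (\sum_t degree (walk_mult (tx t) (ts t)) v) * q1 <= #|V|) ->
  #|T| * q1 <= #|V| * #|V| ->
  exists Ab : T -> {set V} -> nat,
    [/\ forall t, decomposable (2 * k) (Ab t),
        forall t, decomposable (2 * k) (fun e => walk_mult (tx t) (ts t) e + Ab t e)
      & forall e, F e + \sum_t Ab t e <= graph_mult adj e].
Proof.
move=> q0 k4.
have k3 : 3 <= k.-1 by lia.
have [qR [nR embR]] := robust_embedding (2 * k) (2 * Nm + 2) 1 q0 k3.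
(* The bouquets are embedded first and avoided afterwards. They may take up half of the forbidden
   degree n/(2q) and half of the end load n/qR of the second embedding. *)
have [qB [nB embB]] := robust_embedding (2 * k) Nm.+1 (4 * q + 2 * qR) q0 k3.
(* A vertex is the centre of at most [cap], about n/c0, bouquets, each with at most [Nm.+1] loops of
   two ends; [c0] brings this load below n/qB. *)
have [c0 c0E] : exists c0, c0 = (2 * Nm.+1 * qB).+1 by eexists.
exists (4 * c0 + 2 * qR), (nR + nB + c0 + 4 * Nm.+1) => V adj irr conn nV.
move=> T tx ts F tlast tpath tdiv tsize Fdeg Fle tload tcard.
have c00 : 0 < c0 by rewrite c0E.
have [cap [cap1 cap2 _]] := div_bounds #|V| c00.
have cap0 : 0 < cap by case: cap cap2 {cap1} => //; rewrite mul1n; lia.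
pose St t : {set V} := [set v in tx t :: ts t].
have [||| w [wS wcap]] := @balanced_choice V T St cap Nm.+1.
- move=> t; rewrite /St cardsE; apply: leq_trans (card_size _) _.
  by rewrite /= ltnS.
- by [].
- have c1 : cap * c0 >= c0 by rewrite leq_pmull.
  have c2 : #|V| <= 2 * (cap * c0) by lia.
  have c3 : #|V| * #|V| <= 2 * (cap * c0) * #|V| by rewrite leq_mul2r c2 orbT.
  have c4 : #|T| * (4 * c0) <= 2 * (cap * c0) * #|V|.
    by apply: leq_trans c3; apply: leq_trans tcard; rewrite leq_mul2l; lia.
  have c5 : 2 * #|T| <= cap * #|V|.
    rewrite -(leq_pmul2l (m := 2 * c0)); last by lia.
    by move: c4; clear; lia.
  have c6 : 4 * Nm.+1 * cap <= #|V| * cap by rewrite leq_mul2r; lia.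
  have : 0 < cap * #|V| by rewrite muln_gt0 cap0; lia.
  by lia.
(* With [tau t] cycles the bouquet has as many steps as the walk [ts t], so the two can be matched
   step by step. *)
pose tau t := size (ts t) %/ (2 * k).
have tauE t : 2 * k * tau t = size (ts t) by rewrite mulnC divnK.
have tau_le t : tau t <= Nm.+1.
  by rewrite /tau; apply: leq_trans (leq_div _ _) _; apply: leqW.
pose AB := [set d : T * 'I_Nm.+1 | d.2 < tau d.1].
have [|||||gB [gB1 gB2 gB3 gB4]] := embB V adj irr conn _ _ AB (fun d => w d.1)
  (fun d => w d.1) (fun=> 2 * k) (fun d => St d.1) F _ _ _ _ Fle.
- by lia.
- by move=> d _; lia.
- move=> d _; rewrite /St cardsE; apply: leq_trans (card_size _) _.
  by rewrite /= ltnS.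
- by move=> v; apply: leq_trans (Fdeg v); rewrite leq_mul2l; lia.
- move=> v; apply: leq_trans cap1.
  rewrite (eq_bigl (fun d : T * 'I_Nm.+1 => d.2 < tau d.1)) => [|d]; last by rewrite inE.
  rewrite (sum_pair_dep (fun t (j : 'I_Nm.+1) => j < tau t)
    (fun d : T * 'I_Nm.+1 => (v == w d.1) + (v == w d.1))) /=.
  apply: leq_trans (_ : 2 * Nm.+1 * cap * qB <= _); last by rewrite c0E; lia.
  rewrite leq_mul2r; apply/orP; right.
  apply: leq_trans (_ : \sum_t (2 * Nm.+1) * (v == w t) <= _); last first.
    by rewrite -big_distrr /= leq_mul2l wcap orbT.
  apply: leq_sum => t _; rewrite sum_nat_const addnn -mul2n mulnCA -mulnA.
  rewrite leq_mul2l /= leq_mul2r; apply/orP; right.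
  by apply: leq_trans (max_card _) _; rewrite card_ord.
have gBok t (j : 'I_Nm.+1) : j < tau t -> token_ok adj (fun d => w d.1)
  (fun d => w d.1) (fun=> 2 * k) (fun d => St d.1) gB (t, j).
  by move=> jt; apply: gB1; rewrite inE.
pose js t : seq 'I_Nm.+1 := [seq j : 'I_Nm.+1 <- enum 'I_Nm.+1 | j < tau t].
have js_size t : size (js t) = tau t.
  rewrite /js -sum1_size big_filter big_enum_cond /= sum_ord_inord //.
  by rewrite sum1_card card_ord.
have jsP t j : j \in js t -> j < tau t by rewrite mem_filter => /andP[].
pose s' t := flatten [seq rcons p (w t) | p <- [seq gB (t, j) | j <- js t]].
have gB_all t (P : pred (seq V)) : (forall j, j \in js t -> P (gB (t, j))) ->
    all P [seq gB (t, j) | j <- js t].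
  by move=> H; apply/allP => p /mapP[j jjs ->]; apply: H.
have s'_size t : size (s' t) = size (ts t).
  rewrite /s' (@size_flatten_loops _ _ _ (2 * k)) ?size_map ?js_size ?tauE //; last by lia.
  by apply: gB_all => j /jsP /gBok[-> _ _ _].
have s'_path t : path adj (w t) (s' t).
  by apply: path_flatten_loops; apply: gB_all => j /jsP /gBok[_ _ _].
have s'_last t : last (w t) (s' t) = w t by apply: last_flatten_loops.
have s'_out t u : u \in w t :: s' t -> u \notin tx t :: ts t.
  rewrite inE => /predU1P[->|]; first by have := wS t; rewrite inE.
  case/flattenP => p /mapP[p' /mapP[j jjs ->] ->].
  rewrite mem_rcons inE => /predU1P[->|]; first by have := wS t; rewrite inE.
  by have [_ _ H _] := gBok _ _ (jsP _ _ jjs) => /H[]; rewrite inE.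
have s'_mult t e : walk_mult (w t) (s' t) e
    = \sum_(j : 'I_Nm.+1 | j < tau t) token_mult (fun d => w d.1) (fun d => w d.1) gB (t, j) e.
  by rewrite walk_flatten_loops big_map big_filter big_enum_cond.
have s'_dec t : decomposable (2 * k) (walk_mult (w t) (s' t)).
  apply: decomposable_ext (decomposable_sum (js t) (P := fun j : 'I_Nm.+1 => j < tau t)
    (M := fun j => cycle_mult (w t :: gB (t, j))) _).
    by move=> e; rewrite s'_mult big_filter_cond big_enum_cond /=; apply: eq_bigl => j; rewrite andbb.
  move=> j /gBok[sz uq H _]; apply: decomposable_cycle; last by rewrite /= sz; lia.
  by rewrite /= uq andbT; apply/negP => /H[_ /eqP].
pose B e := \sum_t walk_mult (w t) (s' t) e.
have BE e : B e = \sum_(d in AB) token_mult (fun d => w d.1) (fun d => w d.1) gB d e.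
  rewrite (eq_bigl (fun d : T * 'I_Nm.+1 => d.2 < tau d.1)) => [|d]; last by rewrite inE.
  rewrite (sum_pair_dep (fun t (j : 'I_Nm.+1) => j < tau t)
    (fun d => token_mult (fun d => w d.1) (fun d => w d.1) gB d e)) /=.
  by apply: eq_bigr => t _; rewrite s'_mult.
have Bdeg v : degree B v * (4 * q) <= #|V| /\ degree B v * (2 * qR) <= #|V|.
  rewrite (eq_degree v BE); split; apply: leq_trans (gB4 v); rewrite leq_mul2l;
    by [rewrite leq_addr orbT | rewrite leq_addl orbT].
pose vt t i := nth (tx t) (tx t :: ts t) i.
pose vt' t i := nth (w t) (w t :: s' t) i.
have vtN t : vt t (size (ts t)) = vt t 0.
  by rewrite /vt -[size (ts t)]/(size (tx t :: ts t)).-1 nth_last /= tlast.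
have vt'N t : vt' t (size (ts t)) = vt' t 0.
  by rewrite /vt' -s'_size -[size (s' t)]/(size (w t :: s' t)).-1 nth_last /= s'_last.
have vt_in t i : i <= size (ts t) -> vt t i \in tx t :: ts t.
  by move=> it; apply: mem_nth; rewrite /= ltnS.
have vt'_in t i : i <= size (ts t) -> vt' t i \in w t :: s' t.
  by move=> it; apply: mem_nth; rewrite /= ltnS s'_size.
have vt_ne t i : i < size (ts t) -> vt t i != vt t i.+1.
  by have /(pathP (tx t)) := tpath t; apply.
have s'_path' t : path (fun a b => a != b) (w t) (s' t) by apply: path_adj_neq (s'_path t).
have vt'_ne t i : i < size (ts t) -> vt' t i != vt' t i.+1.
  by rewrite -s'_size; have /(pathP (w t)) := s'_path' t; apply.
have vt_vt' t i j : i <= size (ts t) -> j <= size (ts t) -> vt' t i != vt t j.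
  move=> it jt; have := s'_out t _ (vt'_in t i it).
  by apply: contraNneq => ->; apply: vt_in.
pose AR := [set d : T * 'I_Nm.+1 * bool | d.1.2 < size (ts d.1.1)].
pose xR (d : T * 'I_Nm.+1 * bool) := if d.2 then vt d.1.1 d.1.2.+1 else vt d.1.1 d.1.2.
pose yR (d : T * 'I_Nm.+1 * bool) := vt' d.1.1 d.1.2.
(* Together with the edge, lengths [k] and [k.-1] close to 2k; two equal lengths would give an odd
   cycle. No other path of the proof is as short as [k.-1]. *)
pose LR (d : T * 'I_Nm.+1 * bool) := if d.2 then k else k.-1.
pose SR (d : T * 'I_Nm.+1 * bool) : {set V} :=
  [set v in (tx d.1.1 :: ts d.1.1) ++ (w d.1.1 :: s' d.1.1)].
have sumR (f : T * 'I_Nm.+1 * bool -> nat) : \sum_(d in AR) f d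
    = \sum_t \sum_(i < size (ts t)) (f (t, inord i, true) + f (t, inord i, false)).
  rewrite (eq_bigl (fun d : T * 'I_Nm.+1 * bool => (d.1.2 < size (ts d.1.1)) && true)) => [|d]; last by rewrite inE andbT.
  transitivity (\sum_(p : T * 'I_Nm.+1 | p.2 < size (ts p.1)) \sum_(b : bool) f (p, b)).
    by rewrite pair_big_dep /=; apply: eq_bigr => -[[]].
  rewrite (sum_pair_dep (fun t (i : 'I_Nm.+1) => i < size (ts t))
     (fun p : T * 'I_Nm.+1 => \sum_(b : bool) f (p, b))).
  apply: eq_bigr => t _; rewrite sum_ord_inord; last by apply: leqW.
  by apply: eq_bigr => i _; rewrite big_bool.
have inordE t (i : 'I_(size (ts t))) : (inord i : 'I_Nm.+1) = i :> nat.
  by rewrite inordK //; apply: leq_trans (ltn_ord i) (leqW (tsize t)).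
have [||||||gR [gR1 gR2 gR3 gR4]] := embR V adj irr conn _ _ AR xR yR LR SR
  (fun e => F e + B e).
- by lia.
- by move=> [[t i] b] _; rewrite /LR; case: b => /=; lia.
- move=> d _; rewrite /SR cardsE; apply: leq_trans (card_size _) _.
  have aux a : a <= Nm -> a.+1 + a.+1 <= 2 * Nm + 2 by lia.
  by rewrite size_cat /= s'_size; apply: aux (tsize _).
- move=> v; rewrite degreeD; have := Fdeg v; have [+ _] := Bdeg v; lia.
- move=> v; rewrite sumR.
  (* Step i has the ends v(i+1) and v(i) on the walk, and v'(i) twice on the bouquet. Summed
     cyclically, one copy of v'(i) may be read as v'(i+1), so the load is the degree in the two
     closed walks. *)
  have -> : \sum_t \sum_(i < size (ts t)) ((v == xR (t, inord i, true)) + (v == yR (t, inord i, true))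
     + ((v == xR (t, inord i, false)) + (v == yR (t, inord i, false))))
     = \sum_t degree (walk_mult (tx t) (ts t)) v + degree B v.
    rewrite /B degree_sum -big_split /=; apply: eq_bigr => t _.
    rewrite walk_degree_nth // walk_degree_nth // s'_size.
    rewrite [X in _ = _ + X]big_split /=.
    rewrite (_ : \sum_(i < size (ts t)) (v == nth (w t) (s' t) i) =
                 \sum_(i < size (ts t)) (v == vt' t i)).
      rewrite -!big_split /=; apply: eq_bigr => i _.
      rewrite /xR /yR /= inordE; rewrite /vt /vt' /=; blia.
    rewrite -(sum_next_mod _ (fun i => nat_of_bool (v == vt' t i))).
    apply: eq_bigr => i _.
    have := ltn_ord i; rewrite leq_eqVlt => /predU1P[E|lt]; last by rewrite modn_small.
    rewrite [in RHS]E modnn -vt'N; congr (nat_of_bool (v == _)).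
    by rewrite -[in RHS]E.
  have t2 : (\sum_t degree (walk_mult (tx t) (ts t)) v) * (2 * qR) <= #|V|.
    by apply: leq_trans (tload v); rewrite leq_mul2l leq_addl orbT.
  by have [_] := Bdeg v; move: t2; generalize (\sum_t degree (walk_mult (tx t) (ts t)) v); lia.
- by move=> e; rewrite BE; apply: gB3.
pose Rf t i := gR (t, inord i, true).
pose Sf t i := gR (t, inord i, false).
pose RS t e := \sum_(i < size (ts t)) (walk_mult (vt t i.+1) (rcons (Rf t i) (vt' t i)) e
    + walk_mult (vt t i) (rcons (Sf t i) (vt' t i)) e).
have RSE e : \sum_t RS t e = \sum_(d in AR) token_mult xR yR gR d e.
  rewrite sumR; apply: eq_bigr => t _; apply: eq_bigr => i _.
  by rewrite /token_mult /xR /yR /= inordE.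
have gRok t i b : i < size (ts t) -> [/\ size (gR (t, inord i, b)) = (LR (t, inord i, b)).-1,
   uniq (gR (t, inord i, b)) &
   {in gR (t, inord i, b), forall u, u \notin (tx t :: ts t) /\ u \notin (w t :: s' t)}].
  move=> it; have [|sz uq H _] := gR1 (t, inord i, b).
    by rewrite inE /= (inordE _ (Ordinal it)).
  split=> // u /H[]; rewrite inE mem_cat negb_or => /andP[? ?] _ _; split=> //.
have RS_dec t := @decomposable_shifted_walks V (2 * k) (size (ts t)) (vt t) (vt' t)
  (Rf t) (Sf t) (vtN t) (vt'N t).
have avoid t i b u j : i < size (ts t) -> j <= size (ts t) ->
   u \in gR (t, inord i, b) -> u != vt t j /\ u != vt' t j.
  move=> it jt; have [_ _ H] := gRok t i b it => /H[u1 u2]; split.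
    by apply: contraNneq u1 => ->; apply: vt_in.
  by apply: contraNneq u2 => ->; apply: vt'_in.
have ARin t i b : i < size (ts t) -> (t, inord i, b) \in AR.
  by move=> it; rewrite inE /= (inordE _ (Ordinal it)).
have cells1 t i : i < size (ts t) ->
    let c := cell (vt t i) (vt t i.+1) (Rf t i) (vt' t i) (Sf t i) in
    uniq c /\ size c = 2 * k.
  move=> it /=; split; last first.
    have [sR _ _] := gRok t i true it; have [sS _ _] := gRok t i false it.
    by rewrite /cell /= size_cat /= size_rev /Rf /Sf sR sS /LR /=; lia.
  have [_ uR _] := gRok t i true it; have [_ uS _] := gRok t i false it.
  apply: uniq_cell => //; rewrite ?vt_ne ?vt_vt' // 1?ltnW //.
  - move=> u uR'; have [n1 n2] := avoid t i true u i it (ltnW it) uR'.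
    have [n3 _] := avoid t i true u i.+1 it it uR'; split=> //.
    apply: (gR2 _ _ (ARin t i true it) (ARin t i false it)) => //; first by apply/eqP; case.
    by rewrite /share_end /xR /yR /= eqxx !orbT.
  - move=> u uR'; have [n1 n2] := avoid t i false u i it (ltnW it) uR'.
    by have [n3 _] := avoid t i false u i.+1 it it uR'.
have cells2 t i : i < size (ts t) ->
    let c := cell (vt' t i) (vt' t i.+1) (rev (Sf t (i.+1 %% size (ts t)))) (vt t i.+1) (rev (Rf t i)) in
    uniq c /\ size c = 2 * k.
  move=> it /=; set i' := i.+1 %% size (ts t).
  have it' : i' < size (ts t) by rewrite ltn_mod; lia.
  split; last first.
    have [sR _ _] := gRok t i true it; have [sS _ _] := gRok t i' false it'.
    by rewrite /cell /= size_cat /= !size_rev /Rf /Sf sR sS /LR /=; lia.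
  have [_ uR _] := gRok t i true it; have [_ uS _] := gRok t i' false it'.
  (* The two paths of this cell come from different steps. Their interiors are disjoint because they
     share the end v(i+1), which for the last i is v(0). *)
  have vi' : vt t i.+1 = vt t i'.
    rewrite /i'; move: it; rewrite leq_eqVlt => /predU1P[->|lt]; last by rewrite modn_small.
    by rewrite modnn.
  apply: uniq_cell; rewrite ?rev_uniq ?vt'_ne 1?eq_sym ?vt_vt' // 1?ltnW //.
  - move=> u; rewrite mem_rev => uR'; have [_ n1] := avoid t i' false u i it' (ltnW it) uR'.
    have [n3 n4] := avoid t i' false u i.+1 it' it uR'; split=> //; rewrite mem_rev.
    apply: (gR2 _ _ (ARin t i' false it') (ARin t i true it)) => //; first by apply/eqP; case.
    rewrite /share_end /xR /yR /= (inordE _ (Ordinal it)) (inordE _ (Ordinal it')) /=.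
    by rewrite vi' eqxx.
  - move=> u; rewrite mem_rev => uR'; have [_ n1] := avoid t i true u i it (ltnW it) uR'.
    by have [n3 n4] := avoid t i true u i.+1 it it uR'.
exists (fun t e => walk_mult (w t) (s' t) e + RS t e); split.
- move=> t; have [_] := RS_dec t (cells1 t) (cells2 t).
  apply: decomposable_ext => e; congr (_ + _).
  by rewrite (walk_mult_nth (w t)) s'_size.
- move=> t; have [H _] := RS_dec t (cells1 t) (cells2 t).
  apply: decomposable_ext (decomposableD H (s'_dec t)) => e.
  by rewrite [in RHS](walk_mult_nth (tx t)) -addnA; congr (_ + _); apply: addnC.
- by move=> e; rewrite big_split /= RSE addnA; apply: gR3.
Qed.

(** * Parallel paths, prefix parities and hubs *)

Section Parallel.
Variables (V : finType) (adj : rel V) (D : finType) (x y : D -> V) (L : D -> nat).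
Variables (S : D -> {set V}) (g : D -> seq V) (k : nat).
Hypothesis k2 : 1 < k.

Lemma parallel_paths_decomposable (A : {set D}) a b : a != b ->
  {in A, forall d, token_ok adj x y L S g d} ->
  {in A &, forall d d', d != d' -> share_end x y d d' ->
     forall u, u \in g d -> u \notin g d'} ->
  {in A, forall d, [/\ x d = a, y d = b & L d = k]} ->
  ~~ odd #|A| ->
  decomposable (2 * k) (fun e => \sum_(d in A) token_mult x y g d e).
Proof.
move=> ab; have [n] := ubnP #|A|; elim: n A => // n IH A An Aok Adis Aab Aev.
case: (set_0Vmem A) => [->|[d1 d1A]].
  by apply: decomposable_ext (decomposable0 _ _) => e; rewrite big_set0.
case: (set_0Vmem (A :\ d1)) => [A0|[d2 d2A]].
  by move: Aev; rewrite (cardsD1 d1) d1A A0 cards0.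
have [d21 d2A'] : d2 != d1 /\ d2 \in A by move: d2A; rewrite !inE => /andP[].
have cA : #|A| = #|A :\ d1 :\ d2|.+2 by rewrite (cardsD1 d1) d1A (cardsD1 d2) d2A.
have sub d : d \in A :\ d1 :\ d2 -> d \in A by rewrite !inE => /and3P[].
have decA' : decomposable (2 * k) (fun e => \sum_(d in A :\ d1 :\ d2) token_mult x y g d e).
  apply: IH.
  - by move: An; rewrite cA; lia.
  - by move=> d /sub; apply: Aok.
  - by move=> d d' /sub dA /sub d'A; apply: Adis.
  - by move=> d /sub; apply: Aab.
  - by move: Aev; rewrite cA /= negbK.
have [s1 u1 H1 _] := Aok _ d1A; have [s2 u2 H2 _] := Aok _ d2A'.
have [x1 y1 L1] := Aab _ d1A; have [x2 y2 L2] := Aab _ d2A'.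
have decC : decomposable (2 * k) (cycle_mult (a :: g d1 ++ b :: rev (g d2))).
  apply: decomposable_cycle; last first.
    by rewrite /= size_cat /= size_rev s1 s2 L1 L2; lia.
  have aN d : d \in A -> a \notin g d.
    move=> dA; have [_ _ H _] := Aok _ dA; have [xd _ _] := Aab _ dA.
    by apply/negP => /H[_]; rewrite xd eqxx.
  have bN d : d \in A -> b \notin g d.
    move=> dA; have [_ _ H _] := Aok _ dA; have [_ yd _] := Aab _ dA.
    by apply/negP => /H[_ _]; rewrite yd eqxx.
  rewrite cons_uniq mem_cat inE mem_rev (negbTE ab) !negb_or !aN //=.
  rewrite cat_uniq /= mem_rev rev_uniq u1 u2 (bN _ d2A') negb_or (bN _ d1A) /= !andbT.
  apply/hasPn => u; rewrite mem_rev => ug2.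
  apply: (Adis d2 d1 d2A' d1A d21) ug2.
  by rewrite /share_end x1 x2 eqxx.
apply: decomposable_ext (decomposableD decC decA') => e.
rewrite [RHS](big_setD1 d1) //= [X in _ = _ + X](big_setD1 d2) //= addnA; congr (_ + _).
rewrite /cycle_mult rcons_cat rcons_cons -cat_rcons walk_mult_rcons_cat walk_mult_rev.
by rewrite /token_mult x1 y1 x2 y2.
Qed.

Lemma parallel_classes_decomposable (A : {set D}) :
  {in A, forall d, token_ok adj x y L S g d} ->
  {in A &, forall d d', d != d' -> share_end x y d d' ->
     forall u, u \in g d -> u \notin g d'} ->
  {in A, forall d, x d != y d /\ L d = k} ->
  (forall a b, ~~ odd #|[set d in A | (x d == a) && (y d == b)]|) ->
  decomposable (2 * k) (fun e => \sum_(d in A) token_mult x y g d e).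
Proof.
move=> Aok Adis AL Aev.
pose cls (ab : V * V) := [set d in A | (x d == ab.1) && (y d == ab.2)].
have H ab : decomposable (2 * k) (fun e => \sum_(d in cls ab) token_mult x y g d e).
  case: (set_0Vmem (cls ab)) => [->|[d0]].
    by apply: decomposable_ext (decomposable0 _ _) => e; rewrite big_set0.
  rewrite inE => /and3P[d0A /eqP xd0 /eqP yd0].
  have [ne _] := AL _ d0A; rewrite xd0 yd0 in ne.
  apply: (parallel_paths_decomposable ne).
  - by move=> d; rewrite inE => /andP[dA _]; apply: Aok.
  - by move=> d d'; rewrite !inE => /andP[dA _] /andP[d'A _]; apply: Adis.
  - by move=> d; rewrite inE => /and3P[dA /eqP-> /eqP->]; have [] := AL _ dA.
  - exact: Aev.
apply: decomposable_ext (decomposable_sum (index_enum (V * V)%type) (P := xpredT) (fun ab _ => H ab)) => e.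
rewrite (partition_big (fun d => (x d, y d)) xpredT) //=.
apply: eq_bigr => -[a b] _; apply: eq_bigl => d.
by rewrite inE /= xpair_eqE.
Qed.
End Parallel.

Section CyclicPrefix.
Variable m : nat.

Definition prefix_sum (h : 'I_m -> nat) (i : 'I_m) := \sum_(j : 'I_m | j <= i) h j.

(** At [i = 0] the cyclic predecessor is the last index, whose prefix sum is the total; the
    conditional term compensates for this wrap-around. *)
Lemma prefix_sumE h (i : 'I_m) :
  prefix_sum h i + (if i == 0 :> nat then \sum_j h j else 0)
  = h i + prefix_sum h (ord_pred i).
Proof.
rewrite /prefix_sum (bigD1 i) //= -addnA; congr (_ + _).
have mi := ltn_ord i.
case: ifP => [/eqP i0|/negbT i0].
  rewrite big1 ?add0n => [|j]; last first.
    by rewrite i0 leqn0 => /andP[/eqP j0 /eqP[]]; apply: val_inj; rewrite /= j0 i0.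
  apply: eq_bigl => j; rewrite i0 add0n modn_small; last by lia.
  by have := ltn_ord j; lia.
rewrite addn0; apply: eq_bigl => j; rewrite -(inj_eq val_inj) /=.
have -> : (i + m).-1 %% m = i.-1.
  by rewrite (_ : (i + m).-1 = i.-1 + m) ?modnDr ?modn_small; lia.
by lia.
Qed.

Lemma prefix_parity (h : 'I_m -> nat) i : ~~ odd (\sum_j h j) ->
  odd (h i) = odd (prefix_sum h i) (+) odd (prefix_sum h (ord_pred i)).
Proof.
move=> hev; have /(congr1 odd) := prefix_sumE h i; rewrite !oddD.
have -> : odd (if i == 0 :> nat then \sum_j h j else 0) = false.
  by case: ifP => // _; apply/negbTE.
by rewrite addbF => ->; rewrite addbK.
Qed.

(* The s i j are two-dimensional prefix parities; being cyclic they need no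
   boundary cases, since the total row and column parities vanish. *)
Lemma prefix_parity2 (f : 'I_m -> 'I_m -> nat) :
  (forall i, ~~ odd (\sum_j f i j)) -> (forall j, ~~ odd (\sum_i f i j)) ->
  exists s : 'I_m -> 'I_m -> bool, forall i j,
    odd (f i j) = s i j (+) s (ord_pred i) j (+) s i (ord_pred j)
                  (+) s (ord_pred i) (ord_pred j).
Proof.
move=> rows cols.
pose u i j := prefix_sum (f^~ j) i.
exists (fun i j => odd (prefix_sum (u i) j)) => i j.
have uev i' : ~~ odd (\sum_j' u i' j').
  rewrite /u /prefix_sum exchange_big /=.
  by apply: (big_ind (fun n => ~~ odd n)) => // a b; rewrite oddD => /negbTE-> /negbTE->.
rewrite (prefix_parity (h := f^~ j) i) // -/(u i j) -/(u (ord_pred i) j).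
rewrite (prefix_parity (h := u i) j) // (prefix_parity (h := u (ord_pred i)) j) //.
by do 4 case: (odd _).
Qed.

End CyclicPrefix.

(** The hubs are the first 2m vertices of the enumeration. A vertex is assigned by its rank modulo
    [m], shifted by one so that no hub is assigned to itself and spokes have distinct ends. *)
Lemma hubs (V : finType) m : 1 < m -> 2 * m <= #|V| ->
  exists (p q : 'I_m -> V) (r : V -> 'I_m),
  [/\ injective p, injective q, (forall i j, p i != q j), (forall v, p (r v) != v)
    & forall i, #|[set v | r v == i]| <= (#|V| %/ m).+1].
Proof.
move=> m1 mV.
have m0 : 0 < m by lia.
have lp (i : 'I_m) : i < #|V| by apply: leq_trans (ltn_ord i) _; lia.
have lq (i : 'I_m) : m + i < #|V| by have := ltn_ord i; lia.
have lr (v : V) : (enum_rank v).+1 %% m < m by rewrite ltn_mod.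
exists (fun i => enum_val (Ordinal (lp i))), (fun i => enum_val (Ordinal (lq i))),
       (fun v => Ordinal (lr v)); split.
- by move=> i j /enum_val_inj [E]; apply: val_inj.
- by move=> i j /enum_val_inj [/eqP]; rewrite eqn_add2l => /eqP E; apply: val_inj.
- move=> i j; apply/eqP => /enum_val_inj [E].
  by have := ltn_ord i; lia.
- move=> v; apply/eqP => E.
  have : Ordinal (lp (Ordinal (lr v))) = enum_rank v by apply: enum_val_inj; rewrite E enum_rankK.
  move/(congr1 val) => /= E2.
  have lt : enum_rank v < m by rewrite -E2 ltn_mod.
  move: E2; have := lt; rewrite leq_eqVlt => /predU1P[E3|lt2].
    by rewrite E3 modnn => E4; move: E3; rewrite -E4 => E5; lia.
  by rewrite modn_small // => /esym /n_Sn.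
(* Within a residue class modulo [m] a rank is determined by its quotient by [m]. *)
- move=> i; pose h (v : V) : 'I_(#|V| %/ m).+1 := inord (enum_rank v %/ m).
  rewrite -[X in _ <= X]card_ord.
  apply: leq_trans (max_card (mem [set h v | v in [set v | Ordinal (lr v) == i]])).
  rewrite card_in_imset // => v1 v2; rewrite !inE => /eqP e1 /eqP e2 /(congr1 (@nat_of_ord _)).
  have le (v : V) : enum_rank v %/ m < (#|V| %/ m).+1.
    by rewrite ltnS leq_div2r // ltnW // ltn_ord.
  rewrite /h (inordK (le v1)) (inordK (le v2)) => e3; apply: enum_rank_inj; apply: val_inj => /=.
  have e4 : (enum_rank v1).+1 = (enum_rank v2).+1 %[mod m].
    by rewrite (congr1 (@nat_of_ord m) e1 : _ %% m = _) (congr1 (@nat_of_ord m) e2 : _ %% m = _).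
  have e5 : enum_rank v1 = enum_rank v2 %[mod m].
    by apply/eqP; rewrite -(eqn_modDr 1) !addn1; apply/eqP.
  rewrite [LHS](divn_eq _ m) [RHS](divn_eq _ m) e3 e5.
  by [].
Qed.

(** * The absorber of a sparse graph *)

Lemma sum_linear (I : finType) c d (A B C E F : I -> nat) :
  \sum_i (c * A i + c * B i + c * C i + d * E i + d * F i)
  = c * (\sum_i A i) + c * (\sum_i B i) + c * (\sum_i C i) + d * (\sum_i E i)
    + d * (\sum_i F i).
Proof. by rewrite !big_split -!big_distrr. Qed.

Section Walks.
Variable V : finType.
Implicit Types (x y z : V) (s : seq V).

Definition is_walk x s y n (W : {set V} -> nat) :=
  [/\ last x s = y, path (fun a b => a != b) x s, size s = n & walk_mult x s =1 W].

Lemma is_walk_cat x s y n W s' z n' W' :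
  is_walk x s y n W -> is_walk y s' z n' W' ->
  is_walk x (s ++ s') z (n + n') (fun e => W e + W' e).
Proof.
move=> [l1 p1 s1 m1] [l2 p2 s2 m2]; split.
- by rewrite last_cat l1.
- by rewrite cat_path p1 l1.
- by rewrite size_cat s1 s2.
- by move=> e; rewrite walk_mult_cat l1 m1 m2.
Qed.

Lemma is_walk_ext x s y n W n' W' : n = n' -> W =1 W' ->
  is_walk x s y n W -> is_walk x s y n' W'.
Proof. by move=> -> WW [l1 p1 s1 m1]; split=> // e; rewrite m1 WW. Qed.

Lemma is_walk_flatten (I : Type) x (f : I -> seq V) n (W : I -> {set V} -> nat) r :
  (forall i, is_walk x (f i) x n (W i)) ->
  is_walk x (flatten [seq f i | i <- r]) x (n * size r) (fun e => \sum_(i <- r) W i e).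
Proof.
move=> H; elim: r => [|i r IH] /=.
  by split=> // [|e]; rewrite ?muln0 ?big_nil.
apply: is_walk_ext (is_walk_cat (H i) IH); first by rewrite mulnS.
by move=> e; rewrite big_cons.
Qed.

Lemma is_walk_rev x s y n W : is_walk x (rcons s y) y n W ->
  is_walk y (rcons (rev s) x) x n W.
Proof.
move=> [_ p1 s1 m1]; split.
- by rewrite last_rcons.
- move: p1; rewrite -rev_path last_rcons belast_rcons rev_cons.
  by apply: sub_path => a b /=; rewrite eq_sym.
- by rewrite size_rcons size_rev -s1 size_rcons.
- by move=> e; rewrite walk_mult_rev m1.
Qed.
End Walks.

(** * The reserved paths: their ends, lengths and load *)

Section Tokens.
Variables (V : finType) (k M m : nat).
Variables (tl hd : 'I_M -> V) (p q : 'I_m -> V) (r : V -> 'I_m).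

Local Notation token := ('I_M * (unit + bool * bool + bool * 'I_(2 * k))
   + 'I_m * 'I_m * (bool * bool))%type.

(* Tokens are the reserved paths.  For an edge i from tl i to hd i: [tok_cover]
   has the ends of the edge and length 2k; [tok_spoke i false b] joins an end to
   its p-hub and [tok_spoke i true b] joins that hub to the q-hub of tl i; the
   two paths [tok_carry i _ j] form the j-th loop through tl i and tl (i+1).
   [tok_square i j a b] joins p (i+a) to q (j+b). *)
Definition tok_cover (i : 'I_M) : token := inl (i, inl (inl tt)).
Definition tok_spoke (i : 'I_M) (lk b : bool) : token := inl (i, inl (inr (lk, b))).
Definition tok_carry (i : 'I_M) (b : bool) (j : 'I_(2 * k)) : token := inl (i, inr (b, j)).
Definition tok_square (i j : 'I_m) (a b : bool) : token := inr (i, j, (a, b)).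

Definition step_if (a : bool) (i : 'I_m) := if a then ordS i else i.
Definition end_of (i : 'I_M) (b : bool) := if b then hd i else tl i.

Definition tok_x (d : token) : V :=
  match d with
  | inl (i, inl (inl _)) => tl i
  | inl (i, inl (inr (lk, b))) =>
      if lk then p (r (end_of i b)) else end_of i b
  | inl (i, inr _) => tl i
  | inr (i, j, (a, b)) => p (step_if a i)
  end.

Definition tok_y (d : token) : V :=
  match d with
  | inl (i, inl (inl _)) => hd i
  | inl (i, inl (inr (lk, b))) =>
      if lk then q (r (tl i)) else p (r (end_of i b))
  | inl (i, inr _) => tl (ordS i)
  | inr (i, j, (a, b)) => q (step_if b j)
  end.

Definition tok_len (d : token) : nat :=
  match d with
  | inl (i, inl (inl _)) => 2 * k
  | inl (i, inl (inr _)) => k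
  | inl (i, inr (b, _)) => if b then k.+1 else k
  | inr _ => k
  end.

Lemma sum_token (f : token -> nat) : \sum_d f d
  = \sum_i (f (tok_cover i) + \sum_lk \sum_b f (tok_spoke i lk b)
            + \sum_b \sum_j f (tok_carry i b j))
    + \sum_i \sum_j \sum_a \sum_b f (tok_square i j a b).
Proof.
rewrite big_sumType /=; congr (_ + _).
  rewrite (eq_bigr (fun d => f (inl (d.1, d.2)))) => [|[]//].
  rewrite -(pair_bigA _ (fun i d => f (inl (i, d)))) /=; apply: eq_bigr => i _.
  rewrite big_sumType big_sumType /=; congr (_ + _ + _).
  - by rewrite (big_pred1 tt) // => -[].
  - by rewrite [RHS]pair_bigA /=; apply: eq_bigr => -[].
  - by rewrite [RHS]pair_bigA /=; apply: eq_bigr => -[].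
rewrite [RHS]pair_bigA /= (eq_bigr (fun d => f (inr (d.1, d.2)))) => [|[]//].
rewrite -(pair_bigA _ (fun ij d => f (inr (ij, d)))) /=; apply: eq_bigr => -[i j] _.
by rewrite [RHS]pair_bigA /=; apply: eq_bigr => -[].
Qed.

Definition edges_mult e := \sum_i edge_mult (tl i) (hd i) e.

Hypothesis tl_hd : forall i, tl i != hd i.

Lemma degree_edges v :
  degree edges_mult v = \sum_i ((v == tl i) + (v == hd i)).
Proof. by rewrite degree_sum; apply: eq_bigr => i _; rewrite degree_edge. Qed.

Hypothesis p_inj : injective p.
Hypothesis q_inj : injective q.

(** Each edge end u is charged to the hub [h (r u)], so a hub collects the degrees of the at most
    [phi] vertices in its fibre. *)
Lemma hub_load (h : 'I_m -> V) phi Delta v : injective h ->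
  (forall u, degree edges_mult u <= Delta) ->
  (forall i, #|[set u | r u == i]| <= phi) ->
  \sum_i ((v == h (r (tl i))) + (v == h (r (hd i)))) <= phi * Delta.
Proof.
move=> h_inj dD fphi.
have E : \sum_i ((v == h (r (tl i))) + (v == h (r (hd i))))
   = \sum_(u | v == h (r u)) degree edges_mult u.
  rewrite (eq_bigr _ (fun u _ => degree_edges u)) exchange_big /=.
  apply: eq_bigr => i _; rewrite big_split /=; congr (_ + _).
    rewrite big_mkcond (bigD1 (tl i)) //= eqxx big1 ?addn0; first by case: eqP.
    by move=> u /negbTE ->; rewrite if_same.
  rewrite big_mkcond (bigD1 (hd i)) //= eqxx big1 ?addn0; first by case: eqP.
  by move=> u /negbTE ->; rewrite if_same.
rewrite E.
case: (pickP (fun u => v == h (r u))) => [u0 /eqP v0|none]; last by rewrite big_pred0.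
apply: leq_trans (_ : \sum_(u in [set u | r u == r u0]) Delta <= _).
  rewrite [X in X <= _](eq_bigl (mem [set u | r u == r u0])); first exact: leq_sum.
  by move=> u; rewrite /= inE v0 (inj_eq h_inj) eq_sym.
by rewrite sum_nat_const leq_mul2r fphi orbT.
Qed.

Lemma square_load (h : 'I_m -> V) v : injective h ->
  \sum_(i : 'I_m) \sum_(a : bool) (v == h (step_if a i)) <= 2.
Proof.
move=> h_inj; rewrite exchange_big /= big_bool /=.
have S1 : \sum_(i : 'I_m) (v == h i) <= 1.
  case: (pickP (fun i => v == h i)) => [i0 /eqP v0|none]; last first.
    by rewrite big1 // => i _; rewrite none.
  rewrite (bigD1 i0) //= big1 ?addn0; first by case: eqP.
  by move=> i /negbTE ii0; rewrite v0 (inj_eq h_inj) eq_sym ii0.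
rewrite /step_if (_ : \sum_(i < m) (v == h (ordS i)) = \sum_(i < m) (v == h i)).
  by rewrite -[2]/(1 + 1) leq_add.
by rewrite [RHS](reindex_inj (@ordS_inj m)).
Qed.

(** The coefficient 2 + 8k pays for the cover, the outer spokes and the 4k carry paths seen from
    either side. The hub terms are 2 for [p] (a spoke arrives, a link leaves) and 2 for [q] (two
    links per edge). Squares give at most 4m ends at a p-hub and 4m at a q-hub. *)
Lemma token_load phi Delta v :
  (forall u, degree edges_mult u <= Delta) ->
  (forall i, #|[set u | r u == i]| <= phi) ->
  \sum_d ((v == tok_x d) + (v == tok_y d))
    <= (2 + 8 * k) * Delta + 4 * (phi * Delta) + 8 * m.
Proof.
move=> dD fphi; rewrite sum_token leq_add //.
  pose A i := (v == tl i) : nat; pose B i := (v == hd i) : nat.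
  pose W i := (v == p (r (tl i))) : nat; pose W' i := (v == p (r (hd i))) : nat.
  pose Q i := (v == q (r (tl i))) : nat.
  apply: leq_trans (_ : \sum_(i < M) (2 * (A i + B i) + 2 * (W i + W' i) + 2 * Q i
             + 4 * k * A i + 4 * k * A (ordS i)) <= _).
    apply: leq_sum => i _; rewrite !big_bool /= !sum_nat_const !card_ord.
    rewrite -/(A i) -/(B i) -/(W i) -/(W' i) -/(Q i) -/(A (ordS i)).
    by move: (A i) (B i) (W i) (W' i) (Q i) (A (ordS i)); lia.
  have AS : \sum_(i < M) A (ordS i) = \sum_(i < M) A i.
    by rewrite [RHS](reindex_inj (@ordS_inj M)).
  have h1 : \sum_(i < M) (A i + B i) <= Delta by rewrite -degree_edges.
  have h2 : \sum_(i < M) (W i + W' i) <= phi * Delta by apply: hub_load.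
  have h3 : \sum_(i < M) Q i <= phi * Delta.
    apply: leq_trans (hub_load v q_inj dD fphi); apply: leq_sum => i _; exact: leq_addr.
  have h4 : \sum_(i < M) A i <= Delta.
    by apply: leq_trans h1; apply: leq_sum => i _; exact: leq_addr.
  have h5 : 4 * k * \sum_(i < M) A i <= 4 * k * Delta by rewrite leq_mul2l h4 orbT.
  rewrite (sum_linear 2 (4 * k) (fun i => A i + B i) (fun i => W i + W' i) Q A (A \o @ordS M)) AS.
  apply: leq_trans (_ : 2 * Delta + 2 * (phi * Delta) + 2 * (phi * Delta)
    + 4 * k * Delta + 4 * k * Delta <= _); last by lia.
  by (apply: leq_add; [apply: leq_add; [apply: leq_add; [apply: leq_add|]|]|]); rewrite leq_mul2l; apply/orP; right.
have E : \sum_(i < m) \sum_(j < m) \sum_a \sum_b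
    ((v == tok_x (tok_square i j a b)) + (v == tok_y (tok_square i j a b)))
  = 2 * m * \sum_(i < m) \sum_a (v == p (step_if a i))
    + 2 * m * \sum_(j < m) \sum_b (v == q (step_if b j)).
  rewrite big_distrr /=.
  rewrite [X in _ = _ + X](_ : _ = \sum_(i < m) 2 * \sum_(j < m) \sum_b (v == q (step_if b j))); last first.
    by rewrite sum_nat_const card_ord mulnA (mulnC m).
  rewrite -big_split /=; apply: eq_bigr => i _.
  rewrite [X in _ = X + _](_ : _ = \sum_(j < m) 2 * \sum_a (v == p (step_if a i))); last first.
    by rewrite sum_nat_const card_ord mulnA (mulnC m).
  rewrite [X in _ = _ + X]big_distrr -big_split; apply: eq_bigr => j _.
  rewrite !big_bool; cbn -[addn muln]. blia.
rewrite E; apply: leq_trans (leq_add (leq_mul (leqnn _) (square_load v p_inj))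
  (leq_mul (leqnn _) (square_load v q_inj))) _.
by lia.
Qed.
End Tokens.

(** * Closed walks through the reserved paths *)

Section Gadgets.
Variables (V : finType) (adj : rel V) (k M m : nat).
Hypothesis adj_irr : irreflexive adj.
Hypothesis k2 : 1 < k.
Variables (tl hd : 'I_M -> V) (p q : 'I_m -> V) (r : V -> 'I_m).
Hypothesis tl_hd : forall i, tl i != hd i.

Local Notation token := ('I_M * (unit + bool * bool + bool * 'I_(2 * k))
   + 'I_m * 'I_m * (bool * bool))%type.
Local Notation trail := ('I_M * 'I_(2 * k) * bool + 'I_m * 'I_m)%type.
Local Notation X := (@tok_x V k M m tl hd p r).
Local Notation Y := (@tok_y V k M m tl hd p q r).

Variables (S : token -> {set V}) (g : token -> seq V).
Hypothesis g_ok : forall d, token_ok adj X Y (@tok_len k M m) S g d.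

Definition tok (d : token) e := token_mult X Y g d e.
Definition fwd (d : token) := rcons (g d) (Y d).
Definition bwd (d : token) := rcons (rev (g d)) (X d).

Lemma fwd_walk d : is_walk (X d) (fwd d) (Y d) (tok_len d) (tok d).
Proof.
have [sz _ _ pd] := g_ok d; split.
- exact: last_rcons.
- exact: path_adj_neq pd.
- rewrite size_rcons sz prednK //.
  by case: d {sz pd} => [[i [[u|[lk b]]|[b j]]]|[[i j] [a b]]] /=; try case: ifP; lia.
- by [].
Qed.

Lemma bwd_walk d : is_walk (Y d) (bwd d) (X d) (tok_len d) (tok d).
Proof. by apply: is_walk_rev; apply: fwd_walk. Qed.

Definition carry_mult (i : 'I_M) (j : 'I_(2 * k)) e :=
  tok (tok_carry m i false j) e + tok (tok_carry m i true j) e.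

Definition spoke_mult (i : 'I_M) e :=
  \sum_lk \sum_b tok (tok_spoke k m i lk b) e.

Definition square_mult (i j : 'I_m) e :=
  \sum_a \sum_b tok (tok_square k M i j a b) e.

(** The same two paths, of lengths k and k + 1, form a closed walk through [tl i] and, as [loop_in],
    one through [tl (ordS i)]. Either gadget can use the loop, so its length, which is 1 modulo 2k,
    can be moved along the chain. *)
Definition loop_out i j := fwd (tok_carry m i false j) ++ bwd (tok_carry m i true j).
Definition loop_in i j := bwd (tok_carry m i false j) ++ fwd (tok_carry m i true j).

Lemma loop_out_walk i j :
  is_walk (tl i) (loop_out i j) (tl i) (2 * k + 1) (carry_mult i j).
Proof.
have := is_walk_cat (fwd_walk (tok_carry m i false j)) (bwd_walk (tok_carry m i true j)).
by apply: is_walk_ext => //=; lia.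
Qed.

Lemma loop_in_walk i j :
  is_walk (tl (ordS i)) (loop_in i j) (tl (ordS i)) (2 * k + 1) (carry_mult i j).
Proof.
have := is_walk_cat (bwd_walk (tok_carry m i false j)) (fwd_walk (tok_carry m i true j)).
by apply: is_walk_ext => //=; lia.
Qed.

(** A present edge closes up with the cover path to length 2k + 1, and the four spokes are left
    over. If the edge is absent the spokes replace it, with total length 6k. Modulo 2k the length is
    [z] in both cases. *)
Definition body_walk (i : 'I_M) (z : bool) : seq V :=
  if z then hd i :: bwd (tok_cover k m i)
  else fwd (tok_spoke k m i false false) ++ fwd (tok_spoke k m i true false)
       ++ bwd (tok_spoke k m i true true) ++ bwd (tok_spoke k m i false true)
       ++ bwd (tok_cover k m i).

Definition trail_x (t : trail) : V :=
  match t with inl (i, _, _) => tl i | inr (i, _) => p i end.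

Definition carry_sub (P : pred 'I_(2 * k)) : seq 'I_(2 * k) := [seq j <- enum 'I_(2 * k) | P j].

(* The gadget of edge i absorbs one of the walks (i, c, z): z tells whether the
   edge itself is present, c is the number of loops carried in from the gadget
   before, and the loops from (c + z) mod 2k on are not passed to the next. *)
Definition trail_walk (t : trail) : seq V :=
  match t with
  | inl (i, c, z) =>
      body_walk i z
      ++ flatten [seq loop_in (ord_pred i) j | j <- carry_sub (fun j => j < c)]
      ++ flatten [seq loop_out i j | j <- carry_sub (fun j => (c + z) %% (2 * k) <= j)]
  | inr (i, j) =>
      fwd (tok_square k M i j false false) ++ bwd (tok_square k M i j true false)
      ++ fwd (tok_square k M i j true true) ++ bwd (tok_square k M i j false true)
  end.

Definition trail_mult (t : trail) e : nat :=
  match t with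
  | inl (i, c, z) =>
      tok (tok_cover k m i) e
      + (if z then edge_mult (tl i) (hd i) e else spoke_mult i e)
      + \sum_(j : 'I_(2 * k) | j < c) carry_mult (ord_pred i) j e
      + \sum_(j : 'I_(2 * k) | (c + z) %% (2 * k) <= j) carry_mult i j e
  | inr (i, j) => square_mult i j e
  end.

Definition trail_len (t : trail) : nat :=
  match t with
  | inl (i, c, z) => (if z then (2 * k).+1 else 6 * k)
      + ((2 * k + 1) * c + (2 * k + 1) * (2 * k - (c + z) %% (2 * k)))
  | inr _ => 4 * k
  end.

Lemma carry_sub_lt (c : nat) : c <= 2 * k -> size (carry_sub (fun j => j < c)) = c.
Proof.
move=> ck; rewrite -sum1_size big_filter big_enum_cond /= (big_ord_narrow ck).
by rewrite sum1_card card_ord.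
Qed.

Lemma carry_sub_ge (c : nat) : c <= 2 * k -> size (carry_sub (fun j => c <= j)) = 2 * k - c.
Proof.
move=> ck; have := count_predC (fun j : 'I_(2 * k) => j < c) (enum 'I_(2 * k)).
rewrite -size_filter -/(carry_sub _) carry_sub_lt // -cardE card_ord => E.
rewrite -[X in _ = X - c]E addKn size_filter.
by apply: eq_count => j /=; rewrite -leqNgt.
Qed.

Lemma trail_walkP t :
  is_walk (trail_x t) (trail_walk t) (trail_x t) (trail_len t) (trail_mult t).
Proof.
case: t => [[[i c] z]|[i j]] /=; last first.
  have := is_walk_cat (fwd_walk (tok_square k M i j false false))
    (is_walk_cat (bwd_walk (tok_square k M i j true false))
    (is_walk_cat (fwd_walk (tok_square k M i j true true))
      (bwd_walk (tok_square k M i j false true)))).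
  apply: is_walk_ext => [|e] /=; first by lia.
  rewrite /square_mult !big_bool /=.
  move: (tok (tok_square k M i j true true) e) (tok (tok_square k M i j true false) e)
    (tok (tok_square k M i j false true) e) (tok (tok_square k M i j false false) e); lia.
have ck := ltn_ord c.
have mk : (c + z) %% (2 * k) <= 2 * k by rewrite ltnW // ltn_mod; lia.
have body : is_walk (tl i) (body_walk i z) (tl i) (if z then (2 * k).+1 else 6 * k)
   (fun e => tok (tok_cover k m i) e + (if z then edge_mult (tl i) (hd i) e else spoke_mult i e)).
  rewrite /body_walk; case: z {mk}.
    have [l1 p1 s1 m1] := bwd_walk (tok_cover k m i); split.
    - by [].
    - by rewrite /= tl_hd.
    - by rewrite /= s1.
    - by move=> e /=; rewrite m1 addnC.
  have := is_walk_cat (fwd_walk (tok_spoke k m i false false))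
    (is_walk_cat (fwd_walk (tok_spoke k m i true false))
    (is_walk_cat (bwd_walk (tok_spoke k m i true true))
    (is_walk_cat (bwd_walk (tok_spoke k m i false true))
      (bwd_walk (tok_cover k m i))))).
  apply: is_walk_ext => [|e] /=; first by lia.
  rewrite /spoke_mult !big_bool /=.
  move: (tok (tok_spoke k m i true true) e) (tok (tok_spoke k m i true false) e)
    (tok (tok_spoke k m i false true) e) (tok (tok_spoke k m i false false) e)
    (tok (tok_cover k m i) e); lia.
have inc : is_walk (tl i) (flatten [seq loop_in (ord_pred i) j | j <- carry_sub (fun j => j < c)])
   (tl i) ((2 * k + 1) * c) (fun e => \sum_(j : 'I_(2 * k) | j < c) carry_mult (ord_pred i) j e).
  have H j : is_walk (tl i) (loop_in (ord_pred i) j) (tl i) (2 * k + 1) (carry_mult (ord_pred i) j).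
    by have := loop_in_walk (ord_pred i) j; rewrite ord_predK.
  apply: is_walk_ext (is_walk_flatten _ H); first by rewrite carry_sub_lt // ltnW.
  by move=> e; rewrite big_filter big_enum_cond.
have out : is_walk (tl i) (flatten [seq loop_out i j | j <- carry_sub (fun j => (c + z) %% (2 * k) <= j)])
   (tl i) ((2 * k + 1) * (2 * k - (c + z) %% (2 * k)))
   (fun e => \sum_(j : 'I_(2 * k) | (c + z) %% (2 * k) <= j) carry_mult i j e).
  apply: is_walk_ext (is_walk_flatten _ (loop_out_walk i)); first by rewrite carry_sub_ge.
  by move=> e; rewrite big_filter big_enum_cond.
by apply: is_walk_ext (is_walk_cat body (is_walk_cat inc out)) => // e; rewrite !addnA.
Qed.

(** The body has length [z] and each loop length 1 modulo 2k, so the total is z + c - (c + z). For c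
    + z = 2k the residue is 0 and all 2k loops stay in the gadget. *)
Lemma trail_len_dvd t : 2 * k %| trail_len t.
Proof.
case: t => [[[i c] z]|[i j]] /=; last by apply/dvdnP; exists 2; lia.
have ck := ltn_ord c; move: (c : nat) ck => {}c ck.
rewrite -mulnDr; case: z => /=; last first.
  by rewrite addn0 modn_small // subnKC 1?ltnW //; apply/dvdnP; exists (2 * k + 4); lia.
have -> a : (2 * k).+1 + (2 * k + 1) * a = (2 * k + 1) * a.+1 by lia.
have : c.+1 <= 2 * k by [].
rewrite leq_eqVlt (addn1 c) => /predU1P[E|lt].
  rewrite E modnn subn0 -addSn E; apply/dvdnP; exists (2 * (2 * k + 1)); lia.
by rewrite modn_small // -addSn subnKC // dvdn_mull.
Qed.

Lemma trail_len_bound t : trail_len t <= (2 * k + 1) * (4 * k) + 6 * k.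
Proof.
case: t => [[[i c] z]|[i j]] /=; last by lia.
have : (2 * k + 1) * c <= (2 * k + 1) * (2 * k) by rewrite leq_mul2l (ltnW (ltn_ord c)) orbT.
have : (2 * k + 1) * (2 * k - (c + z) %% (2 * k)) <= (2 * k + 1) * (2 * k).
  by rewrite leq_mul2l leq_subr orbT.
move: ((2 * k + 1) * c) ((2 * k + 1) * (2 * k - (c + z) %% (2 * k))) => a b.
by case: z; lia.
Qed.

Lemma sum_tok e : \sum_d tok d e
  = \sum_i (tok (tok_cover k m i) e + spoke_mult i e + \sum_j carry_mult i j e)
    + \sum_i \sum_j square_mult i j e.
Proof.
rewrite sum_token; congr (_ + _); apply: eq_bigr => i _; congr (_ + _).
by rewrite big_bool /= -big_split /=; apply: eq_bigr => j _; rewrite addnC.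
Qed.

Lemma sum_trail (f : trail -> nat) :
  \sum_t f t = \sum_i \sum_c \sum_z f (inl (i, c, z)) + \sum_i \sum_j f (inr (i, j)).
Proof.
rewrite big_sumType /=; congr (_ + _); last first.
  by rewrite pair_bigA /=; apply: eq_bigr => -[].
by rewrite pair_bigA pair_bigA /=; apply: eq_bigr => -[[]].
Qed.

(** An edge has 4k pairs (c, z). A trail uses paths of its own gadget and carry loops of the
    preceding one, each at most once: hence the two terms with factor 4k. The last term pays for the
    squares. *)
Lemma trail_mult_load e : \sum_t trail_mult t e
  <= 4 * k * (edges_mult tl hd e + \sum_d tok d e) + 4 * k * (\sum_d tok d e) + \sum_d tok d e.
Proof.
rewrite sum_trail leq_add //; last by rewrite sum_tok leq_addl.
pose C i := \sum_j carry_mult i j e.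
apply: leq_trans (_ : \sum_i 4 * k * (edge_mult (tl i) (hd i) e
    + (tok (tok_cover k m i) e + spoke_mult i e + C i) + C (ord_pred i)) <= _).
  apply: leq_sum => i _.
  apply: leq_trans (_ : \sum_(c : 'I_(2 * k)) \sum_(z : bool) (edge_mult (tl i) (hd i) e
    + (tok (tok_cover k m i) e + spoke_mult i e + C i) + C (ord_pred i)) <= _); last first.
    rewrite !sum_nat_const card_bool card_ord; nia.
  apply: leq_sum => c _; apply: leq_sum => z _ /=.
  have sub (P : pred 'I_(2 * k)) i' : \sum_(j | P j) carry_mult i' j e <= C i'.
    by rewrite /C big_mkcond /=; apply: leq_sum => j _; case: ifP.
  have h1 := sub (fun j => j < c) (ord_pred i).
  have h2 := sub (fun j => (c + z) %% (2 * k) <= j) i.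
  have arith a b sp e1 s1 s2 c1 c2 : b <= e1 + sp -> s1 <= c1 -> s2 <= c2 ->
    a + b + s1 + s2 <= e1 + (a + sp + c2) + c1 by lia.
  apply: arith h1 h2.
  by case: z; rewrite ?leq_addr ?leq_addl.
rewrite -big_distrr /= -mulnDr leq_mul2l; apply/orP; right.
rewrite big_split /= big_split /=; apply: leq_add; first apply: leq_add => //.
  by rewrite sum_tok leq_addr.
rewrite (_ : \sum_(i < M) C (ord_pred i) = \sum_(i < M) C i); last first.
  by rewrite [RHS](reindex_inj (@ord_pred_inj M)).
rewrite sum_tok; apply: leq_trans (leq_addr _ _); apply: leq_sum => i _.
exact: leq_addl.
Qed.

(** By consistency of [c], gadget i keeps the loops from [c i] on and its successor takes those
    below, so each loop is used exactly once. The chosen trails leave over the spokes of the present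
    edges and the squares with [s i j]. *)
Lemma trail_selection (z : 'I_M -> bool) (c : 'I_M -> 'I_(2 * k)) (s : 'I_m -> 'I_m -> bool) e :
  (forall i, (c (ord_pred i) + z i) %% (2 * k) = c i) ->
  \sum_d tok d e + \sum_i z i * edge_mult (tl i) (hd i) e
  = \sum_i trail_mult (inl (i, c (ord_pred i), z i)) e
    + \sum_i \sum_j ~~ s i j * trail_mult (inr (i, j)) e
    + \sum_i z i * spoke_mult i e
    + \sum_i \sum_j s i j * square_mult i j e.
Proof.
move=> cz; rewrite sum_tok.
pose lo i := \sum_(j : 'I_(2 * k) | j < c i) carry_mult i j e.
pose hi i := \sum_(j : 'I_(2 * k) | c i <= j) carry_mult i j e.
have CE i : \sum_j carry_mult i j e = lo i + hi i.
  rewrite (bigID (fun j : 'I_(2 * k) => j < c i)) /=; congr (_ + _).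
  by apply: eq_bigl => j; rewrite -leqNgt.
have -> : \sum_i trail_mult (inl (i, c (ord_pred i), z i)) e
  = \sum_i (tok (tok_cover k m i) e
     + (if z i then edge_mult (tl i) (hd i) e else spoke_mult i e)
     + lo (ord_pred i) + hi i).
  by apply: eq_bigr => i _; rewrite /= cz.
have sq : \sum_i \sum_j square_mult i j e = \sum_i \sum_j ~~ s i j * square_mult i j e
    + \sum_i \sum_j s i j * square_mult i j e.
  rewrite -big_split /=; apply: eq_bigr => i _; rewrite -big_split /=.
  by apply: eq_bigr => j _; case: (s i j); rewrite /= mul0n mul1n ?addn0.
have arith a b c' d : a + b + (c' + d) = a + c' + b + d by lia.
rewrite sq addnAC.
have -> : \sum_i (tok (tok_cover k m i) e + spoke_mult i e + \sum_j carry_mult i j e)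
  + \sum_i z i * edge_mult (tl i) (hd i) e
  = \sum_i (tok (tok_cover k m i) e
     + (if z i then edge_mult (tl i) (hd i) e else spoke_mult i e)
     + lo (ord_pred i) + hi i) + \sum_i z i * spoke_mult i e.
  transitivity (\sum_i (tok (tok_cover k m i) e + spoke_mult i e + hi i
      + z i * edge_mult (tl i) (hd i) e) + \sum_i lo i).
    rewrite -!big_split /=; apply: eq_bigr => i _; rewrite CE; lia.
  rewrite [\sum_i lo i](reindex_inj (@ord_pred_inj M)) -!big_split /=.
  by apply: eq_bigr => i _; case: (z i); rewrite ?mul0n ?mul1n; lia.
exact: arith.
Qed.
End Gadgets.

Lemma sum_setE (T : finType) (P : pred T) (f : T -> nat) :
  \sum_(d in [set d | P d]) f d = \sum_d P d * f d.
Proof.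
rewrite big_mkcond /=; apply: eq_bigr => d _; rewrite inE.
by case: (P d); rewrite ?mul1n.
Qed.

Lemma card_setE (T : finType) (P : pred T) : #|[set d | P d]| = \sum_d P d.
Proof.
rewrite -sum1_card sum_setE; apply: eq_bigr => d _; exact: muln1.
Qed.

Lemma sum_delta (T : finType) (a : T) (h : T -> nat) : \sum_u (u == a) * h u = h a.
Proof.
rewrite (bigD1 a) //= eqxx mul1n big1 ?addn0 // => u /negbTE ->.
exact: mul0n.
Qed.

Lemma sum_step m (h : 'I_m -> nat) (i0 : 'I_m) :
  \sum_i \sum_a (step_if a i == i0) * h i = h i0 + h (ord_pred i0).
Proof.
rewrite exchange_big big_bool /= addnC; congr (_ + _); first exact: sum_delta.
rewrite -[RHS]sum_delta; apply: eq_bigr => i _; congr (nat_of_bool _ * _).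
by rewrite (can2_eq (@ordSK m) (@ord_predK m)).
Qed.

Lemma odd_sum_even (I : finType) (P : pred I) (F : I -> nat) :
  (forall i, P i -> ~~ odd (F i)) -> ~~ odd (\sum_(i | P i) F i).
Proof.
move=> H; elim/big_ind: _ => // a b /negbTE Ha /negbTE Hb.
by rewrite oddD Ha Hb.
Qed.

(** * Pairing up the paths that the chosen trails leave over *)

Section Leftover.
Variables (V : finType) (adj : rel V) (k M m : nat).
Hypothesis k2 : 1 < k.
Variables (tl hd : 'I_M -> V) (p q : 'I_m -> V) (r : V -> 'I_m).
Hypothesis tl_hd : forall i, tl i != hd i.
Hypothesis p_inj : injective p.
Hypothesis q_inj : injective q.
Hypothesis p_neq_q : forall i j, p i != q j.
Hypothesis pr_neq : forall v, p (r v) != v.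

Local Notation token := ('I_M * (unit + bool * bool + bool * 'I_(2 * k))
   + 'I_m * 'I_m * (bool * bool))%type.
Local Notation X := (@tok_x V k M m tl hd p r).
Local Notation Y := (@tok_y V k M m tl hd p q r).
Local Notation Len := (@tok_len k M m).

Variables (S : token -> {set V}) (g : token -> seq V).
Hypothesis g_ok : forall d, token_ok adj X Y Len S g d.
Hypothesis g_dis : forall d d', d != d' -> share_end X Y d d' ->
  forall u, u \in g d -> u \notin g d'.

Variables (z : 'I_M -> bool) (s : 'I_m -> 'I_m -> bool).

Definition sub_edges_mult e := \sum_i z i * edge_mult (tl i) (hd i) e.

Definition link_count i j := \sum_i' z i' *
  ((r (tl i') == i) * (r (tl i') == j) + (r (hd i') == i) * (r (tl i') == j)).

Hypothesis z_even : forall v, ~~ odd (degree sub_edges_mult v).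
Hypothesis s_parity : forall i j, odd (link_count i j)
  = s i j (+) s (ord_pred i) j (+) s i (ord_pred j) (+) s (ord_pred i) (ord_pred j).

Lemma degree_sub_edges v :
  degree sub_edges_mult v = \sum_i z i * ((v == tl i) + (v == hd i)).
Proof.
rewrite degree_sum; apply: eq_bigr => i _; rewrite -(degree_edge v (tl_hd i)).
by rewrite /degree big_distrr.
Qed.

(** The number of links leaving [p i] is the sum of the degrees over its fibre, and all these
    degrees are even. *)
Lemma link_count_row i : ~~ odd (\sum_j link_count i j).
Proof.
have -> : \sum_j link_count i j = \sum_(u | r u == i) degree sub_edges_mult u.
  rewrite (eq_bigr _ (fun u _ => degree_sub_edges u)) !(exchange_big _ _ (index_enum 'I_M)) /=.
  apply: eq_bigr => i' _; rewrite -!big_distrr /=; congr (_ * _).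
  rewrite !big_split -!big_distrr /=; congr (_ + _).
    rewrite (eq_bigr (fun j => (j == r (tl i')) * 1)) => [|j _]; last by rewrite muln1 eq_sym.
    rewrite sum_delta muln1 big_mkcond -[LHS](sum_delta _ (fun u => nat_of_bool (r u == i))).
    by apply: eq_bigr => u _; case: (u == _); case: (r u == i).
  rewrite (eq_bigr (fun j => (j == r (tl i')) * 1)) => [|j _]; last by rewrite muln1 eq_sym.
  rewrite sum_delta muln1 big_mkcond -[LHS](sum_delta _ (fun u => nat_of_bool (r u == i))).
  by apply: eq_bigr => u _; case: (u == _); case: (r u == i).
by apply: odd_sum_even => u _.
Qed.

(** Both links of an edge end at [q (r (tl i'))], so the edge contributes 0 or 2 to each column.
    This is why the q-hub is taken from the tail alone. *)
Lemma link_count_col j : ~~ odd (\sum_i link_count i j).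
Proof.
rewrite exchange_big /=; apply: odd_sum_even => i' _.
rewrite -big_distrr big_split -!big_distrl /= oddM.
have E v : \sum_(i < m) (r v == i) = 1.
  by rewrite -[RHS](sum_delta (r v) (fun=> 1)); apply: eq_bigr => i _; rewrite muln1 eq_sym.
by rewrite !E addnn odd_double andbF.
Qed.

Definition is_spoke (lk : bool) (d : token) :=
  match d with inl (i, inl (inr (lk', _))) => (lk' == lk) && z i | _ => false end.

Definition is_square (d : token) :=
  match d with inr (i, j, _) => s i j | _ => false end.

Lemma sum_spokes lk (f : token -> nat) : \sum_d is_spoke lk d * f d
  = \sum_i \sum_b z i * f (tok_spoke k m i lk b).
Proof.
rewrite sum_token [X in _ + X]big1 ?addn0 => [|i _]; last first.
  by apply: big1 => j _; apply: big1 => a _; apply: big1.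
apply: eq_bigr => i _; rewrite !mul0n add0n [X in _ + X]big1 ?addn0 => [|b _]; last first.
  by apply: big1.
by rewrite big_bool /= !big_bool /=; case: lk; rewrite ?mul0n ?addn0 ?add0n.
Qed.

Lemma sum_squares (f : token -> nat) : \sum_d is_square d * f d
  = \sum_i \sum_j \sum_a \sum_b s i j * f (tok_square k M i j a b).
Proof.
rewrite sum_token big1 ?add0n // => i _; rewrite mul0n big1 ?big1 // => b _.
  by apply: big1.
by apply: big1.
Qed.

(** A spoke from [a] can only end at [p (r a)], so the class of that pair has as many paths as [a]
    has present edges, an even number. *)
Lemma outer_spokes_decomposable :
  decomposable (2 * k)
    (fun e => \sum_i \sum_b z i * tok tl hd p q r g (tok_spoke k m i false b) e).
Proof.
apply: decomposable_ext (parallel_classes_decomposable (k := k) (A := [set d | is_spoke false d])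
   _ (fun d _ => g_ok d) _ _ _).
- by move=> e; rewrite sum_setE (sum_spokes false (fun d => token_mult X Y g d e)).
- by [].
- by move=> d d' _ _; apply: g_dis.
- move=> [[i [[u|[[] b]]|[b j]]]|[[i j] [a b]]]; rewrite inE //= => _; split=> //.
  by rewrite eq_sym.
move=> a b.
have -> : #|[set d in [set d | is_spoke false d] | (X d == a) && (Y d == b)]|
   = (p (r a) == b) * degree sub_edges_mult a.
  rewrite (eq_card (B := mem [set d | is_spoke false d && ((X d == a) && (Y d == b))])); last first.
    by move=> d; rewrite !inE.
  rewrite card_setE (eq_bigr (fun d => is_spoke false d * ((X d == a) && (Y d == b)))) => [|d _]; last first.
    by rewrite mulnb.
  rewrite (sum_spokes false (fun d => nat_of_bool ((X d == a) && (Y d == b)))).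
  rewrite degree_sub_edges big_distrr /=; apply: eq_bigr => i _.
  have aux x : ((x == a) && (p (r x) == b) : nat) = (p (r a) == b) * (a == x).
    by rewrite (eq_sym a); case: (x =P a) => [->|_]; rewrite ?muln1 ?muln0.
  by rewrite big_bool /= !aux -!mulnDr addnC mulnCA.
by rewrite oddM (negbTE (z_even a)) andbF.
Qed.

(** Between [p i0] and [q j0] run the links counted by [link_count] and one path of each chosen
    square whose row is i0 or its predecessor and whose column is j0 or its predecessor; [s_parity]
    makes the total even. *)
Lemma links_decomposable :
  decomposable (2 * k)
    (fun e => \sum_i \sum_b z i * tok tl hd p q r g (tok_spoke k m i true b) e
      + \sum_i \sum_j s i j * square_mult tl hd p q r g i j e).
Proof.
apply: decomposable_ext (parallel_classes_decomposable (k := k)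
   (A := [set d | is_spoke true d || is_square d]) _ (fun d _ => g_ok d) _ _ _).
- move=> e; rewrite sum_setE.
  rewrite (eq_bigr (fun d => is_spoke true d * token_mult X Y g d e
     + is_square d * token_mult X Y g d e)) => [|d _]; last first.
    rewrite -mulnDl; congr (_ * _).
    by case: d => [[i [[u|[[] b]]|[b j]]]|[[i j] [a b]]] /=; rewrite ?addn0 ?add0n ?orbF.
  rewrite big_split (sum_spokes true (fun d => token_mult X Y g d e)).
  rewrite (sum_squares (fun d => token_mult X Y g d e)); congr (_ + _).
  apply: eq_bigr => i _; apply: eq_bigr => j _; rewrite /square_mult big_distrr /=.
  by apply: eq_bigr => a _; rewrite big_distrr.
- by [].
- by move=> d d' _ _; apply: g_dis.
- move=> [[i [[u|[[] b]]|[b j]]]|[[i j] [a b]]]; rewrite inE //= => _; split=> //;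
  exact: p_neq_q.
move=> a b.
rewrite (eq_card (B := mem [set d | (is_spoke true d || is_square d) && ((X d == a) && (Y d == b))])); last first.
  by move=> d; rewrite !inE.
rewrite card_setE (eq_bigr (fun d => is_spoke true d * ((X d == a) * (Y d == b))
     + is_square d * ((X d == a) * (Y d == b)))) => [|d _]; last first.
  rewrite -mulnDl -!mulnb; congr (_ * _).
  by case: d => [[i [[u|[[] b']]|[b' j]]]|[[i j] [a' b']]] /=; rewrite ?addn0 ?add0n ?orbF.
rewrite big_split (sum_spokes true (fun d => (X d == a) * (Y d == b))).
rewrite (sum_squares (fun d => (X d == a) * (Y d == b))) /=.
case: (pickP (fun i => p i == a)) => [i0 /eqP pa|pa]; last first.
  rewrite !big1 // => i _; last by apply: big1 => b' _; rewrite /= pa mul0n muln0.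
  by do 3 (apply: big1 => ? _); rewrite /= pa mul0n muln0.
case: (pickP (fun i => q i == b)) => [j0 /eqP qb|qb]; last first.
  rewrite !big1 // => i _; last by apply: big1 => b' _; rewrite /= qb !muln0.
  by do 3 (apply: big1 => ? _); rewrite /= qb !muln0.
have -> : \sum_i \sum_b0 z i * ((X (tok_spoke k m i true b0) == a) * (Y (tok_spoke k m i true b0) == b))
    = link_count i0 j0.
  apply: eq_bigr => i _; rewrite big_bool /= -pa -qb !(inj_eq p_inj) !(inj_eq q_inj).
  by rewrite -mulnDr addnC.
have -> : \sum_i \sum_j \sum_a0 \sum_b0 s i j
     * ((X (tok_square k M i j a0 b0) == a) * (Y (tok_square k M i j a0 b0) == b))
  = s i0 j0 + s i0 (ord_pred j0) + (s (ord_pred i0) j0 + s (ord_pred i0) (ord_pred j0)).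
  rewrite -(sum_step (fun j => s i0 j) j0) -(sum_step (fun j => s (ord_pred i0) j) j0).
  rewrite -(sum_step (fun i => \sum_j \sum_b0 (step_if b0 j == j0) * s i j) i0).
  apply: eq_bigr => i _; rewrite exchange_big /=; apply: eq_bigr => a0 _.
  rewrite big_distrr /=; apply: eq_bigr => j _; rewrite big_distrr /=.
  apply: eq_bigr => b0 _; rewrite -pa -qb !(inj_eq p_inj) !(inj_eq q_inj).
  by rewrite mulnC -mulnA.
rewrite !oddD s_parity !oddb.
by case: (s i0 j0); case: (s i0 _); case: (s (ord_pred i0) j0); case: (s _ _).
Qed.
End Leftover.

Lemma degreeZ (V : finType) c (W : {set V} -> nat) v :
  degree (fun e => c * W e) v = c * degree W v.
Proof. by rewrite /degree big_distrr. Qed.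

Section Selection.
Variables (V : finType) (adj : rel V) (k M m : nat).
Hypothesis adj_irr : irreflexive adj.
Hypothesis k2 : 1 < k.
Variables (tl hd : 'I_M -> V) (p q : 'I_m -> V) (r : V -> 'I_m).
Hypothesis tl_hd : forall i, tl i != hd i.
Hypothesis p_inj : injective p.
Hypothesis q_inj : injective q.
Hypothesis p_neq_q : forall i j, p i != q j.
Hypothesis pr_neq : forall v, p (r v) != v.

Local Notation token := ('I_M * (unit + bool * bool + bool * 'I_(2 * k))
   + 'I_m * 'I_m * (bool * bool))%type.
Local Notation trail := ('I_M * 'I_(2 * k) * bool + 'I_m * 'I_m)%type.
Local Notation X := (@tok_x V k M m tl hd p r).
Local Notation Y := (@tok_y V k M m tl hd p q r).
Local Notation Len := (@tok_len k M m).

Variables (S : token -> {set V}) (g : token -> seq V).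
Hypothesis g_ok : forall d, token_ok adj X Y Len S g d.
Hypothesis g_dis : forall d d', d != d' -> share_end X Y d d' ->
  forall u, u \in g d -> u \notin g d'.
Variable Ab : trail -> {set V} -> nat.
Hypothesis Ab_dec : forall t, decomposable (2 * k) (Ab t).
Hypothesis Ab_walk : forall t, decomposable (2 * k)
  (fun e => trail_mult tl hd p q r g t e + Ab t e).

Lemma sub_edges_absorbed (z : 'I_M -> bool) :
  (forall v, ~~ odd (degree (sub_edges_mult tl hd z) v)) ->
  2 * k %| \sum_i z i ->
  decomposable (2 * k) (fun e => sub_edges_mult tl hd z e
     + (\sum_d tok tl hd p q r g d e + \sum_t Ab t e)).
Proof.
move=> z_even z_dvd.
have k0 : 0 < 2 * k by lia.
(* The carry counts the present edges up to i modulo 2k; it closes up around the chain because the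
   total is divisible by 2k. *)
pose c (i : 'I_M) : 'I_(2 * k) := Ordinal (ltn_pmod (prefix_sum z i) k0).
have cz i : (c (ord_pred i) + z i) %% (2 * k) = c i.
  rewrite /= modnDml addnC -prefix_sumE -modnDmr.
  by case: ifP => _; rewrite ?(eqP z_dvd) ?mod0n addn0.
have [s sE] := prefix_parity2 (link_count_row r tl_hd z_even) (link_count_col tl hd r z).
pose ch (t : trail) : bool := match t with
  | inl (i, c', z') => (c' == c (ord_pred i)) && (z' == z i)
  | inr (i, j) => ~~ s i j end.
have decT : decomposable (2 * k) (fun e => \sum_t (ch t * trail_mult tl hd p q r g t e + Ab t e)).
  apply: decomposable_sum => t _; case: (ch t).
    by apply: decomposable_ext (Ab_walk t) => e; rewrite mul1n.
  by apply: decomposable_ext (Ab_dec t) => e; rewrite mul0n.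
have dec1 := outer_spokes_decomposable k2 tl_hd pr_neq g_ok g_dis z_even.
have dec2 := links_decomposable k2 p_inj q_inj p_neq_q g_ok g_dis sE.
apply: decomposable_ext (decomposableD decT (decomposableD dec1 dec2)) => e.
rewrite [RHS]addnA [X in _ = X + _]addnC (trail_selection k2 _ _ _ _ _ _ s _ cz) big_split /=.
have -> : \sum_t ch t * trail_mult tl hd p q r g t e
   = \sum_i trail_mult tl hd p q r g (inl (i, c (ord_pred i), z i)) e
     + \sum_i \sum_j ~~ s i j * trail_mult tl hd p q r g (inr (i, j)) e.
  rewrite sum_trail; congr (_ + _); apply: eq_bigr => i _.
  rewrite -(sum_delta (c (ord_pred i)) (fun c' => trail_mult tl hd p q r g (inl (i, c', z i)) e)).
  apply: eq_bigr => c' _.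
  rewrite -(sum_delta (z i) (fun z' => trail_mult tl hd p q r g (inl (i, c', z')) e)) big_distrr.
  by apply: eq_bigr => z' _; rewrite -mulnb; apply: esym (mulnA _ _ _).
have -> : \sum_i z i * spoke_mult tl hd p q r g i e
  = \sum_i \sum_b z i * tok tl hd p q r g (tok_spoke k m i false b) e
    + \sum_i \sum_b z i * tok tl hd p q r g (tok_spoke k m i true b) e.
  rewrite -big_split; apply: eq_bigr => i _; rewrite /spoke_mult big_bool.
  by rewrite [LHS]mulnDr !big_distrr [LHS]addnC.
have arith a b c1 d1 d2 f1 : a + b + c1 + (d1 + (d2 + f1)) = a + b + (d1 + d2) + f1 + c1 by lia.
exact: arith.
Qed.
End Selection.

Lemma edge_absorber k q : 0 < q -> 4 <= k ->
  exists q0 n0 : nat, forall (V : finType) (adj : rel V),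
  irreflexive adj ->
  (forall L, k.-1 <= L <= 2 * k -> robustly_connected adj q L) ->
  n0 <= #|V| ->
  forall M (tl hd : 'I_M -> V), (forall i, tl i != hd i) ->
  (forall e, edges_mult tl hd e <= graph_mult adj e) ->
  (forall v, degree (edges_mult tl hd) v * q0 <= #|V|) ->
  exists A : {set V} -> nat,
    (forall e, edges_mult tl hd e + A e <= graph_mult adj e) /\
    forall z : 'I_M -> bool,
    (forall v, ~~ odd (degree (sub_edges_mult tl hd z) v)) ->
    2 * k %| \sum_i z i ->
    decomposable (2 * k) (fun e => sub_edges_mult tl hd z e + A e).
Proof.
move=> q_gt0 k4.
have k3 : 3 <= k.-1 by lia.
have k2 : 1 < k by lia.
have [qA [nA absA]] := closed_walk_absorbers ((2 * k + 1) * (4 * k) + 6 * k) q_gt0 k4.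
have [qT [nT embT]] := robust_embedding (2 * k) 0 (8 * q + 2 * (8 * k + 1) * qA) q_gt0 k3.
(* There are about n/cm hubs: linearly many, so that fibres have bounded size 2cm, but few enough
   for the 8m path ends and the m^2 square trails. [q0] depends on [cm] since a hub carries up to
   2cm times the maximum degree. *)
have [cm cmE] : exists cm, cm = 32 * qT + 2 * qA + 2 by eexists.
have [q0 q0E] : exists q0, q0 = 8 * q + 8 * k * qA + 4 * qT * (2 + 8 * k + 8 * cm) + 1 by eexists.
exists q0, (nA + nT + 3 * cm) => V adj irr conn nV M tl hd tl_hd Ele Edeg.
pose n := #|V|.
have cm0 : 0 < cm by lia.
have q00 : 0 < q0 by lia.
have [m [m1 m2 _]] := div_bounds n cm0.
have [Delta [D1 _ D3]] := div_bounds n q00.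
have nbig : nA + nT + 3 * cm <= n by [].
have m_gt1 : 1 < m.
  have : 3 * cm < m.+1 * cm by apply: leq_ltn_trans m2; lia.
  by rewrite ltn_pmul2r //; lia.
have m_small : 2 * m <= #|V|.
  by apply: leq_trans m1; rewrite mulnC leq_mul2l cmE; lia.
have [p [qh [r [p_inj q_inj pq pr fib]]]] := hubs m_gt1 m_small.
have fib2 i : #|[set v | r v == i]| <= 2 * cm.
  apply: leq_trans (fib i) _; rewrite ltn_divLR; last by lia.
  apply: leq_trans m2 _; rewrite mulSn mulnC.
  have : cm <= m * cm by rewrite leq_pmull; lia.
  by lia.
have degD v : degree (edges_mult tl hd) v <= Delta by apply: D3; apply: Edeg.
pose X := @tok_x V k M m tl hd p r; pose Y := @tok_y V k M m tl hd p qh r.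
pose Len := @tok_len k M m.
have Dq : Delta * (8 * q) <= n by apply: leq_trans D1; rewrite leq_mul2l q0E; lia.
have DA : Delta * (8 * k * qA) <= n by apply: leq_trans D1; rewrite leq_mul2l q0E; lia.
have DT : Delta * (4 * qT * (2 + 8 * k + 8 * cm)) <= n.
  by apply: leq_trans D1; rewrite leq_mul2l q0E; lia.
have mT : m * (32 * qT) <= n by apply: leq_trans m1; rewrite leq_mul2l cmE; lia.
have mA : m * (2 * qA) <= n by apply: leq_trans m1; rewrite leq_mul2l cmE; lia.
have [||||||g [g1 g2 g3 g4]] := embT V adj irr conn _ _ setT X Y Len (fun=> set0) (edges_mult tl hd).
- by lia.
- move=> d _; rewrite /Len.
  by case: d => [[i [[u|[lk b]]|[b j]]]|[[i j] [a b]]] /=; try case: ifP; lia.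
- by move=> d _; rewrite cards0.
- move=> v; apply: leq_trans Dq.
  have := degD v; move: (degree _ v) => dv dD.
  by apply: leq_mul => //; lia.
- move=> v; have := @token_load V k M m tl hd p qh r tl_hd p_inj q_inj (2 * cm) Delta v degD fib2.
  rewrite (_ : \sum_(d in setT) ((v == X d) + (v == Y d)) = \sum_d ((v == X d) + (v == Y d)));
    last by apply: eq_bigl => d; rewrite in_setT.
  move=> ld; apply: leq_trans (_ : ((2 + 8 * k) * Delta + 4 * (2 * cm * Delta) + 8 * m) * qT <= _).
    by rewrite leq_mul2r ld orbT.
  by move: DT mT; rewrite -/n; clear; lia.
- by [].
pose L1 e := \sum_d tok tl hd p qh r g d e.
have L1E e : L1 e = \sum_(d in setT) token_mult X Y g d e.
  by apply: eq_bigl => d; rewrite inE.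
have L1deg v : degree L1 v * (8 * q + 2 * (8 * k + 1) * qA) <= n.
  by rewrite (eq_degree v L1E).
have L1q v : degree L1 v * (8 * q) <= n.
  by apply: leq_trans (L1deg v); rewrite leq_mul2l leq_addr orbT.
have L1A v : degree L1 v * (2 * (8 * k + 1) * qA) <= n.
  by apply: leq_trans (L1deg v); rewrite leq_mul2l leq_addl orbT.
have g_ok d : token_ok adj X Y Len (fun=> set0) g d by apply: g1.
have g_dis d d' : d != d' -> share_end X Y d d' -> forall u, u \in g d -> u \notin g d'.
  by apply: g2.
pose tx := @trail_x V k M m tl p.
pose ts := @trail_walk V k M m tl hd p qh r g.
have tW t := trail_walkP irr k2 tl_hd g_ok t.
(* Handshake bound, needed since the number 4kM + m^2 of trails must be a small fraction of n^2. *)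
have M2 : 2 * M <= n * Delta.
  rewrite -[n * Delta]sum_nat_const.
  apply: leq_trans (_ : \sum_(v : V) degree (edges_mult tl hd) v <= _); last first.
    by apply: leq_sum => v _; apply: degD.
  rewrite (eq_bigr _ (fun v _ => degree_edges tl_hd v)) exchange_big /=.
  rewrite (eq_bigr (fun=> 2)) ?sum_nat_const ?card_ord 1?mulnC // => i _.
  have S1 (w : V) : \sum_(v : V) (v == w) = 1.
    by rewrite (bigD1 w) //= eqxx big1 // => u /negbTE ->.
  by rewrite big_split /= !S1.
have [|||||||||Ab [Ab1 Ab2 Ab3]] := absA V adj irr conn _ _ tx ts (fun e => edges_mult tl hd e + L1 e).
- by lia.
- by move=> t; have [] := tW t.
- by move=> t; have [] := tW t.
- by move=> t; have [_ _ -> _] := tW t; apply: trail_len_dvd.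
- by move=> t; have [_ _ -> _] := tW t; apply: trail_len_bound.
- move=> v; rewrite degreeD -/n.
  have : degree (edges_mult tl hd) v * (8 * q) <= n.
    by apply: leq_trans Dq; rewrite leq_mul2r degD orbT.
  by have := L1q v; move: (degree L1 v) (degree _ v); clear; lia.
- by move=> e; rewrite L1E; apply: g3.
- move=> v; rewrite -/n.
  have E : \sum_t degree (walk_mult (tx t) (ts t)) v
     <= 4 * k * (degree (edges_mult tl hd) v + degree L1 v) + 4 * k * degree L1 v + degree L1 v.
    rewrite -degreeD -!degreeZ -!degreeD -degree_sum; apply: leq_degree => e.
    rewrite (eq_bigr (fun t => trail_mult tl hd p qh r g t e)) => [|t _]; last first.
      by have [_ _ _ ->] := tW t.
    exact: trail_mult_load.
  apply: leq_trans (_ : (4 * k * (degree (edges_mult tl hd) v + degree L1 v)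
    + 4 * k * degree L1 v + degree L1 v) * qA <= _); first by rewrite leq_mul2r E orbT.
  have : degree (edges_mult tl hd) v * (8 * k * qA) <= n.
    by apply: leq_trans DA; rewrite leq_mul2r degD orbT.
  by have := L1A v; move: (degree L1 v) (degree _ v); clear; lia.
- rewrite -/n card_sum !card_prod !card_ord card_bool.
  have h1 : 2 * M * (2 * k * qA) <= n * Delta * (2 * k * qA) by rewrite leq_mul2r M2 orbT.
  have h2 : n * (Delta * (8 * k * qA)) <= n * n by rewrite leq_mul2l DA orbT.
  have h3 : m * (m * (2 * qA)) <= n * n.
    by apply: leq_mul => //; apply: leq_trans m_small; lia.
  by move: h1 h2 h3; clear; lia.
exists (fun e => L1 e + \sum_t Ab t e); split; first by move=> e; rewrite addnA.
move=> z z_even z_dvd.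
apply: (sub_edges_absorbed k2 tl_hd p_inj q_inj pq pr g_ok g_dis Ab1 _ z_even z_dvd).
move=> t; apply: decomposable_ext (Ab2 t) => e.
by have [_ _ _ ->] := tW t.
Qed.

(** * Robust connection from common neighbourhoods *)

Section Connection.
Variables (V : finType) (adj : rel V).
Hypothesis adj_sym : symmetric adj.
Hypothesis adj_irr : irreflexive adj.

Definition codeg (x y : V) := #|[set u | adj x u && adj y u]|.

(** A vertex b counted here is the middle of paths x a b c y. Each of b, a, c can be chosen in at
    least |V|/q ways, which is what survives deletions; [half_linked] does the same for paths x a b
    y. *)
Definition linked (q : nat) := forall x y,
  #|V| <= q * #|[set b | (#|V| <= q * codeg x b) && (#|V| <= q * codeg y b)]|.

Definition half_linked (q : nat) := forall x y,
  #|V| <= q * #|[set b | adj y b && (#|V| <= q * codeg x b)]|.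

Definition blocked (F : {set V} -> nat) a := [set u | F [set a; u] != 0].

Lemma blocked_le F a : #|blocked F a| <= degree F a.
Proof.
rewrite -sum1_card big_mkcond /=; apply: leq_sum => u _.
by rewrite inE; case: (F _).
Qed.

Lemma pick_outside (A B : {set V}) : #|B| < #|A| -> exists2 a, a \in A & a \notin B.
Proof.
move=> BA; case: (set_0Vmem (A :\: B)) => [E|[a]]; last first.
  by rewrite inE => /andP[aB aA]; exists a.
by move: BA; rewrite ltnNge subset_leq_card // -setD_eq0 E.
Qed.

Lemma big_gt q (A : {set V}) s : 0 < #|V| -> #|V| <= q * #|A| -> q * s < #|V| -> s < #|A|.
Proof.
move=> V0 VA sV; rewrite ltnNge; apply/negP => As.
have : q * #|A| <= q * s by rewrite leq_mul2l As orbT.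
by lia.
Qed.

Lemma linked_connected q : 0 < q -> 8 * q <= #|V| -> linked q ->
  robustly_connected adj (8 * q) 4.
Proof.
move=> q0 Vq lk x y O F hO hF.
have V0 : 0 < #|V| by lia.
have [b] : exists2 b, b \in [set b | (#|V| <= q * codeg x b) && (#|V| <= q * codeg y b)] & b \notin O.
  by apply: pick_outside; apply: (big_gt V0 (lk x y)); lia.
rewrite inE => /andP[xb yb] bO.
have [a] : exists2 a, a \in [set u | adj x u && adj b u]
    & a \notin O :|: blocked F x :|: blocked F b.
  apply: pick_outside; apply: (big_gt V0 xb).
  apply: leq_ltn_trans (_ : q * (#|O| + degree F x + degree F b) < _).
    rewrite leq_mul2l; apply/orP; right; apply: leq_trans (leq_card_setU _ _) _.
    apply: leq_add (blocked_le _ _); apply: leq_trans (leq_card_setU _ _) _.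
    exact: leq_add (leqnn _) (blocked_le _ _).
  by have := hF x; have := hF b; lia.
rewrite !inE !negb_or !negbK => /andP[xa ba] /andP[/andP[aO Fxa] Fba].
have [c] : exists2 c, c \in [set u | adj y u && adj b u]
    & c \notin O :|: blocked F y :|: blocked F b :|: [set a].
  apply: pick_outside; apply: (big_gt V0 yb).
  apply: leq_ltn_trans (_ : q * (#|O| + degree F y + degree F b + 1) < _).
    rewrite leq_mul2l; apply/orP; right; apply: leq_trans (leq_card_setU _ _) _.
    rewrite cards1 leq_add2r; apply: leq_trans (leq_card_setU _ _) _.
    apply: leq_add (blocked_le _ _); apply: leq_trans (leq_card_setU _ _) _.
    exact: leq_add (leqnn _) (blocked_le _ _).
  by have := hF y; have := hF b; lia.
rewrite !inE !negb_or !negbK => /andP[yc bc] /andP[/andP[/andP[cO Fyc] Fbc] ca].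
exists [:: a; b; c]; split=> //.
- have ab : a != b by apply: contraTneq ba => ->; rewrite adj_irr.
  have bc' : b != c by apply: contraTneq bc => ->; rewrite adj_irr.
  by rewrite /= !inE negb_or ab bc' (eq_sym a) ca.
- by move=> v; rewrite !inE => /or3P[] /eqP ->.
by rewrite /= xa Fxa (adj_sym a) ba (setUC [set a]) Fba bc Fbc (adj_sym c) yc (setUC [set c]) Fyc.
Qed.

Lemma half_linked_connected q : 0 < q -> 8 * q <= #|V| -> half_linked q ->
  robustly_connected adj (8 * q) 3.
Proof.
move=> q0 Vq lk x y O F hO hF.
have V0 : 0 < #|V| by lia.
have [b] : exists2 b, b \in [set b | adj y b && (#|V| <= q * codeg x b)]
    & b \notin O :|: blocked F y.
  apply: pick_outside; apply: (big_gt V0 (lk x y)).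
  apply: leq_ltn_trans (_ : q * (#|O| + degree F y) < _).
    rewrite leq_mul2l; apply/orP; right; apply: leq_trans (leq_card_setU _ _) _.
    exact: leq_add (leqnn _) (blocked_le _ _).
  by have := hF y; lia.
rewrite !inE negb_or negbK => /andP[yb xb] /andP[bO Fyb].
have [a] : exists2 a, a \in [set u | adj x u && adj b u]
    & a \notin O :|: blocked F x :|: blocked F b.
  apply: pick_outside; apply: (big_gt V0 xb).
  apply: leq_ltn_trans (_ : q * (#|O| + degree F x + degree F b) < _).
    rewrite leq_mul2l; apply/orP; right; apply: leq_trans (leq_card_setU _ _) _.
    apply: leq_add (blocked_le _ _); apply: leq_trans (leq_card_setU _ _) _.
    exact: leq_add (leqnn _) (blocked_le _ _).
  by have := hF x; have := hF b; lia.
rewrite !inE !negb_or !negbK => /andP[xa ba] /andP[/andP[aO Fxa] Fba].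
exists [:: a; b]; split=> //.
- rewrite /= !inE andbT.
  by apply: contraTneq ba => ->; rewrite adj_irr.
- by move=> v; rewrite !inE => /orP[] /eqP ->.
by rewrite /= xa Fxa (adj_sym a) ba (setUC [set a]) Fba (adj_sym b) yb (setUC [set b]) Fyb.
Qed.

(** A free step from [x] to some [a] is followed by the shorter path from [a]. As [a] itself joins
    the forbidden set, the constant contains [2 * q'] rather than [q']. *)
Lemma connected_step q q' L : 0 < q -> 8 * q <= #|V| -> linked q ->
  2 * q' <= #|V| -> 0 < L ->
  robustly_connected adj q' L -> robustly_connected adj (8 * q + 2 * q') L.+1.
Proof.
move=> q0 Vq lk Vq' L0 conn x y O F hO hF.
have V0 : 0 < #|V| by lia.
have [b] : exists2 b, b \in [set b | (#|V| <= q * codeg x b) && (#|V| <= q * codeg y b)] & b \notin set0.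
  by apply: pick_outside; apply: (big_gt V0 (lk x y)); rewrite cards0 muln0.
rewrite inE => /andP[xb _] _.
have [a] : exists2 a, a \in [set u | adj x u && adj b u] & a \notin O :|: blocked F x.
  apply: pick_outside; apply: (big_gt V0 xb).
  apply: leq_ltn_trans (_ : q * (#|O| + degree F x) < _).
    rewrite leq_mul2l; apply/orP; right; apply: leq_trans (leq_card_setU _ _) _.
    exact: leq_add (leqnn _) (blocked_le _ _).
  by have := hF x; lia.
rewrite !inE !negb_or !negbK => /andP[xa ba] /andP[aO Fxa].
have [||p [sp up pO pp]] := conn a y (a |: O) F.
- by rewrite cardsU1 aO; lia.
- by move=> v; have := hF v; lia.
exists (a :: p); split.
- by rewrite /= sp prednK.
- by rewrite /= up andbT; apply/negP => /pO; rewrite !inE eqxx.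
- move=> v; rewrite inE => /predU1P[->//|/pO].
  by rewrite !inE negb_or => /andP[].
- by rewrite /= xa Fxa.
Qed.
End Connection.

Lemma linked_connected_all q Lmax : 0 < q ->
  exists q' n0, 0 < q' /\ forall (V : finType) (adj : rel V),
  symmetric adj -> irreflexive adj -> n0 <= #|V| -> linked adj q ->
  forall L, 4 <= L <= Lmax -> robustly_connected adj q' L.
Proof.
move=> q0; elim: Lmax => [|Lmax [q' [n0 [q'0 IH]]]].
  by exists 1, 0; split=> // V adj _ _ _ _ L; lia.
exists (8 * q + 2 * q'), (n0 + 8 * q + 2 * q'); split; first by lia.
move=> V adj sadj irr nV lk L Lr.
have {}IH := IH V adj sadj irr _ lk.
have c4 : robustly_connected adj (8 * q + 2 * q') 4.
  by apply: (robustly_connectedW (q := 8 * q)); [lia | apply: linked_connected => //; lia].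
case: (ltngtP L Lmax.+1) => [lt|gt|E]; last 1 first.
- case: (ltngtP L 4) => [|gt4|->] //; first by lia.
  rewrite E; apply: connected_step => //; try lia.
  by apply: IH; lia.
- by apply: (robustly_connectedW (q := q')); [lia | apply: IH; lia].
- by lia.
Qed.

(** * A sparse robustly connected subgraph *)

Lemma leq_exp2rW m n e : m <= n -> m ^ e <= n ^ e.
Proof. by case: e => // e; rewrite leq_exp2r. Qed.

(** Bernoulli's inequality (1 + 1/d)^e >= 1 + e/d, cleared of denominators. *)
Lemma bernoulli_up d e : d ^ e * (d + e) <= d.+1 ^ e * d.
Proof.
elim: e => [|e IH]; first by rewrite !expn0 addn0.
have : d ^ e * (d + e) * d.+1 <= d.+1 ^ e * d * d.+1 by rewrite leq_mul2r IH orbT.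
rewrite !expnSr; move: (d ^ e) (d.+1 ^ e) => a b h.
apply: leq_trans (_ : a * (d + e) * d.+1 <= _); last by apply: leq_trans h _; lia.
by rewrite -!mulnA leq_mul2l; apply/orP; right; lia.
Qed.

Lemma double_pow d : 0 < d -> 2 * d ^ d.+1 <= d.+1 ^ d.+1.
Proof.
move=> d0; rewrite -(leq_pmul2r d0); apply: leq_trans (bernoulli_up d d.+1).
by rewrite (mulnC 2) -mulnA leq_mul2l; apply/orP; right; lia.
Qed.

(** Bernoulli's inequality (1 - 1/(c+1))^j >= 1 - j/(c+1), cleared of denominators. *)
Lemma bernoulli_down c j : j <= c.+1 -> c.+1 ^ j * (c.+1 - j) <= c ^ j * c.+1.
Proof.
elim: j => [|j IH] jc; first by rewrite !expn0 subn0.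
have := IH (ltnW jc); rewrite !expnSr; move: (c.+1 ^ j) (c ^ j) => a b h.
have [e E] : exists e, c = j + e by exists (c - j); lia.
rewrite (_ : c.+1 - j = e.+1) in h; last by lia.
rewrite (_ : c.+1 - j.+1 = e); last by lia.
apply: leq_trans (_ : a * e.+1 * c <= _).
  by rewrite -!mulnA leq_mul2l; apply/orP; right; rewrite E; lia.
by apply: leq_trans (leq_mul h (leqnn c)) _; lia.
Qed.

(** (1 + 1/c)^c <= 4 for c = 2j: Bernoulli bounds the square root (1 + 1/c)^j by 2. For its sake the
    number of colours will be even. *)
Lemma pow_succ_even j : (2 * j).+1 ^ (2 * j) <= 4 * (2 * j) ^ (2 * j).
Proof.
set c := 2 * j.
have h : c.+1 ^ j <= 2 * c ^ j.
  have jc : j <= c.+1 by rewrite /c; lia.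
  have := bernoulli_down jc; have : c.+1 <= 2 * (c.+1 - j) by rewrite /c; lia.
  move=> h1 h2; rewrite -(leq_pmul2r (m := c.+1)) //.
  apply: leq_trans (leq_mul (leqnn _) h1) _.
  by rewrite mulnCA -mulnA leq_mul2l.
have cE b : b ^ c = (b ^ j) ^ 2 by rewrite -expnM mulnC.
by rewrite !cE (_ : 4 = 2 ^ 2) // -expnMn leq_exp2r.
Qed.

Lemma poly_lt_exp2 K : exists t0, forall t, t0 <= t -> K * t.+1 ^ 2 < 2 ^ t.
Proof.
exists (27 * K.+1) => t tK.
have E := divn_eq t 3; have r3 : t %% 3 < 3 by rewrite ltn_mod.
move: (t %/ 3) (t %% 3) E r3 => u r -> r3 in tK *.
have u2 : u.+1 <= 2 ^ u by apply: ltn_expl.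
apply: leq_trans (_ : (2 ^ u) ^ 3 <= _); last by rewrite -expnM leq_exp2l // leq_addr.
apply: leq_trans (_ : u.+1 ^ 3 <= _); last by rewrite leq_exp2r.
apply: leq_ltn_trans (_ : K * (9 * u.+1 ^ 2) < _).
  rewrite leq_mul2l (_ : 9 = 3 ^ 2) // -expnMn leq_exp2r //; lia.
rewrite mulnA (expnSr _ 2) mulnC ltn_mul2l expn_gt0 /=; lia.
Qed.

Section Coloring.
Variables (V C : finType).
Implicit Types (h : {ffun V -> C}).

(** Probability is counting over all colourings; independence of the colours at different vertices
    becomes distributivity. *)
Lemma sum_prod_colorings (w : V -> C -> nat) :
  \sum_(h : {ffun V -> C}) \prod_v w v (h v) = \prod_v \sum_(j : C) w v j.
Proof. by rewrite bigA_distr_bigA. Qed.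

(* Exponential moments: weight a colouring by 2 to the number of vertices of A
   that miss colour j. *)
Lemma few_hits_bound (A : {set V}) (j : C) t d : #|C| = d.+1 -> 0 < d ->
  4 * #|C| * t <= #|A| ->
  #|[set h : {ffun V -> C} | #|[set v in A | h v == j]| <= t]| * 2 ^ t
    <= #|C| ^ #|V|.
Proof.
move=> Cd d0 tA; set Bad := [set h | _].
pose w v (i : C) := if (v \in A) && (i != j) then 2 else 1.
have wsum v : \sum_(i : C) w v i = if v \in A then (2 * d).+1 else #|C|.
  rewrite /w; case: (v \in A) => /=; last by rewrite sum1_card.
  rewrite (bigD1 j) //= eqxx /= (eq_bigr (fun=> 2)) => [|i ->//].
  rewrite sum_nat_const.
  have -> : #|[pred i | i != j]| = d by have := cardC1 j; rewrite Cd /= => <-; apply: eq_card.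
  by rewrite mulnC.
have total : \prod_v \sum_(i : C) w v i = (2 * d).+1 ^ #|A| * #|C| ^ (#|V| - #|A|).
  rewrite (eq_bigr _ (fun v _ => wsum v)) (bigID (mem A)) /=; congr (_ * _).
    by rewrite -prod_nat_const; apply: eq_bigr => v ->.
  have -> : #|V| - #|A| = #|~: A| by rewrite [RHS]cardsCs setCK.
  rewrite -prod_nat_const; apply: eq_big => v; first by rewrite inE.
  by move/negbTE ->.
have wh h : \prod_v w v (h v) = 2 ^ (#|A| - #|[set v in A | h v == j]|).
  rewrite /w -big_mkcond /= prod_nat_const; congr (2 ^ _).
  rewrite -(cardsID [set v | h v == j] A).
  rewrite (_ : [set v in A | h v == j] = A :&: [set v | h v == j]); last first.
    by apply/setP => v; rewrite !inE.
  by rewrite addKn; apply: eq_card => v; rewrite !inE andbC.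
have At : t <= #|A| by apply: leq_trans tA; rewrite Cd; lia.
(* Markov's inequality: a bad colouring has weight at least 2^(|A| - t). *)
have step1 : #|Bad| * 2 ^ (#|A| - t) <= (2 * d).+1 ^ #|A| * #|C| ^ (#|V| - #|A|).
  rewrite -total -sum_prod_colorings -sum_nat_const big_mkcond /=.
  apply: leq_sum => h _; rewrite inE; case: ifP => // ht.
  by rewrite wh leq_exp2l // leq_sub2l.
(* The mean weight at a vertex of A is 2 - 1/c with c = |C|. By [double_pow], (1 - 1/(2c))^(2c) <=
   1/2, and A has at least 2c times 2t vertices. *)
have step2 : 2 ^ (2 * t) * (2 * d).+1 ^ #|A| <= (2 * #|C|) ^ #|A|.
  have e2 : 2 * #|C| = (2 * d).+2 by rewrite Cd; lia.
  have := @double_pow (2 * d).+1 isT; rewrite -e2.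
  move: (2 * d).+1 e2 => b e2 hb.
  have [x Ax] : exists x, #|A| = 2 * #|C| * (2 * t) + x.
    by exists (#|A| - 2 * #|C| * (2 * t)); lia.
  rewrite Ax !(expnD _ (2 * #|C| * (2 * t))) mulnA leq_mul //; last by rewrite leq_exp2rW // e2.
  by rewrite !(expnM _ (2 * #|C|)); rewrite -expnMn leq_exp2rW.
have AV : #|A| <= #|V| by apply: max_card.
rewrite -(leq_pmul2r (m := 2 ^ t * (2 * #|C|) ^ #|A|)); last first.
  by rewrite muln_gt0 !expn_gt0 /= Cd.
have -> : #|C| ^ #|V| = #|C| ^ #|A| * #|C| ^ (#|V| - #|A|) by rewrite -expnD subnKC.
have E2 : 2 ^ #|A| = 2 ^ t * 2 ^ (#|A| - t) by rewrite -expnD subnKC.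
rewrite [in X in X <= _]expnMn E2.
have Et : 2 ^ (2 * t) = 2 ^ t * 2 ^ t by rewrite mul2n -addnn expnD.
rewrite Et in step2; move: step1 step2.
move: (2 ^ t) (2 ^ (#|A| - t)) (#|C| ^ #|A|) (#|C| ^ (#|V| - #|A|))
  ((2 * d).+1 ^ #|A|) ((2 * #|C|) ^ #|A|) => p2 r2 ca cv da ra.
move: #|Bad| => bad h1 h2.
have h3 : bad * r2 * (p2 * p2 * p2 * ca) <= da * cv * (p2 * p2 * p2 * ca) by rewrite leq_mul2r h1 orbT.
have h4 : p2 * p2 * da * (cv * p2 * ca) <= ra * (cv * p2 * ca) by rewrite leq_mul2r h2 orbT.
by lia.
Qed.

(** Weight 2 on the vertices of colour [j] has mean (1 + 1/|C|)^|V| <= 4^(u+1), against 2^(4u+2) for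
    a class of that size: a gain of 2^(2u). For u = |V|/|C| the threshold is about four times the
    average class. *)
Lemma big_class_bound (j : C) u d : #|C| = 2 * d -> 0 < d -> #|V| <= #|C| * u.+1 ->
  #|[set h : {ffun V -> C} | 4 * u + 2 <= #|[set v | h v == j]|]| * 2 ^ (4 * u + 2)
    <= 4 ^ u.+1 * #|C| ^ #|V|.
Proof.
move=> Cd d0 Vu; set Bad := [set h | _].
pose w (v : V) (i : C) := if i == j then 2 else 1.
have wsum v : \sum_(i : C) w v i = #|C|.+1.
  rewrite /w (bigD1 j) //= eqxx (eq_bigr (fun=> 1)) => [|i /negbTE ->//].
  rewrite sum1_card.
  have -> : #|[pred i | i != j]| = #|C|.-1 by rewrite -(cardC1 j); apply: eq_card.
  by rewrite Cd; lia.
have total : \prod_v \sum_(i : C) w v i = #|C|.+1 ^ #|V|.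
  by rewrite (eq_bigr _ (fun v _ => wsum v)) prod_nat_const.
have wh h : \prod_v w v (h v) = 2 ^ #|[set v | h v == j]|.
  by rewrite /w -big_mkcond /= prod_nat_const; congr (2 ^ _); apply: eq_card => v; rewrite inE.
apply: leq_trans (_ : #|C|.+1 ^ #|V| <= _).
  rewrite -total -sum_prod_colorings -sum_nat_const big_mkcond /=.
  apply: leq_sum => h _; rewrite inE; case: ifP => // ht.
  by rewrite wh leq_exp2l.
have hC : #|C|.+1 ^ #|C| <= 4 * #|C| ^ #|C| by rewrite Cd; apply: pow_succ_even.
have [x Vx] : exists x, #|C| * u.+1 = #|V| + x by exists (#|C| * u.+1 - #|V|); lia.
have C0 : 0 < #|C| by rewrite Cd; lia.
have Cx : 0 < #|C| ^ x by rewrite expn_gt0 C0.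
rewrite -(leq_pmul2r Cx) -mulnA -expnD -Vx.
apply: leq_trans (_ : #|C|.+1 ^ (#|C| * u.+1) <= _).
  by rewrite Vx expnD leq_mul2l leq_exp2rW ?orbT.
by rewrite !(expnM _ #|C|) -expnMn leq_exp2rW.
Qed.
End Coloring.

(** Union bound over at most (2n^2 + 1)|C| bad events, each of probability at most 2^(-t) with t
    linear in n. *)
Lemma good_coloring (C : finType) d q0 : #|C| = 2 * d -> 0 < d -> 0 < q0 ->
  exists q1 n0, 0 < q1 /\ forall (V I : finType) (A : I -> {set V}),
  n0 <= #|V| -> #|I| <= 2 * #|V| ^ 2 -> (forall i, #|V| <= q0 * #|A i|) ->
  exists h : {ffun V -> C},
    (forall i j, #|V| <= q1 * #|[set v in A i | h v == j]|) /\
    (forall j, #|[set v | h v == j]| * #|C| <= 6 * #|V|).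
Proof.
move=> Cd d0 q00; pose c := #|C|.
(* For t = n/q1 this gives 4|C|t <= n/q0, the size that [few_hits_bound] asks of each set. *)
have [q1 q1E] : exists q1, q1 = 4 * c * q0 by eexists.
have c0 : 0 < c by rewrite /c Cd; lia.
have q10 : 0 < q1 by rewrite q1E !muln_gt0 c0.
have [t0 t0P] := poly_lt_exp2 (2 * q1 ^ 2 * c).
exists q1, (t0 * q1 + c); split=> // V I A nV cI hA.
have [t [t1 t2 t3]] := div_bounds #|V| q10.
have [u [u1 u2 u3]] := div_bounds #|V| c0.
have tt0 : t0 <= t by apply: t3; lia.
have cq : c <= q1 by rewrite q1E mulnAC leq_pmull // muln_gt0.
have tu : t <= u by apply: u3; apply: leq_trans t1; rewrite leq_mul.
pose Bad1 i j := [set h : {ffun V -> C} | #|[set v in A i | h v == j]| <= t].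
pose Bad2 j := [set h : {ffun V -> C} | 4 * u + 2 <= #|[set v | h v == j]|].
have b1 i j : #|Bad1 i j| * 2 ^ t <= c ^ #|V|.
  apply: (@few_hits_bound V C (A i) j t (2 * d).-1); rewrite ?Cd -/c; try lia.
  rewrite -(leq_pmul2l q00); apply: leq_trans (hA i); apply: leq_trans t1.
  by rewrite q1E /c Cd; lia.
have b2 j : #|Bad2 j| * 2 ^ t <= c ^ #|V|.
  have := @big_class_bound V C j u d Cd d0; rewrite -/c -/(Bad2 j) mulnC => /(_ (ltnW u2)).
  rewrite (_ : 4 ^ u.+1 = 2 ^ (2 * u + 2)); last by rewrite (_ : 4 = 2 ^ 2) // -expnM; congr (_ ^ _); lia.
  rewrite (_ : 4 * u + 2 = 2 * u + 2 + 2 * u); last by lia.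
  rewrite expnD mulnA (mulnC #|_|) -mulnA leq_pmul2l ?expn_gt0 //.
  move=> hb; apply: leq_trans hb; rewrite leq_mul2l leq_exp2l //.
  by apply/orP; right; lia.
pose Bad := [set h | [exists i, exists j, h \in Bad1 i j] || [exists j, h \in Bad2 j]].
have cBad : #|Bad| <= \sum_i \sum_j #|Bad1 i j| + \sum_j #|Bad2 j|.
  have cE (S : {set {ffun V -> C}}) : #|S| = \sum_h (h \in S).
    by rewrite -sum1_card big_mkcond /=; apply: eq_bigr => h _; case: (h \in S).
  have E1 : \sum_i \sum_j #|Bad1 i j| = \sum_h \sum_i \sum_j (h \in Bad1 i j).
    rewrite [RHS]exchange_big /=; apply: eq_bigr => i _; rewrite [RHS]exchange_big /=.
    by apply: eq_bigr => j _; apply: cE.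
  have E2 : \sum_j #|Bad2 j| = \sum_h \sum_j (h \in Bad2 j).
    by rewrite [RHS]exchange_big /=; apply: eq_bigr => j _; apply: cE.
  rewrite cE E1 E2 -big_split /=; apply: leq_sum => h _.
  rewrite inE; case: existsP => [[i /existsP[j hB]]|_] /=.
    by rewrite (bigD1 i) //= (bigD1 j) //= hB.
  case: existsP => [[j hB]|_] //.
  by rewrite [X in _ + X](bigD1 j) //= hB addnCA.
have : #|Bad| * 2 ^ t < 2 ^ t * c ^ #|V|.
  apply: leq_ltn_trans (_ : (2 * #|V| ^ 2 + 1) * c * c ^ #|V| < _).
    apply: leq_trans (_ : (\sum_(i : I) \sum_(j : C) c ^ #|V|) + \sum_(j : C) c ^ #|V| <= _).
      apply: leq_trans (leq_mul cBad (leqnn _)) _.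
      rewrite mulnDl !big_distrl /=; apply: leq_add; apply: leq_sum => i _ //.
      by rewrite big_distrl /=; apply: leq_sum => j _.
    rewrite !sum_nat_const -/c -mulSnr -mulnA leq_mul2r; apply/orP; right.
    by rewrite addn1 ltnS.
  rewrite ltn_mul2r expn_gt0 c0 /=; apply: leq_ltn_trans (t0P _ tt0).
  have : #|V|.+1 ^ 2 <= (t.+1 * q1) ^ 2 by rewrite leq_exp2r.
  rewrite !expnMn -!mulnn.
  move: (t.+1 * t.+1) (q1 * q1) => T Q hT.
  have : #|V|.+1 * #|V|.+1 * c <= T * Q * c by rewrite leq_mul2r hT orbT.
  have hc : (2 * (#|V| * #|V|) + 1) * c < 2 * (#|V|.+1 * #|V|.+1) * c.
    by rewrite ltn_mul2r c0 /=; move: #|V|; clear; lia.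
  move=> hT2; apply: leq_trans (ltnW hc) _.
  by rewrite -mulnA (_ : 2 * Q * c * T = 2 * (T * Q * c)) ?leq_mul2l //; clear; lia.
rewrite mulnC ltn_pmul2l ?expn_gt0 // => lt.
have [h _ hB] : exists2 h : {ffun V -> C}, h \in setT & h \notin Bad.
  by apply: pick_outside; rewrite cardsT card_ffun.
exists h; move: hB; rewrite inE negb_or => /andP[/existsPn hB1 /existsPn hB2]; split.
  move=> i j; have /existsPn/(_ j) := hB1 i; rewrite inE -ltnNge => lt'.
  apply: leq_trans (ltnW t2) _; rewrite mulnC leq_mul2l lt' orbT //.
move=> j; have := hB2 j; rewrite inE -ltnNge => lt'.
have : #|[set v | h v == j]| * c <= (4 * u + 1) * c by rewrite leq_mul2r; apply/orP; right; lia.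
by rewrite -/c; lia.
Qed.

Lemma sparse_linked_subgraph q0 qe : 0 < q0 ->
  exists q1 n0, 0 < q1 /\ forall (V : finType) (adj : rel V),
  symmetric adj -> n0 <= #|V| -> linked adj q0 ->
  exists adj0 : rel V, [/\ symmetric adj0, subrel adj0 adj, linked adj0 q1
    & forall v, #|[set u | adj0 v u]| * qe <= #|V|].
Proof.
(* A vertex sees at most 2p colours, each on at most 6n/p^2 vertices, so its degree is at most
   12n/p, below n/qe. [p] is even to make the number p^2 of colours even. *)
move=> q00; pose p := 12 * qe + 2; pose d := (6 * qe + 1) * p.
have Cd : #|{: 'I_p * 'I_p}| = 2 * d by rewrite card_prod card_ord /d /p; lia.
have d0 : 0 < d by rewrite /d /p; lia.
have [q1 [n0 [q10 col]]] := good_coloring Cd d0 q00.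
exists q1, n0; split=> // V adj sadj nV lk.
(* The sets that must keep a linear part in every colour: middle vertices for a pair (flag [false])
   and common neighbourhoods (flag [true]). Where the latter are small nothing is claimed, and
   [setT] stands in. *)
pose A (xbs : V * V * bool) : {set V} := let: (x, b, s) := xbs in
  if s then (if #|V| <= q0 * codeg adj x b then [set u | adj x u && adj b u] else setT)
  else [set b' | (#|V| <= q0 * codeg adj x b') && (#|V| <= q0 * codeg adj b b')].
have [||h [h1 h2]] := col V _ A nV.
- by rewrite !card_prod card_bool -mulnn; lia.
- move=> [[x b] []] /=; last exact: lk.
  by case: ifP => // _; rewrite cardsT leq_pmull.
(* De Bruijn-type pattern: it has walks of every length at least 2 between any
   two colours, but degree at most 2p among p^2 colours. *)
pose Gam (i j : 'I_p * 'I_p) := (i.2 == j.1) || (i.1 == j.2).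
have Gam_sym i j : Gam i j = Gam j i by rewrite /Gam orbC eq_sym (eq_sym i.2).
pose adj0 := [rel v u | adj v u && Gam (h v) (h u)].
exists adj0; split.
- by move=> v u; rewrite /= sadj Gam_sym.
- by move=> v u /andP[].
(* The colours along a path of length 4 from x to y will be h x, (s, s), (s, s), (s, (h y).1), h y;
   consecutive ones are related by [Gam]. *)
- move=> x y; pose s := (h x).2.
  apply: leq_trans (h1 (x, y, false) (s, s)) _; rewrite leq_mul2l; apply/orP; right.
  apply: subset_leq_card; apply/subsetP => b; rewrite !inE => /andP[/andP[xb yb] /eqP hb].
  apply/andP; split.
    apply: leq_trans (h1 (x, b, true) (s, s)) _; rewrite leq_mul2l; apply/orP; right.
    apply: subset_leq_card; apply/subsetP => u; rewrite /= xb !inE => /andP[/andP[xu bu] /eqP hu].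
    by rewrite /= xu bu hb hu /Gam /= eqxx.
  apply: leq_trans (h1 (y, b, true) (s, (h y).1)) _; rewrite leq_mul2l; apply/orP; right.
  apply: subset_leq_card; apply/subsetP => u; rewrite /= yb !inE => /andP[/andP[yu bu] /eqP hu].
  by rewrite /= yu bu hb hu /Gam /= !eqxx orbT.
move=> v.
have cG i : #|[set j | Gam i j]| <= 2 * p.
  rewrite card_setE -(pair_bigA _ (fun a b => nat_of_bool (Gam i (a, b)))) /=.
  apply: leq_trans (_ : \sum_(a < p) \sum_(b < p) ((a == i.2) + (b == i.1)) <= _).
    apply: leq_sum => a _; apply: leq_sum => b _; rewrite /Gam /= (eq_sym a) (eq_sym b).
    by case: (_ == a); case: (_ == b).
  have S1 (w : 'I_p) : \sum_(a < p) (a == w) = 1.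
    by rewrite -[RHS](sum_delta w (fun=> 1)); apply: eq_bigr => a _; rewrite muln1.
  rewrite (eq_bigr (fun a => p * (a == i.2) + 1)) => [|a _]; last first.
    by rewrite big_split /= S1 sum_nat_const card_ord.
  rewrite big_split /= -big_distrr /= S1 sum_nat_const card_ord; lia.
have dv : #|[set u | adj0 v u]| <= \sum_(j in [set j | Gam (h v) j]) #|[set u | h u == j]|.
  rewrite -sum1_card (partition_big h (mem [set j | Gam (h v) j])) /=; last first.
    by move=> u; rewrite !inE => /andP[].
  apply: leq_sum => j _; rewrite sum1_card; apply: subset_leq_card.
  by apply/subsetP => u; rewrite !inE unfold_in => /andP[_].
have dv2 : #|[set u | adj0 v u]| * (p * p) <= 2 * p * (6 * #|V|).
  apply: leq_trans (leq_mul dv (leqnn _)) _; rewrite big_distrl /=.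
  apply: leq_trans (_ : \sum_(j in [set j | Gam (h v) j]) 6 * #|V| <= _).
    by apply: leq_sum => j _; have := h2 j; rewrite card_prod card_ord.
  by rewrite sum_nat_const leq_mul2r cG orbT.
have p0 : 0 < p by rewrite /p; lia.
have : #|[set u | adj0 v u]| * p <= 12 * #|V|.
  by rewrite -(leq_pmul2r p0); move: dv2; clear; lia.
move: #|[set u | adj0 v u]| => dd; rewrite /p; clear; lia.
Qed.

(** * Covering the leftover of a greedy decomposition *)

Section Leftovers.
Variable V : finType.
Implicit Types (M H F : {set V} -> nat) (x y u v b : V) (e : {set V}) (c : seq V).

Lemma msizeD M F : msize (fun e => M e + F e) = msize M + msize F.
Proof. by rewrite /msize big_split. Qed.

Lemma eq_msize M F : M =1 F -> msize M = msize F.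
Proof. by move=> E; apply: eq_bigr => e _. Qed.

Lemma msize_edge x y : msize (edge_mult x y) = 1.
Proof. by rewrite /msize -(sum_delta [set x; y] (fun=> 1)); apply: eq_bigr => e _; rewrite muln1. Qed.

Definition cycle_free l H :=
  forall c, uniq c -> size c = l -> ~ forall e, cycle_mult c e <= H e.

Lemma msize_cycle c : msize (cycle_mult c) = size c.
Proof.
case: c => [|x s]; first by rewrite /msize big1.
by transitivity (size (rcons s x)); [exact: msize_walk | rewrite size_rcons].
Qed.

Lemma peel_cycles l M : 0 < l -> exists D H,
  [/\ decomposable l D, cycle_free l H & forall e, M e = D e + H e].
Proof.
move=> l0; have [n] := ubnP (msize M); elim: n M => // n IH M Mn.
case: (boolP [exists c : l.-tuple V, uniq c && [forall e, cycle_mult c e <= M e]]) => [|no].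
  case/existsP=> c /andP[uc /forallP cM].
  have [M' ME] := ms_sub cM.
  have [|D [H [decD Hfree M'E]]] := IH M'.
    have : msize M = msize (cycle_mult c) + msize M' by rewrite -msizeD; apply: eq_msize.
    by rewrite msize_cycle size_tuple; lia.
  exists (fun e => cycle_mult c e + D e), H; split=> //.
    by apply: decomposableD => //; apply: decomposable_cycle => //; rewrite size_tuple.
  by move=> e; rewrite ME M'E addnA.
exists (fun=> 0), M; split=> //; first exact: decomposable0.
move=> c uc sc cM; case/negP: no; apply/existsP.
have sc' : size c == l by apply/eqP.
by exists (Tuple sc'); rewrite uc; apply/forallP.
Qed.

Fixpoint alternate (s t : seq V) : seq V :=
  if s is a :: s' then if t is b :: t' then a :: b :: alternate s' t' else [::] else [::].

Lemma perm_alternate s t : size s = size t -> perm_eq (alternate s t) (s ++ t).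
Proof.
elim: s t => [|a s IH] [|b t] //= [/IH st]; rewrite perm_cons.
apply: perm_trans (_ : perm_eq _ (b :: (s ++ t))) _; first by rewrite perm_cons.
by rewrite perm_sym -cat1s perm_catCA.
Qed.

Lemma path_alternate (r : rel V) x s t y : size s = size t ->
  {in s & t, forall a b, r a b && r b a} -> {in s, forall a, r x a} ->
  {in t, forall b, r b y} -> r x y -> path r x (rcons (alternate s t) y).
Proof.
elim: s t x => [|a s IH] [|b t] x //=; first by move=> _ _ _ _ ->.
move=> [st] Hst Hx Hy xy.
have /andP[ab _] := Hst a b (mem_head _ _) (mem_head _ _).
rewrite Hx ?mem_head // ab /=; apply: IH => //.
- by move=> a' b' a's b't; apply: Hst; rewrite inE ?a's ?b't orbT.
- move=> a' a's; have a's' : a' \in a :: s by rewrite inE a's orbT.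
  by have /andP[] := Hst a' b a's' (mem_head _ _).
- by move=> b' b't; apply: Hy; rewrite inE b't orbT.
- by apply: Hy; apply: mem_head.
Qed.

Definition support_rel H : rel V := fun a b => 0 < H [set a; b].

Lemma support_cycle H x s : uniq (x :: s) -> 1 < size s ->
  path (support_rel H) x (rcons s x) -> forall e, cycle_mult (x :: s) e <= H e.
Proof.
move=> /= /andP[xs us] s1 ps e; rewrite /cycle_mult.
case: (posnP (walk_mult x (rcons s x) e)) => [->//|gt0].
have [a [b [Hab ->]]] := walk_mult_gt0 ps gt0.
by apply: leq_trans Hab; apply: walk_mult_rcons_le1.
Qed.

Lemma complete_bipartite_cycle H (S T : {set V}) k : 1 < k ->
  [disjoint S & T] -> k <= #|S| -> k <= #|T| ->
  {in S & T, forall a b, 0 < H [set a; b]} -> ~ cycle_free (2 * k) H.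
Proof.
move=> k1 dST Sk Tk HST Hfree.
pose s := take k (enum S); pose t := take k (enum T).
have ss : size s = k by rewrite size_take -cardE; case: ltngtP Sk.
have st : size t = k by rewrite size_take -cardE; case: ltngtP Tk.
have sS a : a \in s -> a \in S by move/mem_take; rewrite mem_enum.
have tT b : b \in t -> b \in T by move/mem_take; rewrite mem_enum.
have us : uniq s by rewrite take_uniq // enum_uniq.
have ut : uniq t by rewrite take_uniq // enum_uniq.
have st_eq : size s = size t by rewrite ss.
have pm := perm_alternate st_eq.
have ualt : uniq (alternate s t).
  rewrite (perm_uniq pm) cat_uniq us ut andbT /=; apply/hasPn => b /tT bT.
  by apply/negP => /sS aS; move/disjointFr: dST => /(_ _ aS); rewrite bT.
have salt : size (alternate s t) = 2 * k by rewrite (perm_size pm) size_cat ss st; lia.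
apply: (Hfree (alternate s t) ualt salt).
have pal : forall a b s' t', s = a :: s' -> t = b :: t' ->
    path (support_rel H) a (rcons (b :: alternate s' t') a).
  move=> a b s' t' sE tE.
  have Hst : {in s & t, forall a b, support_rel H a b && support_rel H b a}.
    by move=> a' b' /sS aS /tT bT; rewrite /support_rel (setUC [set b']) HST.
  have /andP[ab ba] : support_rel H a b && support_rel H b a.
    by apply: Hst; rewrite ?sE ?tE mem_head.
  rewrite /= ab; apply: path_alternate.
  - by move: st_eq; rewrite sE tE => -[].
  - by move=> a' b' a's b't; apply: Hst; rewrite ?sE ?tE inE ?a's ?b't orbT.
  - move=> a' a's.
    have a'S : a' \in s by rewrite sE inE a's orbT.
    have bT : b \in t by rewrite tE mem_head.
    by have /andP[] := Hst a' b a'S bT.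
  - move=> b' b't.
    have aS : a \in s by rewrite sE mem_head.
    have b'T : b' \in t by rewrite tE inE b't orbT.
    by have /andP[] := Hst a b' aS b'T.
  - by [].
move: pal ualt salt; case: (s) ss => [|a s']; first by move: k1 => /[swap] /= <-.
case: (t) st => [|b t']; first by move: k1 => /[swap] /= <-.
move=> _ _ pal ualt salt; apply: support_cycle => //; last exact: pal.
by move: k1 salt; rewrite [size _]/= [size (b :: _)]/=; move: (size _) => z; lia.
Qed.

Definition heavy q H := [set v | #|V| < q * #|[set u | 0 < H [set v; u]]|].

(* Among 2qk heavy vertices, many outside vertices see at least k of them, and
   by pigeonhole many see the same ones: this gives a K_{k,k}. *)
Lemma few_heavy q k H : 1 < k -> 0 < q ->
  (forall v, H [set v; v] = 0) -> cycle_free (2 * k) H ->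
  2 * q * k * 2 ^ (2 * q * k) < #|V| -> #|heavy q H| < 2 * q * k.
Proof.
move=> k1 q0 Hvv Hfree Vbig; rewrite ltnNge; apply/negP => big.
pose m := 2 * q * k; pose nb v := [set u | 0 < H [set v; u]].
pose B := [set v in take m (enum (heavy q H))].
have cB : #|B| = m.
  rewrite cardsE (card_uniqP _) ?take_uniq ?enum_uniq //.
  by rewrite size_take -cardE; move: big; rewrite -/m; case: ltngtP.
have Bh v : v \in B -> #|V| < q * #|nb v|.
  by rewrite inE => /mem_take; rewrite mem_enum inE.
pose tp w := nb w :&: B.
have dbl : \sum_(w : V) #|tp w| = \sum_(v in B) #|nb v|.
  have cE (S : {set V}) : #|S| = \sum_v (v \in S).
    by rewrite -sum1_card big_mkcond /=; apply: eq_bigr => v _; case: (v \in S).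
  rewrite (eq_bigr _ (fun w _ => cE (tp w))) exchange_big [RHS]big_mkcond /=.
  apply: eq_bigr => v _; case: (boolP (v \in B)) => vB.
    by rewrite cE; apply: eq_bigr => w _; rewrite in_setI vB andbT !inE setUC.
  by rewrite big1 // => w _; rewrite in_setI (negbTE vB) andbF.
pose W := [set w | k <= #|tp w|].
have up : \sum_(w : V) #|tp w| <= k * #|V| + m * #|W|.
  rewrite (bigID (mem W)) /= addnC; apply: leq_add.
    apply: leq_trans (_ : \sum_(w : V | w \notin W) k <= _).
      by apply: leq_sum => w; rewrite inE -ltnNge => /ltnW.
    by rewrite sum_nat_const mulnC leq_mul2l max_card orbT.
  rewrite mulnC -sum_nat_const; apply: leq_sum => w _.
  by rewrite -cB subset_leq_card // subsetIr.
have low : m * #|V| <= q * \sum_(v in B) #|nb v|.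
  rewrite big_distrr /= -cB -sum_nat_const; apply: leq_sum => v /Bh; exact: ltnW.
(* From m|V| <= q(k|V| + m|W|) and m = 2qk follows k|V| <= m|W|, while |V| > m 2^m. Then some trace
   on B, one of 2^m, occurs more than k times. *)
have W1 : k * 2 ^ m < #|W|.
  rewrite ltnNge; apply/negP => Wle.
  have h1 : 2 * q * k * #|V| <= q * (k * #|V|) + q * (m * #|W|).
    by rewrite -mulnDr; apply: leq_trans low _; rewrite leq_mul2l -dbl up orbT.
  have h2 : q * (m * #|W|) <= q * (m * (k * 2 ^ m)) by rewrite !leq_mul2l Wle !orbT.
  have h3 : q * k * (m * 2 ^ m) < q * k * #|V|.
    by rewrite ltn_pmul2l // muln_gt0 q0; lia.
  have arith n' m' w P : 2 * q * k * n' <= q * (k * n') + q * (m' * w) ->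
      q * (m' * w) <= q * (m' * (k * P)) -> q * k * (m' * P) < q * k * n' -> False.
    by clear; lia.
  exact: arith h1 h2 h3.
have [T [TB Tbig]] : exists T : {set V}, T \subset B /\ k <= #|[set w in W | tp w == T]|.
  case: (pickP (fun T : {set V} => (T \subset B) && (k <= #|[set w in W | tp w == T]|))).
    by move=> T /andP[]; exists T.
  move=> none; move: W1; rewrite ltnNge => /negP[].
  rewrite -sum1_card (partition_big tp (mem (powerset B))) /=; last first.
    by move=> w _; rewrite powersetE subsetIr.
  rewrite mulnC -cB -card_powerset -sum_nat_const; apply: leq_sum => T; rewrite powersetE => TB.
  have := none T; rewrite TB /= => /negbT; rewrite -ltnNge => /ltnW.
  move=> hle; rewrite sum1_card; apply: leq_trans hle; apply: eq_leq.
  by apply: eq_card => w; rewrite [RHS]inE.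
set W' := [set w in W | tp w == T] in Tbig.
have W'T w : w \in W' -> w \in W /\ tp w = T by rewrite inE => /andP[? /eqP].
apply: (@complete_bipartite_cycle H T W' k k1 _ _ Tbig _ Hfree).
- rewrite disjoint_subset; apply/subsetP => v vT; rewrite inE; apply/negP => /W'T[_ vT'].
  by move: vT; rewrite -vT' !inE Hvv.
- have [w /W'T[wW wT]] : exists w, w \in W' by apply/card_gt0P; apply: leq_trans Tbig; lia.
  by rewrite -wT; move: wW; rewrite inE.
- by move=> a b aT /W'T[_ bT]; move: aT; rewrite -bT !inE setUC => /andP[].
Qed.

Definition loopless H := forall v, H [set v; v] = 0.
Definition on_edges H := forall e, 0 < H e -> exists x y, x != y /\ e = [set x; y].

Lemma edge_listing H : on_edges H -> exists l : seq (V * V),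
  (forall d, d \in l -> d.1 != d.2) /\
  forall e, H e = \sum_(d <- l) edge_mult d.1 d.2 e.
Proof.
have [n] := ubnP (msize H); elim: n H => // n IH H Hn Hon.
case: (pickP (fun e => 0 < H e)) => [e0 He0|none]; last first.
  by exists [::]; split=> // e; rewrite big_nil; have := none e; case: (H e).
have [x [y [xy E]]] := Hon _ He0.
have [|H' HE] := @ms_sub _ H (edge_mult x y).
  by move=> e; rewrite /edge_mult; case: eqP => //= ->; rewrite -E.
have [||l [l1 l2]] := IH H'.
- have : msize H = msize (edge_mult x y) + msize H' by rewrite -msizeD; apply: eq_msize.
  by rewrite msize_edge; lia.
- by move=> e H'e; apply: Hon; rewrite HE; lia.
exists ((x, y) :: l); split; first by move=> d; rewrite inE => /predU1P[->|/l1].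
by move=> e; rewrite big_cons HE l2.
Qed.

(* Edges at the vertices b of B are taken in pairs u b u', so that b itself is
   the end of few of the paths to be found, however large its degree. *)
Lemma fork_listing (B : {set V}) H : on_edges H -> (forall e, H e <= 1) ->
  exists (ps : seq (V * (V * V))) (l : seq (V * V)),
  [/\ forall d, d \in ps -> [/\ d.2.1 != d.2.2, d.1 != d.2.1 & d.1 != d.2.2],
      forall d, d \in l -> d.1 != d.2,
      forall e, H e = \sum_(d <- ps) (edge_mult d.1 d.2.1 e + edge_mult d.1 d.2.2 e)
                      + \sum_(d <- l) edge_mult d.1 d.2 e
    & forall v, \sum_(d <- ps) ((v == d.2.1) + (v == d.2.2))
                + \sum_(d <- l) ((v == d.1) + (v == d.2))
                <= if v \in B then #|B|.+1 else degree H v].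
Proof.
have [n] := ubnP (msize H); elim: n H => // n IH H Hn Hon H1.
case: (pickP (fun t : V * (V * V) => [&& t.1 \in B, t.2.1 \notin B, t.2.2 \notin B,
    t.2.1 != t.2.2 & (0 < H [set t.1; t.2.1]) && (0 < H [set t.1; t.2.2])])) => [[b [u u']]|none] /=.
  case/and5P=> bB uB u'B uu' /andP[Hbu Hbu'].
  have bu : b != u by apply: contraNneq uB => <-.
  have bu' : b != u' by apply: contraNneq u'B => <-.
  have [|H' HE] := @ms_sub _ H (fun e => edge_mult b u e + edge_mult b u' e).
    move=> e; rewrite /edge_mult; case: eqP => [->|_]; last by case: eqP => // ->.
    by rewrite pair_set_eq eqxx (negbTE uu') (negbTE bu') addn0.
  have [|||ps [l [ps1 l1 E ld]]] := IH H'.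
  - have : msize H = msize (edge_mult b u) + msize (edge_mult b u') + msize H'.
      by rewrite -!msizeD; apply: eq_msize.
    by rewrite !msize_edge; lia.
  - by move=> e H'e; apply: Hon; rewrite HE; lia.
  - by move=> e; have := H1 e; rewrite HE; lia.
  exists ((b, (u, u')) :: ps), l; split=> //.
  - by move=> d; rewrite inE => /predU1P[->|/ps1].
  - by move=> e; rewrite big_cons HE E /= !addnA.
  move=> v; rewrite big_cons /=; have := ld v.
  have dE : degree H v = degree (edge_mult b u) v + degree (edge_mult b u') v + degree H' v.
    by rewrite -!degreeD; apply: eq_degree.
  rewrite dE !degree_edge //; case: ifP => vB.
    have -> : (v == u) = false by apply: contraNF uB => /eqP <-.
    have -> : (v == u') = false by apply: contraNF u'B => /eqP <-.
    by [].
  move=> h; rewrite -addnA; apply: leq_trans (leq_add (leqnn _) h) _; lia.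
(* No fork is left: a vertex of B has at most one edge leaving B, hence degree at most |B| + 1. *)
have [l [l1 E]] := edge_listing Hon.
exists [::], l; split=> // [e|v]; first by rewrite big_nil E.
rewrite big_nil add0n.
have dE : degree H v = \sum_(d <- l) ((v == d.1) + (v == d.2)).
  rewrite (eq_degree _ E) degree_sum; apply: eq_big_seq => d dl.
  by rewrite degree_edge // l1.
rewrite -dE; case: ifP => // vB.
rewrite /degree (bigID (mem B)) /= -addn1; apply: leq_add.
  by rewrite -sum1_card; apply: leq_sum => u _.
case: (pickP (fun u => (u \notin B) && (0 < H [set v; u]))) => [u0 /andP[u0B Hu0]|nu]; last first.
  by rewrite big1 // => u uB; have := nu u; rewrite uB; case: (H _).
rewrite (bigD1 u0) //= big1 ?addn0 // => u /andP[uB uu0].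
have := none (v, (u, u0)); rewrite /= vB uB u0B uu0 Hu0 /= andbT.
by case: (H _).
Qed.
End Leftovers.

Lemma graph_mult_vv (V : finType) (adj : rel V) v :
  irreflexive adj -> graph_mult adj [set v; v] = 0.
Proof.
move=> irr; rewrite /graph_mult; case: existsP => // -[x /existsP[y /andP[xy]]].
rewrite pair_set_eq => /orP[] /andP[/eqP E1 /eqP E2]; by rewrite -E1 -E2 irr in xy.
Qed.

Lemma degree_graph (V : finType) (adj : rel V) v :
  symmetric adj -> degree (graph_mult adj) v = #|[set u | adj v u]|.
Proof.
move=> sadj; rewrite card_setE; apply: eq_bigr => u _; exact: graph_multP.
Qed.

Lemma graph_on_edges (V : finType) (adj : rel V) (H : {set V} -> nat) :
  irreflexive adj -> (forall e, H e <= graph_mult adj e) -> on_edges H.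
Proof.
move=> irr Hle e He; have : 0 < graph_mult adj e by apply: leq_trans He (Hle e).
rewrite /graph_mult; case: existsP => // -[x /existsP[y /andP[xy /eqP ->]]] _.
by exists x, y; split=> //; apply: contraTneq xy => ->; rewrite irr.
Qed.

(** [adj] will be the sparse graph, while [H] comes from the rest. A fork u b u' is closed by a path
    of length 2k - 2 avoiding b, a single edge by one of length 2k - 1. Light vertices have few path
    ends by their degree, the boundedly many heavy ones thanks to the forks. *)
Lemma leftover_covered k q : 0 < q -> 4 <= k -> exists n0, forall (V : finType) (adj : rel V),
  irreflexive adj ->
  (forall L, 4 <= L <= 2 * k -> robustly_connected adj q L) ->
  n0 <= #|V| ->
  forall H : {set V} -> nat, on_edges H -> (forall e, H e <= 1) -> loopless H ->
  cycle_free (2 * k) H ->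
  exists U : {set V} -> nat, (forall e, U e <= graph_mult adj e) /\
    decomposable (2 * k) (fun e => H e + U e).
Proof.
move=> q0 k4.
have k3 : 3 <= 2 * k - 2 by lia.
have [qd [nd embd]] := robust_embedding (2 * k - 1) 1 0 q0 k3.
pose q1 := qd.+1.
exists (nd + (2 * q1 * k * 2 ^ (2 * q1 * k)).+1 + (2 * q1 * k) * qd).
move=> V adj irr conn nV H Hon H1 Hvv Hfree.
have k1 : 1 < k by lia.
have := @few_heavy V q1 k H k1 isT Hvv Hfree; set B := heavy q1 H => few.
have {few} cB : #|B| < 2 * q1 * k by apply: few; move: nV; move: (_ ^ _); lia.
have [ps [l [ps1 l1 HE ld]]] := fork_listing B Hon H1.
pose D := ('I_(size ps) + 'I_(size l))%type.
pose P (i : 'I_(size ps)) := tnth (in_tuple ps) i.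
pose Q (i : 'I_(size l)) := tnth (in_tuple l) i.
have Pin i : P i \in ps by apply: mem_tnth.
have Qin i : Q i \in l by apply: mem_tnth.
pose x (d : D) := match d with inl i => (P i).2.1 | inr i => (Q i).1 end.
pose y (d : D) := match d with inl i => (P i).2.2 | inr i => (Q i).2 end.
pose L (d : D) := if d is inl _ then 2 * k - 2 else 2 * k - 1.
pose S (d : D) : {set V} := if d is inl i then [set (P i).1] else set0.
have sumP (f : V * (V * V) -> nat) : \sum_(d <- ps) f d = \sum_i f (P i).
  by rewrite (big_tnth _ _ ps).
have sumQ (f : V * V -> nat) : \sum_(d <- l) f d = \sum_i f (Q i).
  by rewrite (big_tnth _ _ l).
have [|||||||g [g1 g2 g3 g4]] := embd V adj irr _ _ D setT x y L S (fun=> 0).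
- by move=> L' L'r; apply: conn; lia.
- by move: nV; move: (_ ^ _); lia.
- by move=> [i|i] _ /=; lia.
- by move=> [i|i] _ /=; rewrite ?cards1 ?cards0.
- by move=> v; rewrite /degree big1.
- move=> v.
  have -> : \sum_(d in [set: D]) ((v == x d) + (v == y d))
     = \sum_(d <- ps) ((v == d.2.1) + (v == d.2.2)) + \sum_(d <- l) ((v == d.1) + (v == d.2)).
    rewrite sumP sumQ (eq_bigl xpredT) => [|d]; last by rewrite in_setT.
    by rewrite big_sumType.
  apply: leq_trans (leq_mul (ld v) (leqnn _)) _; case: ifP => vB.
    apply: leq_trans (_ : 2 * q1 * k * qd <= _); first by rewrite leq_mul2r cB orbT.
    by move: nV; move: (_ ^ _); lia.
  move: vB; rewrite inE => /negbT; rewrite -leqNgt => hv; apply: leq_trans hv.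
  rewrite mulnC; apply: leq_mul => //.
  rewrite /degree -sum1_card [X in _ <= X]big_mkcond /=; apply: leq_sum => u _.
  by rewrite inE; have := H1 [set v; u]; case: (H _) => [|[|h]].
- by [].
exists (fun e => \sum_d token_mult x y g d e); split.
  move=> e; apply: leq_trans (g3 e); rewrite add0n; apply: eq_leq.
  by apply: eq_bigl => d; rewrite in_setT.
pose cyc (d : D) := match d with
  | inl i => (P i).1 :: (P i).2.1 :: rcons (g d) (P i).2.2
  | inr i => (Q i).1 :: rcons (g d) (Q i).2 end.
apply: decomposable_ext (decomposable_sum (index_enum D) (P := xpredT)
  (M := fun d => cycle_mult (cyc d)) _).
  move=> e; rewrite !big_sumType HE sumP sumQ /= addnACA -!big_split /=; congr (_ + _);
    apply: eq_bigr => i _; rewrite /cycle_mult /token_mult /=.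
    by rewrite walk_mult_rcons last_rcons [edge_mult (P i).2.2 _ _]edge_multC addnA addnAC.
  by rewrite walk_mult_rcons last_rcons [edge_mult (Q i).2 _ _]edge_multC addnC.
move=> d _; have [sz uq av _] := g1 d (in_setT d).
apply: decomposable_cycle; last by case: d sz {uq av} => i /= sz; rewrite size_rcons sz; lia.
case: d sz uq av => i sz uq av /=.
  have [n1 n2 n3] := ps1 _ (Pin i).
  rewrite inE !mem_rcons !inE rcons_uniq uq !negb_or n1 n2 n3 /= andbT.
  apply/and3P; split; apply/negP => /av[] /=; rewrite ?inE ?eqxx //.
have n1 := l1 _ (Qin i).
rewrite mem_rcons inE rcons_uniq uq negb_or n1 /= andbT.
by apply/andP; split; apply/negP => /av[] /=; rewrite ?eqxx.
Qed.

Theorem linked_graph_decomposable k q0 : 0 < q0 -> 4 <= k ->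
  exists n0, forall (V : finType) (adj : rel V),
  symmetric adj -> irreflexive adj -> n0 <= #|V| -> linked adj q0 ->
  (k = 4 -> half_linked adj q0) ->
  (forall v, ~~ odd (degree (graph_mult adj) v)) ->
  2 * k %| msize (graph_mult adj) ->
  decomposable (2 * k) (graph_mult adj).
Proof.
move=> q00 k4.
have [qc [nc [qc0 connc]]] := linked_connected_all (2 * k) q00.
have q_gt0 : 0 < qc + 8 * q0 by lia.
have [qe [ne abs]] := edge_absorber q_gt0 k4.
have [q1 [n1 [q10 sparse]]] := sparse_linked_subgraph qe q00.
have [qs [ns [qs0 conns]]] := linked_connected_all (2 * k) q10.
have [nd cover] := leftover_covered qs0 k4.
exists (nc + 8 * q0 + ne + n1 + ns + nd) => V adj sadj irr nV lk hlk ev dv.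
have conn L : k.-1 <= L <= 2 * k -> robustly_connected adj (qc + 8 * q0) L.
  move=> Lr; case: (ltnP 3 L) => L4.
    apply: (robustly_connectedW (q := qc)); first by lia.
    by apply: connc => //; lia.
  have [k4' ->] : k = 4 /\ L = 3 by lia.
  apply: (robustly_connectedW (q := 8 * q0)); first by lia.
  by apply: half_linked_connected => //; [lia | apply: hlk].
have [|adj0 [sadj0 sub0 lk0 deg0]] := sparse V adj sadj _ lk; first by lia.
have irr0 : irreflexive adj0 by move=> v; apply: contraFF (irr v) => /sub0.
have conn0 L : 4 <= L <= 2 * k -> robustly_connected adj0 qs L.
  by apply: conns => //; lia.
have [l [l1 lE]] := @edge_listing V (graph_mult adj0)
  (graph_on_edges irr0 (fun e => leqnn _)).
pose tl i := (tnth (in_tuple l) i).1; pose hd i := (tnth (in_tuple l) i).2.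
have tl_hd i : tl i != hd i by apply: l1; apply: mem_tnth.
have E0 e : edges_mult tl hd e = graph_mult adj0 e.
  by rewrite lE (big_tnth _ _ l).
have le0 e : graph_mult adj0 e <= graph_mult adj e.
  rewrite /graph_mult; case: existsP => // -[x /existsP[y /andP[xy exy]]].
  by case: existsP => // -[]; exists x; apply/existsP; exists y; rewrite (sub0 _ _ xy).
have [|||A [Ale Aabs]] := abs V adj irr conn _ (size l) tl hd tl_hd.
- by lia.
- by move=> e; rewrite E0.
- by move=> v; rewrite (eq_degree v E0) degree_graph.
have [R RE] := ms_sub Ale.
have k20 : 0 < 2 * k by lia.
have [D [H [decD Hfree REDH]]] := peel_cycles R k20.
have Hle e : H e <= graph_mult adj e by rewrite RE REDH; lia.
have [||||U [Ule decHU]] := cover V adj0 irr0 conn0 _ H _ _ _ Hfree.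
- by lia.
- exact: graph_on_edges irr Hle.
- by move=> e; apply: leq_trans (Hle e) (graph_mult_le1 _ _).
- by move=> v; have := Hle [set v; v]; rewrite graph_mult_vv // leqn0 => /eqP.
pose z i := U [set tl i; hd i] == 0.
(* [U] and the multiset of E0 take values at most 1, so E0 splits exactly by whether [U]
   vanishes. *)
have subE e : graph_mult adj0 e = U e + sub_edges_mult tl hd z e.
  have -> : sub_edges_mult tl hd z e = (U e == 0) * edges_mult tl hd e.
    rewrite /sub_edges_mult /edges_mult big_distrr; apply: eq_bigr => i _.
    rewrite /edge_mult /z; case: (e =P [set tl i; hd i]) => [->|_] //. by rewrite muln0 [RHS]muln0.
  rewrite E0; have := Ule e; have := graph_mult_le1 adj0 e.
  by case: (U e) => [|[|n]]; case: (graph_mult adj0 e) => [|[|n']].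
(* Absorbing the empty remainder shows that [A] decomposes by itself, so it has even degrees and a
   number of edges divisible by 2k. *)
have decA : decomposable (2 * k) A.
  apply: decomposable_ext (Aabs (fun=> false) _ _).
  - by move=> e; rewrite /sub_edges_mult big1.
  - by move=> v; rewrite (@eq_degree _ _ (fun=> 0)) /degree ?big1 // => e; rewrite /sub_edges_mult big1.
  - by rewrite big1.
have total e : graph_mult adj e = D e + (H e + U e) + (sub_edges_mult tl hd z e + A e).
  by rewrite RE REDH E0 subE; lia.
have k22 : 2 < 2 * k by lia.
(* Evenness and divisibility of the remainder follow by subtracting the decomposable parts D, H + U
   and A from the whole graph. *)
have decS : decomposable (2 * k) (fun e => sub_edges_mult tl hd z e + A e).
  apply: Aabs.
    move=> v; have := ev v; rewrite (eq_degree v total) (degreeD (fun e => D e + (H e + U e))).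
    rewrite (degreeD D) (degreeD _ A) !oddD (negbTE (decomposable_even_degree v k22 decD)).
    rewrite (negbTE (decomposable_even_degree v k22 decHU)).
    by rewrite (negbTE (decomposable_even_degree v k22 decA)) !addFb addbF.
  have -> : \sum_i z i = msize (sub_edges_mult tl hd z).
    rewrite /msize exchange_big /=; apply: eq_bigr => i _.
    by rewrite -big_distrr /= -/(msize _) msize_edge muln1.
  move: dv; rewrite (eq_msize total) (msizeD (fun e => D e + (H e + U e))) (msizeD D).
  rewrite (msizeD _ A) dvdn_addr; last by rewrite dvdn_add // msize_decomposable.
  by rewrite dvdn_addl // msize_decomposable.
apply: decomposable_ext (decomposableD (decomposableD decD decHU) decS) => e.
by rewrite total.
Qed.

(** * From multisets to partitions, and expanders *)

Section CycleCopies.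
Variable V : finType.
Implicit Types (x : V) (s c : seq V) (e : {set V}).

Lemma path_mem (r : rel V) x s : path r x s ->
  path (fun a b => (a \in x :: s) && r a b) x s.
Proof.
move=> /(pathP x) H; apply/(pathP x) => i si; rewrite H // andbT.
by rewrite mem_nth // ltnW.
Qed.

Definition cycle_edges c : {set {set V}} := [set [set x; next c x] | x in c].

Lemma cycle_edgesP c e : uniq c -> (e \in cycle_edges c) = (0 < cycle_mult c e).
Proof.
case: c => [|x s] uc; first by apply/imsetP => -[].
have pn : path (frel (next (x :: s))) x (rcons s x) by have := cycle_next uc.
apply/imsetP/idP => [[z zc ->]|gt0].
  rewrite /cycle_mult (walk_mult_nth x).
  have iz : index z (x :: s) < size (rcons s x) by rewrite size_rcons -[X in _ < X]/(size (x :: s)) index_mem.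
  rewrite (bigD1 (Ordinal iz)) //= addn_gt0.
  have /(pathP x)/(_ _ iz)/eqP := pn.
  have -> : nth x (x :: rcons s x) (index z (x :: s)) = z.
    by rewrite -rcons_cons nth_rcons index_mem zc nth_index.
  by move=> <-; apply/orP; left; rewrite /edge_mult lt0b; apply/eqP.
have [a [b [/andP[ac /eqP nb] ->]]] := walk_mult_gt0 (path_mem pn) gt0.
exists a; last by rewrite nb.
by move: ac; rewrite !inE mem_rcons inE => /orP[->|].
Qed.
End CycleCopies.

Lemma graph_mult_edges (G : sgraph) e : graph_mult (@adj G) e = (e \in edges G).
Proof.
rewrite /graph_mult; congr nat_of_bool; apply/existsP/imset2P.
  case=> x /existsP[y /andP[xy /eqP ->]]; exists x y => //; by rewrite inE.
case=> x y _; rewrite inE => xy ->; exists x; apply/existsP; exists y.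
by rewrite xy eqxx.
Qed.

(** The multiset of the graph is at most 1, so an edge lies on at most one cycle of the list, and
    every cycle stays in the graph. *)
Lemma decomposition_of_multiset (G : sgraph) l : 2 < l ->
  decomposable l (graph_mult (@adj G)) -> has_cycle_decomposition l G.
Proof.
move=> l2 [cs /allP csP E].
have cs_u c : c \in cs -> uniq c by case/csP/andP.
have cs_s c : c \in cs -> size c = l by case/csP/andP => _ /eqP.
have cs_le c e : c \in cs -> cycle_mult c e <= graph_mult (@adj G) e.
  by move=> ccs; rewrite E (big_rem c) //= leq_addr.
exists [set B in [seq cycle_edges c | c <- cs]]; split; last first.
  move=> B; rewrite inE => /mapP[c ccs ->]; split=> //; exists c; split=> //.
    exact: cs_s.
  rewrite /ucycle cs_u // andbT; case: c ccs (cs_le c) => [//|x s] ccs cle.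
  by apply: walk_mult_le_graph => [|e]; [exact: adj_sym | apply: cle].
apply/and3P; split.
- apply/eqP/setP => e; apply/bigcupP/idP => [[B]|ee].
    rewrite inE => /mapP[c ccs ->]; rewrite cycle_edgesP ?cs_u // => gt0.
    have := leq_trans gt0 (cs_le c e ccs); rewrite graph_mult_edges; by case: (e \in _).
  have : 0 < graph_mult (@adj G) e by rewrite graph_mult_edges ee.
  rewrite E => gt0.
  have /hasP[c ccs cgt0] : has (fun c => 0 < cycle_mult c e) cs.
    apply/negPn/negP => /hasPn none; move: gt0; rewrite big_seq big1 // => c /none.
    by case: (cycle_mult c e).
  by exists (cycle_edges c); [rewrite inE map_f | rewrite cycle_edgesP ?cs_u].
- apply/trivIsetP => A B; rewrite !inE => /mapP[c ccs ->] /mapP[c' c'cs ->] AB.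
  rewrite disjoint_subset; apply/subsetP => e; rewrite inE !cycle_edgesP ?cs_u // => ce.
  apply/negP => c'e; have cc' : c' != c by apply: contraNneq AB => ->.
  have : graph_mult (@adj G) e <= 1 by apply: graph_mult_le1.
  rewrite E (big_rem c) //= (big_rem c') //=; first by lia.
  by rewrite rem_mem.
- rewrite inE; apply/mapP => -[c ccs /esym E0].
  case: c ccs E0 => [/cs_s /= E0|x s _ /setP/(_ [set x; next (x :: s) x])]; first by lia.
  by rewrite inE; move/imsetP => []; exists x; rewrite ?mem_head.
Qed.

Import Order.TTheory GRing.Theory Num.Theory.
Local Open Scope ring_scope.

Section ExpanderLinked.
Variables (R : realType) (nu : R) (G : sgraph) (q : nat).
Hypothesis nu_gt0 : 0 < nu.
Hypothesis nuq : 1 <= nu * q%:R.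

Lemma nat_bound_of_density (a : nat) :
  nu * #|G|%:R <= a%:R -> (#|G| <= q * a)%N.
Proof.
move=> h; rewrite -(ler_nat R) natrM.
have h1 : nu * #|G|%:R * q%:R <= a%:R * q%:R by rewrite ler_wpM2r.
have h2 : #|G|%:R <= nu * q%:R * #|G|%:R :> R by rewrite ler_peMl.
by rewrite mulrC; apply: le_trans h1; rewrite mulrAC.
Qed.

Lemma robust_codeg (x v : G) :
  v \in robust_nbhd nu (nbhd x) -> (#|G| <= q * codeg (@adj G) x v)%N.
Proof.
rewrite inE => /nat_bound_of_density; rewrite /deg_in /codeg.
suff -> : nbhd v :&: nbhd x = [set u | adj x u && adj v u] by [].
by apply/setP => u; rewrite !inE andbC.
Qed.

Lemma card_setI_lower (A B : {set G}) :
  #|G|%:R + nu * #|G|%:R <= #|A|%:R + #|B|%:R :> R -> (#|G| <= q * #|A :&: B|)%N.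
Proof.
move=> h; apply: nat_bound_of_density.
have : (#|A :|: B| <= #|G|)%N by apply: max_card.
rewrite cardsU -(ler_nat R) natrB; last first.
  by apply: leq_trans (subset_leq_card (subsetIl A B)) (leq_addr _ _).
by rewrite natrD; lra.
Qed.

Hypothesis G_exp : expander nu G.

(** The robust neighbourhoods of N(x) and N(y) each exceed half of the vertices by nu n, hence
    overlap in linearly many; each of their members has linear codegree with x, respectively y. *)
Lemma expander_linked : linked (@adj G) q.
Proof.
move=> x y; have hx := G_exp x; have hy := G_exp y.
have n0 : 0 <= nu * #|G|%:R by rewrite mulr_ge0 // ltW.
apply: leq_trans (card_setI_lower (A := robust_nbhd nu (nbhd x))
  (B := robust_nbhd nu (nbhd y)) _) _.
  by move: hx hy; rewrite /expanding; lra.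
rewrite leq_mul2l; apply/orP; right; apply: subset_leq_card; apply/subsetP => b.
by rewrite !inE => /andP[bx b_y]; rewrite !robust_codeg // inE.
Qed.

(** N(y) replaces one robust neighbourhood: with half of the vertices it still meets the other one
    in at least nu n. *)
Lemma expander_half_linked : #|G|%:R / 2 <= (min_degree G)%:R :> R ->
  half_linked (@adj G) q.
Proof.
move=> hmin x y; have hx := G_exp x.
have md : (min_degree G <= #|nbhd y|)%N.
  rewrite /min_degree; move: (mem_index_enum y); elim: (index_enum G) => // z s IH.
  rewrite inE big_cons => /predU1P[->|/IH h]; first exact: geq_minl.
  exact: leq_trans (geq_minr _ _) h.
apply: leq_trans (card_setI_lower (A := nbhd y) (B := robust_nbhd nu (nbhd x)) _) _.
  by move: hx hmin md; rewrite /expanding -(ler_nat R); lra.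
rewrite leq_mul2l; apply/orP; right; apply: subset_leq_card; apply/subsetP => b.
by rewrite !inE => /andP[yb bx]; rewrite yb robust_codeg // inE.
Qed.
End ExpanderLinked.

Theorem theorem5p2 (R : realType) (k : nat) (hk : (4 <= k)%N)
    (nu : R) (hnu : 0 < nu) :
  exists n0 : nat, forall (n : nat) (G : sgraph),
    (n0 <= n)%N ->
    #|G| = n ->
    cycle_divisible (2 * k)%N G ->
    expander nu G ->
    (k = 4%N -> n%:R / 2 <= (min_degree G)%:R :> R) ->
    has_cycle_decomposition (2 * k)%N G.
Proof.
(* A natural number above 1/nu turns the real density into the inverse densities used so far. *)
pose q := Num.bound nu^-1.
have nuq : 1 <= nu * q%:R.
  rewrite -[leLHS](divff (lt0r_neq0 hnu)) ler_pM2l //.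
  by apply/ltW/archi_boundP; rewrite invr_ge0 ltW.
have q0 : (0 < q)%N by case: q nuq => //; rewrite mulr0 ler10.
have [n0 main] := linked_graph_decomposable q0 hk.
exists n0 => n G n0n Gn [Gdvd Geven] Gexp Gmin.
have sadj := @adj_sym G; have irr := @adj_irrefl G.
apply: decomposition_of_multiset; first by lia.
apply: main => //.
- by rewrite Gn.
- exact: expander_linked hnu nuq Gexp.
- by move=> /Gmin hmin; apply: expander_half_linked nuq Gexp _; rewrite Gn.
- by move=> v; rewrite degree_graph //; apply: Geven.
- suff -> : msize (graph_mult (@adj G)) = #|edges G| by [].
  rewrite -sum1_card [RHS]big_mkcond /=; apply: eq_bigr => e _.
  by rewrite graph_mult_edges; case: (e \in _).
Qed.
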